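(* There is an algorithm which, given a positive integer $t$ and an $n$-vertex graph $G$ with no $K_t$-immersion, lists all maximal cliques of $G$ in time at most $n\cdot 3^{t/3+o(t)}$. Furthermore, this bound is asymptotically sharp up to the $o(t)$ term in the exponent when $n\ge t$: for all sufficiently large $t$ and all $n\ge t$ there exists an $n$-vertex graph with no $K_t$-immersion that has at least $n\cdot 3^{t/3-o(t)}$ maximal cliques.
   Context: Graphs are finite, simple and undirected. $K_t$ is the complete graph on $t$ vertices. An immersion of a graph $H$ in $G$ (in the strong sense, used throughout) consists of an injective map $\phi$ from $V(H)$ to $V(G)$, whose image is the set of branch vertices, together with, for each edge $uv$ of $H$, a path in $G$ between $\phi(u)$ and $\phi(v)$, such that these paths are pairwise edge-disjoint and no branch vertex is an internal vertex of any of these paths. $G$ has no $K_t$-immersion if there is no such immersion of $K_t$ in $G$. A clique of $G$ is a set of pairwise adjacent vertices; it is a maximal clique if it is not properly contained in another clique. To list all maximal cliques means to output exactly the maximal cliques of $G$, each of them once. Running time is worst-case time of a deterministic algorithm in the standard RAM model, with the graph given by adjacency lists. The notation $o(t)$ stands for a function of $t$ alone (independent of $n$ and $G$) whose quotient by $t$ tends to $0$ as $t\to\infty$ (the two occurrences may be different functions). *)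

(* Defs.v *)
From mathcomp Require Import all_boot.

Set Implicit Arguments.
Unset Strict Implicit.
Unset Printing Implicit Defensive.

Definition simple_graph (V : finType) (e : rel V) : Prop :=
  symmetric e /\ irreflexive e.

Definition complete_graph (t : nat) : rel 'I_t := fun u v => u != v.

Definition clique (V : finType) (e : rel V) : pred {set V} :=
  fun C => [forall x in C, forall y in C, (x != y) ==> e x y].

Definition maximal_cliques (V : finType) (e : rel V) : {set {set V}} :=
  [set C | maxset (clique e) C].

(* Edges and paths are undirected: an edge is a two-element set of vertices,
   and a path, given by its sequence of vertices, may be traversed from either
   end. *)
Definition edges (V : finType) (e : rel V) : {set {set V}} :=
  [set [set z.1; z.2] | z : V * V & e z.1 z.2].

Definition path_between (V : finType) (e : rel V) (a b : V) (s : seq V) : bool :=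
  if s is x :: p
  then [&& path e x p, uniq s & [set x; last x p] == [set a; b]]
  else false.

Definition path_edges (V : finType) (s : seq V) : {set {set V}} :=
  [set [set z.1; z.2] | z in zip s (behead s)].

Definition inner_vertices (V : finType) (s : seq V) : seq V :=
  if s is x :: p then behead (belast x p) else [::].

(* [P] assigns a path of the host graph [e] to every edge of [h]; its values
   outside [edges h] are irrelevant. *)
Definition is_immersion (U V : finType) (h : rel U) (e : rel V)
    (phi : U -> V) (P : {set U} -> seq V) : Prop :=
  [/\ injective phi,
      forall u v, h u v -> path_between e (phi u) (phi v) (P [set u; v]),
      forall E F, E \in edges h -> F \in edges h -> E != F ->
        [disjoint path_edges (P E) & path_edges (P F)]
    & forall E w, E \in edges h -> phi w \notin inner_vertices (P E)].

Definition has_immersion (U V : finType) (h : rel U) (e : rel V) : Prop :=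
  exists (phi : U -> V) (P : {set U} -> seq V), is_immersion h e phi P.

(* Random access machine: registers and an addressable memory, both holding
   natural numbers, and a write-only output tape. The operands of the
   instructions are register numbers, except for the constant of [IConst] and
   the jump targets. *)
Inductive instr : Type :=
| IConst of nat & nat          (* r := k *)
| ICopy of nat & nat           (* r := a *)
| IAdd of nat & nat & nat      (* r := a + b *)
| ISub of nat & nat & nat      (* r := a - b, truncated at 0 *)
| IMul of nat & nat & nat      (* r := a * b *)
| IDiv of nat & nat & nat      (* r := a %/ b, with a %/ 0 = 0 *)
| ILoad of nat & nat           (* r := memory[a] *)
| IStore of nat & nat          (* memory[a] := b *)
| IJump of nat
| IJumpZ of nat & nat          (* jump to the target if a = 0 *)
| IWrite of nat
| IHalt.

Definition program := seq instr.

Record config := Config {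
  pc : nat;
  regs : nat -> nat;
  memory : nat -> nat;
  output : seq nat
}.

(* Leaving the program text halts the machine. *)
Definition current (p : program) (c : config) : instr := nth IHalt p (pc c).

Definition halted (p : program) (c : config) : bool :=
  if current p c is IHalt then true else false.

Definition step (p : program) (c : config) : config :=
  let: Config i rg m o := c in
  let set_reg r x := Config i.+1 [eta rg with r |-> x] m o in
  match current p c with
  | IConst r k => set_reg r k
  | ICopy r a => set_reg r (rg a)
  | IAdd r a b => set_reg r (rg a + rg b)
  | ISub r a b => set_reg r (rg a - rg b)
  | IMul r a b => set_reg r (rg a * rg b)
  | IDiv r a b => set_reg r (rg a %/ rg b)
  | ILoad r a => set_reg r (m (rg a))
  | IStore a b => Config i.+1 rg [eta m with rg a |-> rg b] o
  | IJump l => Config l rg m o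
  | IJumpZ a l => Config (if rg a == 0 then l else i.+1) rg m o
  | IWrite a => Config i.+1 rg m (rcons o (rg a))
  | IHalt => c
  end.

Definition initial (input : seq nat) : config :=
  Config 0 (fun=> 0) (nth 0 input) [::].

Definition run (p : program) (input : seq nat) (k : nat) : config :=
  iter k (step p) (initial input).

Definition fits_in (w : nat) (c : config) : Prop :=
  forall i, regs c i <= w /\ memory c i <= w.

(* [p] halts on [input] with output [out] after [k] unit-cost steps, all the
   numbers occurring in the computation being at most [w]. *)
Definition computes (p : program) (w : nat) (input out : seq nat) (k : nat) :
    Prop :=
  [/\ halted p (run p input k),
      output (run p input k) = out
    & forall j, j <= k -> fits_in w (run p input j)].

Definition adjacency_lists (n : nat) (e : rel 'I_n) (adj : 'I_n -> seq 'I_n) :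
    Prop :=
  forall v, uniq (adj v) /\ adj v =i e v.

(* Memory layout: cell 0 holds t, cell 1 holds n, and the neighbours of vertex
   v are stored in the cells from memory[2 + v] included to memory[2 + v + 1]
   excluded. *)
Definition encode_input (t n : nat) (adj : 'I_n -> seq 'I_n) : seq nat :=
  let lists := [seq [seq val u | u <- adj v] | v <- enum 'I_n] in
  [:: t, n, n + 3 & scanl addn (n + 3) [seq size l | l <- lists]]
    ++ flatten lists.

(* Each clique is written as its size followed by its vertices. *)
Definition encode_output (n : nat) (L : seq (seq 'I_n)) : seq nat :=
  flatten [seq size s :: [seq val x | x <- s] | s <- L].

Definition lists_maximal_cliques (n : nat) (e : rel 'I_n)
    (L : seq (seq 'I_n)) : Prop :=
  all uniq L /\
  perm_eq [seq [set x in s] | s <- L] (enum (maximal_cliques e)).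

(* Main.v *)
(* Upper bound. A graph whose vertices all have more than 6 t^2 neighbours
   contains a highly connected piece, hence by Menger's theorem t^2 disjoint paths
   from one vertex u to the neighbourhoods of t branch vertices, and K_t is
   immersed through u. So vertices of degree at most 6 t^2 can be removed one by
   one, and the cliques through v whose other vertices are removed after v live
   in a set R of at most 6 t^2 vertices. Inside R one branches on whether the
   vertex with the most non-neighbours belongs to the clique. In a set of N
   vertices with at most d N non-neighbours each, where N (1 - 4 d) >= t, the
   edges missing between t branch vertices can be replaced greedily by
   edge-disjoint paths of length 2; so as long as the set is larger than
   t / (1 - 4 d), a chosen vertex divides its size by 1 / (1 - d), which happens
   only O(log t / d) times and costs a factor 2^(O(log^2 t / d)). Below that size,
   a weighted form of the Moon-Moser bound leaves at most 3^(N/3) branches.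
   Taking 1 / d of order t^(1/4) gives 3^(t/3 + o(t)) for each vertex.

   Lower bound. Take disjoint copies of the complete multipartite graph
   K_{3,...,3} on less than t vertices. *)
Require Import Defs.
From mathcomp Require Import all_boot.
From mathcomp Require Import zify.

Set Implicit Arguments.
Unset Strict Implicit.
Unset Printing Implicit Defensive.

(** * Immersions of complete graphs *)

(** The time must be linear in [n], yet every clique found in [R] has to be compared with all
    neighbours of [v], the removed ones included, and these may be many. On average they are few:
    degeneracy bounds the sum of all degrees by [12 t^2 n]. The adjacency matrix has [n^2] cells,
    but the memory starts at zero and only the edges are written. The order of removal comes from a
    queue of the vertices whose remaining degree has dropped to [6 t^2].

    The relation [branching] separates the two halves of the upper bound: the program is shown to
    realise some derivation of it in time proportional to the number of leaves, and the leaves of an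
    arbitrary derivation are counted independently of the program.

    The exponent [1/4] balances two errors. With [1 / d] of order [z], the enlarged threshold costs
    [O(t / z)] in the exponent. The branching above the threshold costs [O(z log^2 t)], and the
    crude bound [log t = O(z)] turns this into [O(z^3)]. Both agree when [z] is of order
    [t^(1/4)]. *)

Definition relimage (X Y : finType) (r : X -> Y -> bool) (W : {set X}) :
    {set Y} :=
  [set y | [exists x in W, r x y]].

Lemma relimageU (X Y : finType) (r : X -> Y -> bool) (U W : {set X}) :
  relimage r (U :|: W) = relimage r U :|: relimage r W.
Proof.
apply/setP=> y; rewrite !inE; apply/exists_inP/orP.
  case=> x /setUP[] xP rxy; [left | right]; apply/exists_inP; exists x => //.
by case=> /exists_inP[x xP rxy]; exists x; rewrite // inE xP ?orbT.
Qed.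

Lemma relimageDr (X Y : finType) (r : X -> Y -> bool) (W : {set X})
    (B : {set Y}) :
  relimage (fun x y => r x y && (y \notin B)) W = relimage r W :\: B.
Proof.
apply/setP=> y; rewrite !inE; apply/exists_inP/andP.
  by case=> x xW /andP[rxy yB]; split=> //; apply/exists_inP; exists x.
by case=> yB /exists_inP[x xW rxy]; exists x; rewrite // rxy.
Qed.

(** Induction on [#|A|]. If a proper nonempty subset [W] is tight, it is matched inside its image
    and the rest of [A] outside of it; tightness preserves Hall's condition for the rest. If none is
    tight, any edge at any [x] can be used up, since the loss of one vertex of [Y] is affordable.
    [y0] is a default value. *)
Theorem hall (X Y : finType) (y0 : Y) (r : X -> Y -> bool) (A : {set X}) :
  (forall W : {set X}, W \subset A -> #|W| <= #|relimage r W|) ->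
  exists f : X -> Y,
    {in A &, injective f} /\ {in A, forall x, r x (f x)}.
Proof.
have [k] := ubnP #|A|; elim: k A r => // k IHk A r /ltnSE leAk hallA.
have [->|/set0Pn[x xA]] := eqVneq A set0.
  by exists (fun=> y0); split=> [x y | x]; rewrite inE.
have [/existsP[W /and4P[sWA W0 neWA /eqP eqW]]|] :=
    boolP [exists W : {set X}, [&& W \subset A, W != set0, W != A
                                & #|W| == #|relimage r W|]].
  have ltWA : #|W| < #|A| by rewrite proper_card // properEneq neWA.
  have [||f [f_inj f_r]] := IHk W r; first exact: leq_trans ltWA leAk.
    by move=> U sUW; apply: hallA; apply: subset_trans sUW sWA.
  set r' := fun x y => r x y && (y \notin relimage r W).
  have [||g [g_inj g_r]] := IHk (A :\: W) r'.
  - move: W0; rewrite cardsD (setIidPr sWA) -card_gt0; move: ltWA leAk; lia.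
  - move=> U /subsetDP[sUA dUW].
    rewrite relimageDr.
    have := hallA (U :|: W); rewrite subUset sUA => /(_ sWA).
    rewrite relimageU cardsU (disjoint_setI0 dUW) cards0 subn0 eqW.
    by move: (subset_leq_card (subsetIl (relimage r U) (relimage r W)));
       rewrite cardsU cardsD; lia.
  have ngf y z : y \in A -> z \in A -> y \in W -> z \notin W -> f y <> g z.
    move=> yA zA yW zW fg; have /g_r/andP[_] : z \in A :\: W by rewrite inE zW.
    by rewrite -fg inE => /exists_inP[]; exists y => //; apply: f_r.
  exists (fun z => if z \in W then f z else g z); split=> [y z yA zA | y yA].
    case: ifP => yW; case: ifP => zW; first exact: f_inj.
    - by move/ngf; case=> //; rewrite zW.
    - by move/esym/ngf; case=> //; rewrite yW.
    by apply: g_inj; rewrite inE ?yA ?zA ?yW ?zW.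
  case: ifPn => yW; first exact: f_r.
  by have /g_r/andP[] : y \in A :\: W by rewrite inE yW.
rewrite negb_exists => /forallP tight.
have /card_gt0P[y] : 0 < #|relimage r [set x]|.
  by apply: leq_trans (hallA _ _); rewrite ?cards1 ?sub1set.
rewrite inE => /exists_inP[_ /set1P-> rxy].
have [||g [g_inj g_r]] := IHk (A :\ x) (fun z u => r z u && (u \notin [set y])).
- by rewrite (cardsD1 x A) xA in leAk.
- move=> U sUA; rewrite relimageDr cardsD.
  have [->|U0] := eqVneq U set0; first by rewrite cards0.
  have /subsetD1P[sUA' xU] := sUA.
  have := tight U; rewrite sUA' U0 /=.
  have -> /= : U != A by apply: contraNneq xU => ->.
  have := hallA U sUA'.
  have := subset_leq_card (subsetIr (relimage r U) [set y]); rewrite cards1.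
  by move=> h1 h2 h3; move: h1 h2; move: h3; lia.
exists (fun z => if z == x then y else g z); split=> [u v uA vA | u uA].
  have ng z : z \in A -> z != x -> g z != y.
    move=> zA zx; have /g_r/andP[_] : z \in A :\ x by rewrite !inE zx.
    by rewrite inE.
  case: ifPn => [/eqP->|ux]; case: ifPn => [/eqP->|vx] //.
  - by move/esym/eqP; rewrite (negPf (ng _ vA vx)).
  - by move/eqP; rewrite (negPf (ng _ uA ux)).
  by apply: g_inj; rewrite !inE ?ux ?vx.
case: ifPn => [/eqP->//|ux].
by have /g_r/andP[] : u \in A :\ x by rewrite !inE ux.
Qed.

Lemma path_edgesP (V : finType) (r : rel V) x p E :
  path r x p -> E \in path_edges (x :: p) ->
  exists a b, [/\ E = [set a; b], r a b, a \in x :: p & b \in x :: p].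
Proof.
move=> + /imsetP[[a b] /= + ->].
elim: p x => [|y p IHp] x //= /andP[rxy rp].
rewrite inE => /orP[/eqP[-> ->]|abp].
  by exists x, y; rewrite !inE !eqxx orbT.
have [a' [b' [-> rab ain bin]]] := IHp _ rp abp.
by exists a', b'; split=> //; rewrite inE ?ain ?bin orbT.
Qed.

Lemma inner_vertices_rcons (V : finType) x p (y : V) :
  inner_vertices (x :: rcons p y) = p.
Proof. by rewrite /= belast_rcons. Qed.

Section Builder.
Variables (V : finType) (e : rel V) (t : nat) (phi : 'I_t -> V).
Hypothesis phi_inj : injective phi.

(** An immersion assigns paths to two-element sets. Giving them for [i < j] only removes the
    question of orientation, and edge-disjointness becomes the statement that a common edge forces
    equal pairs. *)
Lemma has_complete_immersion (Q : 'I_t -> 'I_t -> seq V) :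
  (forall i j : 'I_t, i < j -> path_between e (phi i) (phi j) (Q i j)) ->
  (forall (i j k l : 'I_t) E, i < j -> k < l -> E \in path_edges (Q i j) ->
    E \in path_edges (Q k l) -> (i, j) = (k, l)) ->
  (forall i j k : 'I_t, i < j -> phi k \notin inner_vertices (Q i j)) ->
  has_immersion (@complete_graph t) e.
Proof.
move=> Qpath Qdisj Qinner.
pose P (E : {set 'I_t}) :=
  if [pick z : 'I_t * 'I_t | (z.1 < z.2) && (E == [set z.1; z.2])] is Some z
  then Q z.1 z.2 else [::].
have set2_lt (i j k l : 'I_t) : i < j -> k < l -> [set i; j] = [set k; l] ->
    (i, j) = (k, l).
  move=> ij kl E.
  have := set21 i j; rewrite E => /set2P[] ei;
  have := set22 i j; rewrite E => /set2P[] ej; subst i j; move: ij;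
    rewrite ?ltnn //.
  by rewrite ltnNge ltnW.
have PE (i j : 'I_t) : i < j -> P [set i; j] = Q i j.
  move=> ij; rewrite /P; case: pickP => [[k l] /= /andP[kl /eqP E]|].
    by have [-> ->] := set2_lt _ _ _ _ ij kl E.
  by move/(_ (i, j)); rewrite /= ij eqxx.
have edge_lt E : E \in edges (@complete_graph t) ->
    exists i j : 'I_t, i < j /\ E = [set i; j].
  case/imsetP => -[i j]; rewrite !inE /= => nij ->.
  have [ij|ji|/val_inj eij] := ltngtP i j; first by exists i, j.
    by exists j, i; rewrite setUC.
  by move: nij; rewrite /complete_graph eij eqxx.
exists phi, P; split=> //.
- move=> i j nij; have [ij|ji|/val_inj eij] := ltngtP i j.
  + by rewrite PE //; apply: Qpath.
  + rewrite setUC PE //; have := Qpath _ _ ji.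
    by case: (Q j i) => //= x p /and3P[-> -> /eqP->]; rewrite setUC eqxx.
  by move: nij; rewrite /complete_graph eij eqxx.
- move=> E F /edge_lt[i [j [ij ->]]] /edge_lt[k [l [kl ->]]].
  rewrite !PE //; apply: contraNT => /pred0Pn[D /andP[/= D1 D2]].
  by have [-> ->] := Qdisj _ _ _ _ _ ij kl D1 D2.
by move=> E w /edge_lt[i [j [ij ->]]]; rewrite PE //; apply: Qinner.
Qed.

(* The path joining the branch vertices [i] and [j] runs through [s i j], the
   center [u] and the reverse of [s j i]. *)
Lemma star_immersion (u : V) (s : 'I_t -> 'I_t -> seq V) :
  symmetric e -> (forall i, phi i != u) ->
  (forall i j, path e (phi i) (rcons (s i j) u)) ->
  (forall i j, s i j != [::]) ->
  (forall i j, uniq (s i j)) ->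
  (forall i j k, phi k \notin s i j) -> (forall i j, u \notin s i j) ->
  (forall i j k l x, x \in s i j -> x \in s k l -> (i, j) = (k, l)) ->
  has_immersion (@complete_graph t) e.
Proof.
move=> e_sym phi_u s_path s0 s_uniq s_phi s_u s_disj.
pose M i j := [predU s i j & s j i].
pose Q i j := phi i :: s i j ++ u :: rev (phi j :: s j i).
have Qmem i j x : x \in Q i j -> [|| x == phi i, x == phi j, x == u | x \in M i
  j].
  rewrite /Q /M !inE mem_cat inE mem_rev inE.
  by do ?[case: (_ == _) | case: (_ \in _)].
have Qlast i j : Q i j = phi i :: rcons (s i j ++ u :: rev (s j i)) (phi j).
  by rewrite /Q rev_cons -rcons_cons rcons_cat.
have pathQ i j (r : rel V) : (forall k l, path r (phi k) (rcons (s k l) u)) ->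
    (forall x y, r x y = r y x) -> path r (phi i) (s i j ++ u :: rev (phi j ::
      s j i)).
  move=> rs r_sym; rewrite -cat_rcons cat_path rs last_rcons /=.
  have := rev_path r (phi j) (rcons (s j i) u).
  rewrite last_rcons belast_rcons => ->.
  by rewrite -(eq_path (e := r)) ?rs // => x y; apply: r_sym.
(* Each edge of the path has an end among the vertices private to the pair, because the segments
   [s i j] are nonempty. These vertices lie on no other path, so the paths are edge-disjoint
   although all of them pass through [u]. *)
have Qmid i j E : E \in path_edges (Q i j) ->
    exists2 x, x \in E & x \in M i j.
  pose r : rel V := fun x y => (x \in M i j) || (y \in M i j).
  have r_sym x y : r x y = r y x by rewrite /r orbC.
  have rs k l : k = i /\ l = j \/ k = j /\ l = i ->
      path r (phi k) (rcons (s k l) u).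
    move=> kl; have sM x : x \in s k l -> x \in M i j.
      by case: kl => -[-> ->]; rewrite !inE => ->; rewrite ?orbT.
    elim: (s k l) (phi k) (s0 k l) sM => // y p IHp x _ sM /=.
    have yM : y \in M i j by apply: sM; rewrite mem_head.
    rewrite (_ : r x y) /=; last by apply/orP; right.
    case: p IHp sM => [|z p] IHp sM /=.
      by rewrite andbT; apply/orP; left.
    by apply: IHp => // w w_in; apply: sM; rewrite inE w_in orbT.
  move=> EQ.
  have rQ : path r (phi i) (s i j ++ u :: rev (phi j :: s j i)).
    rewrite -cat_rcons cat_path rs /=; last by left.
    rewrite last_rcons.
    have := rev_path r (phi j) (rcons (s j i) u).
    rewrite last_rcons belast_rcons => ->.
    rewrite -(eq_path (e := r)); last by move=> x y; apply: r_sym.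
    by apply: rs; right.
  have [a [b [-> /orP[aM|bM] _ _]]] := path_edgesP rQ EQ.
    by exists a; rewrite // !inE eqxx.
  by exists b; rewrite // !inE eqxx orbT.
apply: (@has_complete_immersion Q).
- move=> i j ij; have nij : i != j by rewrite neq_ltn ij.
  rewrite /path_between /Q pathQ //=.
  rewrite rev_cons -rcons_cons -rcons_cat last_rcons eqxx andbT.
  rewrite mem_rcons inE mem_cat inE mem_rev !negb_or (inj_eq phi_inj) nij.
  rewrite phi_u !s_phi /= rcons_uniq mem_cat inE mem_rev !negb_or.
  rewrite phi_u !s_phi /= cat_uniq s_uniq /= rev_uniq s_uniq mem_rev s_u /=
    andbT.
  rewrite negb_or s_u /=; apply/hasPn=> x; rewrite mem_rev => xji.
  by apply/negP=> xij; have [eij] := s_disj _ _ _ _ _ xji xij;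
    rewrite eij eqxx in nij.
- move=> i j k l E ij kl /Qmid[x xE xM] EQ.
  have := path_edgesP (pathQ k l _ s_path e_sym) EQ.
  move=> [a [b [Eab _ aQ bQ]]].
  have xQ : x \in Q k l by move: xE; rewrite Eab => /set2P[] ->.
  have xphi m : x != phi m.
    by apply: contraTneq xM => ->; rewrite !inE !(negPf (s_phi _ _ _)).
  have xu : x != u by apply: contraTneq xM => ->;
    rewrite !inE !(negPf (s_u _ _)).
  have := Qmem _ _ _ xQ; rewrite (negPf (xphi _)) (negPf (xphi _)) (negPf xu)
    /=.
  rewrite !inE => /orP[xkl|xkl]; move: xM; rewrite !inE => /orP[] xij;
    have [? ?] := s_disj _ _ _ _ _ xkl xij; subst k l => //.
  - by move: ij; rewrite ltnNge ltnW.
  - by move: ij; rewrite ltnNge ltnW.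
move=> i j k _; rewrite Qlast inner_vertices_rcons mem_cat inE mem_rev !negb_or.
by rewrite !s_phi phi_u.
Qed.

End Builder.

(** * Disjoint paths as orbits of an injective successor map *)

Section Linkage.
Variables (V : finType) (A T src : {set V}) (f : V -> V).
Hypotheses (f_inj : {in A &, injective f})
  (fP : {in A, forall x, f x \in (A :|: T) :\: src}).

(** Cancelling [f] backwards along both orbits, the one that arrives first at its start would
    exhibit a source as a value of [f], which is excluded. So orbits of distinct sources are
    disjoint, and no orbit repeats a vertex. *)
Lemma iter_src_inj i j a b : a \in src -> b \in src ->
  (forall k, k < i -> iter k f a \in A) ->
  (forall k, k < j -> iter k f b \in A) ->
  iter i f a = iter j f b -> a = b /\ i = j.
Proof.
move=> aS bS; have ns x : x \in A -> f x \notin src.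
  by move/fP; rewrite inE => /andP[].
elim: i j => [|i IHi] [|j] //= iA jA eq_ab.
- by case/negP: (ns _ (jA j (ltnSn j))); rewrite -eq_ab.
- by case/negP: (ns _ (iA i (ltnSn i))); rewrite eq_ab.
have [] := IHi j; last by move=> -> ->.
- by move=> k ki; apply: iA; apply: ltnW.
- by move=> k kj; apply: jA; apply: ltnW.
by apply: f_inj => //; [apply: iA | apply: jA].
Qed.

Lemma linkage_uniq k a : a \in src ->
  (forall j, j < k -> iter j f a \in A) -> uniq (traject f a k.+1).
Proof.
move=> aS kA; rewrite looping_uniq; apply/negP=> /trajectP[j jk].
case/iter_src_inj => // [i ij|_ kj]; first by apply: kA; apply: ltn_trans jk.
by rewrite -kj ltnn in jk.
Qed.

Lemma linkage_reaches a : a \in src -> a \in A :|: T ->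
  exists k, iter k f a \in T /\ forall j, j < k -> iter j f a \in A :\: T.
Proof.
move=> aS aAT; have [/existsP[k kT]|] := boolP [exists k : 'I_#|V|.+1, iter k f
  a \in T].
  have exT : exists k, iter k f a \in T by exists k.
  case: (ex_minnP exT) => m mT m_min; exists m; split=> // j.
  elim: j => [|j IHj] jm.
    rewrite inE; apply/andP; split; first by apply: contraL jm => /m_min;
      rewrite -leqNgt.
    by case/setUP: aAT => // aT; move: (m_min 0 aT) jm; case: m {mT m_min}.
  rewrite inE; apply/andP; split; first by apply: contraL jm => /m_min;
    rewrite -leqNgt.
  have /setDP[/fP + _] := IHj (ltnW jm).
  case/setDP=> /setUP[//|jT _]; first by move: (m_min j.+1 jT);
    rewrite leqNgt jm.
rewrite negb_exists => /forallP noT.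
have allA j : j < #|V|.+1 -> iter j f a \in A.
  elim: j => [|j IHj] jV.
    by case/setUP: aAT => // aT; move: (noT ord0); rewrite aT.
  have /fP := IHj (ltnW jV).
  case/setDP=> /setUP[//|jT _]; by move: (noT (Ordinal jV)); rewrite /= jT.
have /card_uniqP : uniq (traject f a #|V|.+1).
  by apply: linkage_uniq => // j jV; apply: allA; apply: ltnW.
by rewrite size_traject => E; have := max_card (mem (traject f a #|V|.+1));
  rewrite E ltnn.
Qed.

End Linkage.

(** The successor map may fix vertices, namely those that lie on no path. Along a sequence without
    repetition these loops cannot occur. *)
Lemma uniq_path_strict (V : eqType) (e : rel V) x p :
  path (fun a b => (a == b) || e a b) x p -> uniq (x :: p) -> path e x p.
Proof.
elim: p x => //= y p IHp x /andP[xy yp] /and3P[]; rewrite inE negb_or.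
by case/andP=> /negPf nxy _ yNp p_uniq; rewrite nxy /= in xy;
  rewrite xy IHp //= yNp.
Qed.

Lemma path_traject (V : eqType) (r : rel V) f a k :
  (forall j, j < k -> r (iter j f a) (iter j.+1 f a)) ->
  path r a (traject f (f a) k).
Proof.
elim: k a => //= k IHk a rf; rewrite (rf 0) //=; apply: IHk => j jk.
by have := rf j.+1 jk; rewrite -!iterSr.
Qed.

(** * Immersions in graphs of large minimum degree *)

Section MinDegree.
Variables (V : finType) (e : rel V).
Hypothesis e_sym : symmetric e.

Definition nbrs (x : V) : {set V} := [set y | e x y].

Definition boundary (S X : {set V}) : {set V} :=
  [set y in S :\: X | [exists x in X, e x y]].

(* A set [X] minimal among those with small boundary cannot be split by few
   vertices: the two sides of such a split share at most the separator and
   would inherit only parts of the boundary of [X]. This high connectivity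
   provides, by Menger's theorem in the form of Hall's theorem for the map
   sending each vertex to its successor, disjoint paths from the center. *)
Theorem immersion_of_min_degree t (S : {set V}) :
  0 < t -> S != set0 -> (forall x, x \in S -> 6 * t * t < #|S :&: nbrs x|) ->
  has_immersion (@complete_graph t) e.
Proof.
(* [mu] is twice the number [t * t] of paths plus twice the number [t] of branch vertices, because
   the two boundaries added up at the end share a separator and [B]. Choosing the sources requires
   degrees of about [mu + t * t + t], which is [3 * t * t + 3 * t] and so at most [6 * t * t]. *)
move=> t0 S0 degS; pose mu := 2 * t * t + 2 * t.
pose P (X : {set V}) := [&& X \subset S, X != set0 & #|boundary S X| < mu].
have PS : P S.
  rewrite /P subxx S0 (_ : boundary S S = set0) ?cards0 /mu; first by nia.
  by apply/setP=> x; rewrite !inE andNb.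
case: (arg_minnP (fun X : {set V} => #|X|) PS) => X0 /and3P[sXS nX0 bdX] X_min.
move: X0 sXS nX0 bdX X_min => X sXS X0 bdX X_min.
have bd_proper (Y : {set V}) : Y \subset X -> Y != set0 -> Y != X -> mu <=
  #|boundary S Y|.
  move=> sYX Y0 nYX; rewrite leqNgt; apply/negP=> bdY.
  have := X_min Y; rewrite /P (subset_trans sYX sXS) Y0 bdY => /(_ isT).
  by rewrite leqNgt proper_card // properEneq nYX.
set Z := boundary S X in bdX.
have ZS : Z \subset S by apply/subsetP=> x; rewrite !inE => /andP[/andP[]].
have ZX x : x \in Z -> x \notin X by rewrite !inE => /andP[/andP[]].
have nbrsX x : x \in X -> S :&: nbrs x \subset (X :&: nbrs x) :|: Z.
  move=> xX; apply/subsetP=> y; rewrite !inE => /andP[yS xy].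
  rewrite xy yS; case: (y \in X) => //=; rewrite ?orbT //.
  by apply/exists_inP; exists x.
have degX x : x \in X -> 4 * t * t - 2 * t < #|X :&: nbrs x|.
  move=> xX; have := subset_leq_card (nbrsX x xX).
  have := degS x (subsetP sXS _ xX).
  have := (leq_card_setU (X :&: nbrs x) Z).1; move: bdX; rewrite /mu; nia.
have cardX : t < #|X|.
  have [x xX] := set0Pn _ X0; have := degX x xX.
  have := subset_leq_card (subsetIl X (nbrs x)); nia.
pose psi (i : 'I_t.+1) : V := enum_val (widen_ord cardX i).
have psi_inj : injective psi.
  by move=> i j /enum_val_inj/(congr1 val)/= /val_inj.
have psiX i : psi i \in X by apply: enum_valP.
(* Any [t.+1] vertices of [X] can serve as the center and the branch vertices. *)
pose u := psi ord_max; pose phi (i : 'I_t) := psi (widen_ord (leqnSn t) i).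
have phi_inj : injective phi.
  by move=> i j /psi_inj/(congr1 val)/= /val_inj.
have phi_u i : phi i != u.
  apply/eqP=> /psi_inj/(congr1 val)/= E; by have := ltn_ord i; rewrite E ltnn.
pose B := phi @: setT.
have cardB : #|B| <= t.
  by apply: leq_trans (leq_imset_card _ _) _; rewrite cardsT card_ord.
have phiB i : phi i \in B by apply: imset_f; rewrite inE.
have BX x : x \in B -> x \in X by case/imsetP=> i _ ->; apply: psiX.
have uB : u \notin B by apply/imsetP=> -[i _ /eqP];
  rewrite eq_sym (negPf (phi_u i)).
(* [a (i, j)] is the neighbour through which the branch vertex [i] leaves towards [j]. Each list of
   candidates alone has at least [t * t] members, so Hall's condition is immediate. *)
have [a [a_inj aP]] : exists a : 'I_t * 'I_t -> V,
    {in setT &, injective a} /\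
    {in setT, forall p, a p \in (X :&: nbrs (phi p.1)) :\: (u |: B)}.
  apply: (hall u (r := fun p y => y \in (X :&: nbrs (phi p.1)) :\: (u |: B))).
  move=> W _; have [->|/set0Pn[p pW]] := eqVneq W set0; first by rewrite cards0.
  have leW : #|W| <= t * t by apply: leq_trans (max_card _) _;
    rewrite card_prod card_ord.
  have : (X :&: nbrs (phi p.1)) :\: (u |: B) \subset
     relimage (fun p y => y \in (X :&: nbrs (phi p.1)) :\: (u |: B)) W.
    by apply/subsetP=> y yP; rewrite inE; apply/exists_inP; exists p.
  move/subset_leq_card; apply: leq_trans; apply: leq_trans leW _.
  rewrite cardsD.
  have := subset_leq_card (subsetIr (X :&: nbrs (phi p.1)) (u |: B)).
  have := degX (phi p.1) (psiX _); rewrite cardsU1 uB; nia.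
pose src := a @: setT.
have card_src : #|src| = t * t.
  by rewrite card_in_imset // cardsT card_prod card_ord.
have srcP x : x \in src -> [/\ x \in X, x \notin B & x != u].
  case/imsetP=> p _ ->; have := aP p (in_setT p).
  by rewrite !inE negb_or => /andP[/andP[-> ->] /andP[-> _]].
pose V2 := (X :|: Z) :\: (u |: B).
have src_V2 x : x \in src -> x \in V2.
  by case/srcP=> xX xB xu; rewrite !inE xX negb_or xu xB.
pose T := V2 :&: nbrs u.
(* Menger's theorem as a matching: an injection of [V2 :\: T] into [V2 :\: src] along edges or fixed
   points gives successors that never return to a source, and the orbits of the sources can end only
   in [T], next to [u]. *)
have [f [f_inj fP]] : exists f : V -> V, {in V2 :\: T &, injective f} /\
   {in V2 :\: T, forall x, (f x \in V2 :\: src) && ((x == f x) || e x (f x))}.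
  apply: (hall u (r := fun x y => (y \in V2 :\: src) && ((x == y) || e x y))).
  move=> W sW; rewrite leqNgt; apply/negP=> ltW.
  have WV2 x : x \in W -> x \in V2 by move/(subsetP sW); rewrite inE => /andP[].
  have WT x : x \in W -> ~~ e u x.
    move=> xW; have := subsetP sW _ xW; rewrite !(inE, negb_and).
    by case/andP=> /orP[|//]; rewrite -!negb_and; have := WV2 x xW;
      rewrite !inE => ->.
  (* The image of a violating [W] is [W :|: D] without the sources. Hence [D], which separates [W]
     from the rest of [V2], has fewer than [t * t] elements. *)
  pose D := [set y in V2 :\: W | [exists x in W, e x y]].
  have imW : relimage (fun x y => (y \in V2 :\: src) && ((x == y) || e x y)) W
      = (W :|: D) :\: src.
    apply/setP=> y; rewrite !inE; case: (y \in src) => /=.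
      by apply/exists_inP=> -[x].
    apply/exists_inP/idP.
      case=> x xW /andP[yV2 /orP[/eqP <-|xy]]; first by rewrite xW.
      case: (y \in W) => //=; rewrite yV2 /=.
      by apply/exists_inP; exists x.
    case/orP=> [yW|/andP[/andP[_ yV2] /exists_inP[x xW xy]]].
      by exists y; rewrite // eqxx andbT; have := WV2 _ yW; rewrite !inE.
    by exists x; rewrite // yV2 xy orbT.
  have dWD : W :&: D = set0 by apply/setP=> x; rewrite !inE; case: (x \in W).
  move: ltW; rewrite imW cardsD cardsU dWD cards0 subn0 => ltW.
  have srcWD := subset_leq_card (subsetIr (W :|: D) src).
  (* Sources lie in [X]. If [W] misses [X], all sources in [W :|: D] are in [D], so there is no
     deficit. *)
  have [Y0|Y0] := eqVneq (X :&: W) set0.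
    have : (W :|: D) :&: src \subset D.
      apply/subsetP=> x /setIP[/setUP[xW|//] /srcP[xX _ _]].
      by move: (in_set0 x); rewrite -Y0 inE xX xW.
    by move/subset_leq_card; lia.
  have uX : u \in X by apply: psiX.
  have uV2 : u \notin V2 by rewrite !inE eqxx.
  have uW : u \notin W by apply: contra uV2; apply: WV2.
  have uD : u \notin D by rewrite inE inE (negPf uV2) andbF.
  (* Both sides of the split are nonempty proper subsets of [X], the second because it contains [u],
     so each has a boundary of at least [mu]. These boundaries lie in [D :|: B] together with
     complementary parts of [Z], whence [2 * mu <= 2 * (#|D| + t) + #|Z|]. With [#|Z| < mu] this
     contradicts [#|D| < t * t]. *)
  have bd1 : boundary S (X :&: W) \subset D :|: B :|: (Z :&: W).
    apply/subsetP=> y; rewrite inE => /andP[/setDP[yS yXW] /exists_inP[x]].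
    case/setIP=> xX xW xy; have yu : y != u.
      by apply: contraTneq xy => ->; rewrite e_sym; apply: WT.
    have yXZ : y \in X :|: Z.
      have := subsetP (nbrsX x xX) y; rewrite !inE yS xy => /(_ isT).
      by rewrite andbT.
    have [yB|yB] := boolP (y \in B); first by rewrite !in_setU yB orbT.
    have yV2 : y \in V2 by rewrite in_setD in_setU1 (negPf yu) (negPf yB) yXZ.
    have [yW|yW] := boolP (y \in W); last first.
      rewrite !in_setU (_ : y \in D) // inE in_setD yW yV2 /=.
      by apply/exists_inP; exists x.
    rewrite !in_setU in_setI yW andbT; move: yXZ yXW.
    by rewrite in_setU in_setI yW andbT => /orP[->|->]; rewrite ?orbT.
  have bd2 : boundary S (X :\: (W :|: D :|: B)) \subset D :|: B :|: (Z :\: W).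
    apply/subsetP=> y; rewrite inE => /andP[/setDP[yS yXW] /exists_inP[x]].
    case/setDP=> xX; rewrite !in_setU !negb_or -andbA => /and3P[xW xD xB] xy.
    have yXZ : y \in X :|: Z.
      have := subsetP (nbrsX x xX) y; rewrite !inE yS xy => /(_ isT).
      by rewrite andbT.
    have yW : y \notin W.
      apply/negP=> yW; have xu : x != u by apply: contraTneq xy => ->;
        apply: WT.
      case/negP: xD; rewrite inE in_setD xW /= in_setD in_setU1 (negPf xu)
        (negPf xB).
      by rewrite in_setU xX /=; apply/exists_inP; exists y; rewrite // e_sym.
    move: yXZ yXW; rewrite !(in_setU, in_setD) (negPf yW) /=.
    by case: (y \in D); case: (y \in B); case: (y \in X); case: (y \in Z).
  have := subset_leq_card bd1; have := subset_leq_card bd2.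
  have := bd_proper _ (subsetIl X W) Y0.
  have -> : X :&: W != X.
    by apply: contraNneq uW => E; move: uX; rewrite -E inE => /andP[].
  have uY : u \in X :\: (W :|: D :|: B).
    by rewrite in_setD !in_setU (negPf uW) (negPf uD) (negPf uB).
  have := bd_proper _ (subsetDl X (W :|: D :|: B)).
  have -> : X :\: (W :|: D :|: B) != set0 by apply/set0Pn; exists u.
  have -> : X :\: (W :|: D :|: B) != X.
    have [y /setIP[yX yW]] := set0Pn _ Y0.
    by apply/eqP=> E; move: yX; rewrite -E in_setD !in_setU yW.
  move=> /(_ isT isT) h1 /(_ isT) h2.
  have := (leq_card_setU (D :|: B) (Z :&: W)).1;
    have := (leq_card_setU (D :|: B) (Z :\: W)).1.
  have := (leq_card_setU D B).1; have := cardsID W Z.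
  move: h1 h2 bdX cardB ltW srcWD card_src; rewrite /mu -!mulnA; clear; lia.
have fP1 : {in V2 :\: T, forall x, f x \in ((V2 :\: T) :|: T) :\: src}.
  move=> x /fP/andP[+ _]; rewrite !(in_setD _ src) => /andP[-> /=].
  by rewrite in_setU in_setD; case: (f x \in T) => //= ->.
have src_AT x : x \in src -> x \in (V2 :\: T) :|: T.
  by move/src_V2; rewrite in_setU in_setD; case: (x \in T) => //= ->.
have src_a p : a p \in src by apply: imset_f; rewrite inE.
have reach p := linkage_reaches f_inj fP1 (src_a p) (src_AT _ (src_a p)).
have [k kP] := fin_all_exists reach.
have kA p j : j < k p -> iter j f (a p) \in V2 :\: T.
  by move=> jk; have [_ /(_ j jk)/setDP[]] := kP p.
pose s i j := traject f (a (i, j)) (k (i, j)).+1.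
have sV2 i j x : x \in s i j -> x \in V2.
  case/trajectP=> m; rewrite ltnS leq_eqVlt => /orP[/eqP-> ->|/kA + ->].
    by have [+ _] := kP (i, j) => /setIP[].
  by case/setDP.
apply: (star_immersion phi_inj (u := u) (s := s)) => //.
- move=> i j; rewrite /s trajectS rcons_cons /=.
  have := aP (i, j) (in_setT _); rewrite !inE => /andP[_ /andP[_ /= ->]] /=.
  rewrite rcons_path last_traject; apply/andP; split.
    apply: uniq_path_strict.
      by apply: path_traject => m /kA/fP/andP[_].
    by apply: (linkage_uniq f_inj fP1 (src_a _) (@kA (i, j))).
  by have [+ _] := kP (i, j); rewrite !inE => /andP[_]; rewrite e_sym.
- by move=> i j; apply: (linkage_uniq f_inj fP1 (src_a _) (@kA (i, j))).
- move=> i j l; apply/negP=> /sV2; rewrite !inE => /andP[].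
  by rewrite negb_or phiB andbF.
- by move=> i j; apply/negP=> /sV2; rewrite !inE eqxx.
move=> i j i' j' x /trajectP[m mk ->] /trajectP[m' mk'].
case/(iter_src_inj f_inj fP1 (src_a _) (src_a _)).
- by move=> l lm; apply: kA; apply: leq_trans lm _; rewrite -ltnS.
- by move=> l lm; apply: kA; apply: leq_trans lm _; rewrite -ltnS.
by move/a_inj=> ->.
Qed.

End MinDegree.

(* The number of non-neighbours of [x] in [S]; it counts [x] itself. *)
Definition codeg (V : finType) (e : rel V) (S : {set V}) (x : V) : nat :=
  #|S :\: nbrs e x|.

Lemma set2_cross (V : finType) (a b c d : V) :
  [set a; b] = [set c; d] -> a != d -> a = c /\ b = d.
Proof.
move=> E nad; have := set21 a b; rewrite E => /set2P[eac|ead]; last first.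
  by rewrite ead eqxx in nad.
subst c; split=> //; have := set22 a b; rewrite E => /set2P[eba|//].
by have := set22 a d; rewrite -E eba => /set2P[] ->.
Qed.

Lemma set2_lt_inj (V : finType) t (phi : 'I_t -> V) (i j k l : 'I_t) :
  injective phi -> i < j -> k < l ->
  [set phi i; phi j] = [set phi k; phi l] -> (i, j) = (k, l).
Proof.
move=> phi_inj ij kl; have [?|nil E] := eqVneq i l.
  subst l; move=> E; have : phi k \in [set phi i; phi j] by rewrite E set21.
  case/set2P=> /phi_inj ek; first by rewrite ek ltnn in kl.
  by subst; move: kl; rewrite ltnNge ltnW.
by have [|/phi_inj-> /phi_inj->] := set2_cross E;
  first by rewrite (inj_eq phi_inj).
Qed.

(** * Immersions in dense sets by paths of length at most 2 *)

Section Dense.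
Variables (V : finType) (e : rel V) (e_sym : symmetric e).
Variables (e_irr : irreflexive e) (t m : nat).
Variables (S : {set V}) (phi : 'I_t -> V).
Hypotheses (phi_inj : injective phi) (phiS : forall i, phi i \in S)
  (S_large : t + 4 * m <= #|S|) (S_dense : forall x, x \in S -> codeg e S x <=
    m).

Let B := phi @: setT.

Let missing (p : 'I_t * 'I_t) := (p.1 < p.2) && ~~ e (phi p.1) (phi p.2).

Let meets (p q : 'I_t * 'I_t) :=
  [|| p.1 == q.1, p.1 == q.2, p.2 == q.1 | p.2 == q.2].

(** The other ends of the missing pairs at [i], together with [phi i] itself, are distinct
    non-neighbours of [phi i], and there are at most [m] of those. *)
Lemma missing_at (l : seq ('I_t * 'I_t)) i p : uniq (p :: l) ->
  all missing (p :: l) -> (i == p.1) || (i == p.2) ->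
  #|[set q in l | (i == q.1) || (i == q.2)]| < m.
Proof.
move=> /= /andP[pl l_uniq] /andP[pm lm] ip.
pose other (q : 'I_t * 'I_t) := if i == q.1 then q.2 else q.1.
pose A := [set q in p :: l | (i == q.1) || (i == q.2)].
have AP q : q \in A -> missing q.
  rewrite inE => /andP[+ _]; rewrite inE => /orP[/eqP->//|]; exact: (allP lm).
have -> : [set q in l | (i == q.1) || (i == q.2)] = A :\ p.
  apply/setP=> q; rewrite !inE; have [->|//] := eqVneq q p.
  by rewrite (negPf pl).
have pA : p \in A by rewrite !inE eqxx ip.
rewrite -ltnS; have -> : #|A :\ p|.+2 = #|A|.+1 by rewrite (cardsD1 p A) pA.
have o_inj : {in A &, injective (fun q => phi (other q))}.
  move=> [a b] [c d] qA rA /phi_inj; rewrite /other /=.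
  move: qA rA (AP _ qA) (AP _ rA) => + + mq mr; move: mq mr;
    rewrite /missing /= !inE /=.
  move=> /andP[ab _] /andP[cd _] /andP[_ +] /andP[_ +].
  case: (i =P a) => [?|_] /=; case: (i =P c) => [?|_] /=; subst.
  - by move=> _ _ ->.
  - by move=> _ /eqP E1 E2; subst; move: ab cd; clear; lia.
  - by move=> /eqP E1 _ E2; subst; move: ab cd; clear; lia.
  by move=> /eqP<- /eqP<- ->.
rewrite -(card_in_imset o_inj).
have iS : phi i \notin (fun q => phi (other q)) @: A.
  apply/imsetP=> -[q qA /phi_inj]; have /andP[] := AP q qA.
  by rewrite /other; case: eqP => [<- ij _ E|/eqP ni _ _ E];
    [move: ij; rewrite -E ltnn | rewrite E eqxx in ni].
have -> : #|(fun q => phi (other q)) @: A|.+1 =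
    #|phi i |: (fun q => phi (other q)) @: A| by rewrite cardsU1 iS.
apply: leqW; apply: leq_trans (S_dense (phiS i)).
apply/subset_leq_card/subsetP=> x /setU1P[->|/imsetP[q qA ->]].
  by rewrite !inE phiS e_irr.
rewrite !inE phiS andbT; have /andP[_] := AP q qA; move: qA;
  rewrite !inE /other.
case: (i =P q.1) => [<-//|_] /= /andP[_ /eqP<-]; by rewrite e_sym.
Qed.

(** A middle vertex is chosen greedily for each missing pair, with different choices for pairs that
    share an end. Forbidden are the [t] branch vertices, at most [m] non-neighbours of each end, and
    fewer than [m] middle vertices already in use at each end; this is the origin of [t + 4 * m]. *)
Lemma missing_coloring (l : seq ('I_t * 'I_t)) : uniq l -> all missing l ->
  exists c : 'I_t * 'I_t -> V,
    (forall p, p \in l ->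
      [/\ c p \notin B, e (phi p.1) (c p) & e (c p) (phi p.2)]) /\
    (forall p q, p \in l -> q \in l -> meets p q -> c p = c q -> p = q).
Proof.
elim: l => [|p l IHl] l_uniq l_miss; first by exists (fun p => phi p.1).
have [||c [c_adj c_inj]] := IHl; first by case/andP: l_uniq.
  by case/andP: l_miss.
pose F i := c @: [set q in l | (i == q.1) || (i == q.2)].
have FP i : (i == p.1) || (i == p.2) -> #|F i| < m.
  by move/(missing_at l_uniq l_miss); apply: leq_ltn_trans (leq_imset_card _ _).
have cardB : #|B| <= t.
  by apply: leq_trans (leq_imset_card _ _) _; rewrite cardsT card_ord.
have /card_gt0P[w] : 0 < #|S :\: (B :|: (S :\: nbrs e (phi p.1)) :|:
     (S :\: nbrs e (phi p.2)) :|: F p.1 :|: F p.2)|.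
  rewrite cardsD; set U := _ :|: F p.2.
  have := subset_leq_card (subsetIr S U).
  have := (leq_card_setU (B :|: (S :\: nbrs e (phi p.1)) :|:
     (S :\: nbrs e (phi p.2)) :|: F p.1) (F p.2)).1.
  have := (leq_card_setU (B :|: (S :\: nbrs e (phi p.1)) :|:
     (S :\: nbrs e (phi p.2))) (F p.1)).1.
  have := (leq_card_setU (B :|: (S :\: nbrs e (phi p.1)))
     (S :\: nbrs e (phi p.2))).1.
  have := (leq_card_setU B (S :\: nbrs e (phi p.1))).1.
  have := S_dense (phiS p.1); have := S_dense (phiS p.2); rewrite /codeg -/U.
  have := FP p.1; have := FP p.2; rewrite !eqxx orbT => /(_ isT) + /(_ isT).
  move: S_large cardB; clear; lia.
rewrite in_setD !in_setU !in_setD !negb_or !negb_and !negbK -!andbA.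
case/and5P=> wB w1 w2 wF1 /andP[wF2 wS].
rewrite wS orbF inE in w1; rewrite wS orbF inE in w2.
have wF q : q \in l -> meets p q -> w <> c q.
  move=> ql + E; move: wF1 wF2; rewrite E /meets => cq1 cq2.
  have Fq i : c q \notin F i -> (i == q.1) || (i == q.2) = false.
    by apply: contraNF => iq; apply: imset_f; rewrite inE ql.
  by rewrite orbA (Fq _ cq1) (Fq _ cq2).
have pl : p \notin l by case/andP: l_uniq.
have meetsC q q' : meets q q' = meets q' q.
  rewrite /meets ![_ == q.1]eq_sym ![_ == q.2]eq_sym.
  by do 4 case: (_ == _).
exists (fun q => if q == p then w else c q); split=> [q|q q'].
  rewrite inE; case: eqP => [->|_ /c_adj//]; by rewrite e_sym in w2 *; split;
    rewrite // e_sym.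
rewrite !inE; case: (eqVneq q p) => [->|_] /=;
  case: (eqVneq q' p) => [->|_] //= qp q'p.
- by move=> pq E; case: (wF _ q'p pq E).
- by rewrite meetsC => pq E; case: (wF _ qp pq (esym E)).
exact: c_inj.
Qed.

(** The middle of a path of length 2 is outside [B], so an edge common to two such paths determines
    a common end and a common middle. The two pairs then meet and have the same colour, hence are
    equal. *)
Lemma immersion_of_dense_set :
  has_immersion (@complete_graph t) e.
Proof.
pose l := enum [pred p | missing p].
have [||c [c_adj c_inj]] := @missing_coloring l; first exact: enum_uniq.
  by apply/allP=> p; rewrite mem_enum.
pose Q i j := if e (phi i) (phi j) then [:: phi i; phi j]
              else [:: phi i; c (i, j); phi j].
have phiB i : phi i \in B by apply: imset_f; rewrite inE.
have cP (i j : 'I_t) : i < j -> ~~ e (phi i) (phi j) -> (i, j) \in l /\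
    [/\ c (i, j) \notin B, e (phi i) (c (i, j)) & e (c (i, j)) (phi j)].
  move=> ij nij; have lij : (i, j) \in l by rewrite mem_enum inE /missing ij.
  by split=> //; apply: (c_adj (i, j)).
have phic (i : 'I_t) x : x \notin B -> phi i != x.
  by move=> xB; apply: contraNneq xB => <-.
apply: (@has_complete_immersion V e t phi phi_inj Q).
- move=> i j ij; have nij : phi i != phi j by rewrite (inj_eq phi_inj) neq_ltn
  ij.
  rewrite /Q; case: ifPn => eij; rewrite /path_between /=.
    by rewrite eij !inE nij eqxx.
  have [_ [cB -> ->]] := cP _ _ ij eij.
  by rewrite !inE !negb_or phic // nij eqxx eq_sym phic.
- move=> i j k l' E ij kl.
  have single E' (x y : V) : E' \in path_edges [:: x; y] -> E' = [set x; y].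
    by case/imsetP=> z; rewrite inE => /eqP->.
  have double E' (x w y : V) : E' \in path_edges [:: x; w; y] ->
      E' = [set x; w] \/ E' = [set y; w].
    case/imsetP=> z; rewrite !inE => /orP[] /eqP-> ->; first by left.
    by right; rewrite setUC.
  have nset (x y z w : V) : w \notin B -> x \in B -> y \in B ->
      [set x; y] <> [set z; w].
    move=> wB xB yB E'; have := set22 z w; rewrite -E' => /set2P[] E2;
    by rewrite E2 ?xB ?yB in wB.
  have inB (a b : 'I_t) w w' : w \notin B -> w' \notin B ->
      [set phi a; w] = [set phi b; w'] -> a = b /\ w = w'.
    by move=> wB w'B /set2_cross[|/phi_inj]; first exact: phic.
  rewrite /Q; case: ifPn => eij; case: ifPn => ekl.
  + by move/single=> -> /single/(set2_lt_inj phi_inj ij kl).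
  + have [_ [cB _ _]] := cP _ _ kl ekl.
    by move/single=> -> /double[] /nset[].
  + have [_ [cB _ _]] := cP _ _ ij eij.
    by move=> /[swap] /single=> -> /double[] /nset[].
  have [lij [cB _ _]] := cP _ _ ij eij; have [lkl [c'B _ _]] := cP _ _ kl ekl.
  by case/double=> -> /double[] /(inB _ _ _ _ cB c'B)[E1 E2];
    apply: c_inj => //;
     rewrite /meets /= E1 eqxx ?orbT.
- move=> i j k ij; rewrite /Q; case: ifPn => eij //=.
  have [_ [cB _ _]] := cP _ _ ij eij.
  by rewrite inE phic.
Qed.

End Dense.

Theorem dense_set_immersion (V : finType) (e : rel V) t m (S : {set V}) :
  symmetric e -> irreflexive e -> (forall x, x \in S -> codeg e S x <= m) ->
  t + 4 * m <= #|S| -> has_immersion (@complete_graph t) e.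
Proof.
move=> e_sym e_irr S_dense S_large.
have tS : t <= #|S| by apply: leq_trans (leq_addr _ _) S_large.
apply: (@immersion_of_dense_set _ _ e_sym e_irr t m S
          (fun i => enum_val (widen_ord tS i))) => //.
  by move=> i j /enum_val_inj/(congr1 val)/= /val_inj.
by move=> i; apply: enum_valP.
Qed.

(** * Branching *)

Section Branching.
Variables (V : finType) (e : rel V).
Hypotheses (e_sym : symmetric e) (e_irr : irreflexive e).

(* A relation and not a function, because the program may choose any vertex with
   the most non-neighbours. The cliques avoiding it come first, as they do on
     the
   stack of the program. *)
Inductive branching : {set V} -> seq {set V} -> Prop :=
| BranchLeaf S : clique e S -> branching S [:: S]
| BranchNode S w L1 L2 :
    ~~ clique e S -> w \in S ->
    (forall x, x \in S -> codeg e S x <= codeg e S w) ->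
    branching (S :&: nbrs e w) L1 -> branching (S :\ w) L2 ->
    branching S (L2 ++ [seq w |: C | C <- L1]).

Lemma cliqueP (C : {set V}) :
  reflect {in C &, forall x y, x != y -> e x y} (clique e C).
Proof.
apply: (iffP forall_inP) => [H x y xC yC|H x xC].
  by move/forall_inP: (H x xC) => /(_ y yC)/implyP.
by apply/forall_inP=> y yC; apply/implyP; apply: H.
Qed.

(** Since [codeg] counts the vertex itself, the largest value is at most 1 exactly for cliques. This
    is the leaf test of the program. *)
Lemma clique_codeg S : clique e S = [forall x in S, codeg e S x <= 1].
Proof.
apply/cliqueP/forall_inP=> [S_cl x xS|codegS x y xS yS].
  rewrite /codeg -(cards1 x) subset_leq_card //; apply/subsetP=> y.
  rewrite !inE => /andP[+ yS]; apply: contraR => yx.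
  by apply: S_cl; rewrite // eq_sym.
apply: contraR => nxy.
have /card_le1_eqP H := codegS x xS; apply/eqP/H; rewrite !inE ?yS ?nxy //.
by rewrite e_irr xS.
Qed.

Lemma clique_sub (S C : {set V}) : C \subset S -> clique e S -> clique e C.
Proof.
move=> sCS /cliqueP S_cl; apply/cliqueP=> x y xC yC.
by apply: S_cl; apply: (subsetP sCS).
Qed.

Lemma clique_add w (C : {set V}) : clique e C -> C \subset nbrs e w -> clique e
  (w |: C).
Proof.
move=> /cliqueP C_cl sCw; apply/cliqueP=> x y /setU1P[->|xC] /setU1P[->|yC].
- by rewrite eqxx.
- by have := subsetP sCw y yC; rewrite inE.
- by have := subsetP sCw x xC; rewrite inE e_sym.
exact: C_cl.
Qed.

Lemma branching_sub S L C : branching S L -> C \in L -> C \subset S.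
Proof.
move=> bSL; elim: bSL C => {S L} [S _ C|S w L1 L2 _ wS _ _ IH1 _ IH2 C].
  by rewrite inE => /eqP->.
rewrite mem_cat => /orP[/IH2|/mapP[D /IH1 sD ->]].
  by move/subset_trans; apply; rewrite subD1set.
by rewrite subUset sub1set wS (subset_trans sD) // subsetIl.
Qed.

Lemma branching_clique S L C : branching S L -> C \in L -> clique e C.
Proof.
move=> bSL; elim: bSL C => {S L} [S S_cl C|S w L1 L2 _ wS _ b1 IH1 _ IH2 C].
  by rewrite inE => /eqP->.
rewrite mem_cat => /orP[/IH2//|/mapP[D DL ->]].
apply: clique_add (IH1 _ DL) _; apply: subset_trans (branching_sub b1 DL) _.
exact: subsetIr.
Qed.

Lemma branching_uniq S L : branching S L -> uniq L.
Proof.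
elim=> {S L} [S //|S w L1 L2 _ wS _ b1 U1 b2 U2].
have wL1 D : D \in L1 -> w \notin D.
  move/(branching_sub b1)/subsetP=> sD; apply/negP=> /sD.
  by rewrite !inE e_irr andbF.
rewrite cat_uniq U2 /=; apply/andP; split.
  apply/hasPn=> _ /mapP[D DL ->]; apply/negP=> /(branching_sub b2)/subsetP.
  by move/(_ w); rewrite !inE eqxx => /(_ isT).
rewrite map_inj_in_uniq // => C D /wL1 wC /wL1 wD E.
by rewrite -(setU1K wC) E setU1K.
Qed.

(** The last hypothesis makes [C] maximal inside [S], and the branch that [C] follows inherits this:
    without [w], [C] is maximal in [S :\ w]; with [w], [C :\ w] is maximal among the neighbours of
    [w]. The list may also contain cliques that are maximal only in a subproblem, so a test is still
    needed. *)
Lemma branching_complete S L (C : {set V}) : branching S L -> C \subset S ->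
  clique e C ->
  (forall x, x \in S -> C \subset nbrs e x -> x \in C) -> C \in L.
Proof.
move=> bSL; elim: bSL C => {S L} [S S_cl|S w L1 L2 _ wS _ b1 IH1 b2 IH2] C sCS
  C_cl C_max.
  rewrite inE eqEsubset sCS; apply/subsetP=> x xS.
  apply/negPn/negP=> xC; case/negP: (xC); apply: C_max => //.
  apply/subsetP=> y yC; rewrite inE; move/cliqueP: S_cl; apply=> //.
    exact: (subsetP sCS).
  by apply: contraNneq xC => ->.
rewrite mem_cat; have [wC|wC] := boolP (w \in C); last first.
  rewrite IH2 // ?subsetD1 ?sCS //.
  by move=> x /setD1P[_]; apply: C_max.
apply/orP; right; apply/mapP; exists (C :\ w); last by rewrite setD1K.
have CNw : C :\ w \subset nbrs e w.
  apply/subsetP=> x; rewrite !inE => /andP[xw xC].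
  by move/cliqueP: C_cl; apply; rewrite // eq_sym.
apply: IH1.
- by rewrite subsetI CNw andbT; apply: subset_trans sCS; apply: subD1set.
- by apply: clique_sub C_cl; apply: subD1set.
move=> x; rewrite !inE => /andP[xS wx] sCx.
rewrite C_max // ?andbT; first by apply: contraTneq wx => ->; rewrite e_irr.
by rewrite -(setD1K wC) subUset sub1set inE e_sym wx.
Qed.

Lemma branching_size_gt0 S L : branching S L -> 0 < size L.
Proof.
by elim=> {S L} // S w L1 L2 _ _ _ _ L1_gt0 _ _; rewrite size_cat size_map; lia.
Qed.

End Branching.

(** * Maximal cliques grouped by their first removed vertex *)

Section Vertex.
Variables (V : finType) (e : rel V).
Hypotheses (e_sym : symmetric e) (e_irr : irreflexive e).

Lemma maximal_cliqueP (M : {set V}) :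
  reflect (clique e M /\ forall u, M \subset nbrs e u -> u \in M)
          (M \in maximal_cliques e).
Proof.
rewrite inE; apply: (iffP maxsetP) => [[M_cl M_max]|[M_cl M_max]].
  split=> // u sMu; rewrite -(M_max (u |: M)) ?setU11 ?subsetUr //.
  exact: clique_add.
split=> // D D_cl sMD; apply/eqP; rewrite eqEsubset sMD andbT.
apply/subsetP=> u uD; apply/negPn/negP=> uM; case/negP: (uM); apply: M_max.
apply/subsetP=> x xM; rewrite inE; move/(cliqueP _ _ : clique e D -> _): D_cl.
by apply=> //; [apply: (subsetP sMD) | apply: contraNneq uM => ->].
Qed.

Lemma set0_not_maximal (x : V) : set0 \notin maximal_cliques e.
Proof.
apply/maximal_cliqueP=> -[_ /(_ x)]; rewrite inE sub0set => H.
by move: (H isT).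
Qed.

(** [X] stands for the vertices removed before [v]. A vertex that extends [v |: C] is a neighbour of
    [v], so it suffices to search [al]; as it may lie in [X], searching [Rl] would not do. *)
Lemma maximal_cliques_at (v : V) (X : {set V}) (al Rl : seq V) L :
  al =i e v -> Rl = [seq u <- al | u \notin X] -> v \notin X ->
  branching e [set x in Rl] L ->
  let Lv := [seq v |: C | C : {set V} <- L & ~~ has (fun u => [forall x in C, e
    u x]) al] in
  uniq Lv /\ forall M, (M \in Lv) =
    [&& M \in maximal_cliques e, [disjoint M & X] & v \in M].
Proof.
move=> alE RlE vX bL Lv.
have RlP x : (x \in Rl) = e v x && (x \notin X).
  by rewrite RlE mem_filter alE andbC.
have vL C : C \in L -> v \notin C.
  move/(branching_sub bL)/subsetP=> sC; apply/negP=> /sC.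
  by rewrite inE RlP e_irr.
split.
  rewrite map_inj_in_uniq ?filter_uniq ?(branching_uniq e_irr bL) //.
  move=> C D; rewrite !mem_filter => /andP[_ /vL vC] /andP[_ /vL vD] E.
  by rewrite -(setU1K vC) E setU1K.
move=> M; apply/mapP/and3P => [[C]|[M_max dMX vM]].
  rewrite mem_filter => /andP[noext CL] ->.
  have sC := subsetP (branching_sub bL CL).
  have Cv x : x \in C -> e v x by move/sC; rewrite inE RlP => /andP[].
  split; last exact: setU11; last first.
    rewrite -setI_eq0; apply/eqP/setP=> x; rewrite !inE.
    apply/negP=> /andP[/orP[/eqP->|/sC]]; first by rewrite (negPf vX).
    by rewrite inE RlP => /andP[_ /negPf->].
  apply/maximal_cliqueP; split.
    apply: clique_add (branching_clique e_sym bL CL) _ => //.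
    by apply/subsetP=> x xC; rewrite inE Cv.
  move=> u su; apply/negPn/negP=> uC; case/negP: noext.
  apply/hasP; exists u.
    by rewrite alE; have := subsetP su v (setU11 _ _); rewrite inE e_sym.
  by apply/forall_inP=> x xC; have := subsetP su x (setU1r _ xC); rewrite inE.
have /maximal_cliqueP[M_cl M_ext] := M_max.
have adj x y : x \in M -> y \in M -> x != y -> e x y.
  by move=> xM yM; move/(cliqueP _ _ : clique e M -> _): M_cl; apply.
exists (M :\ v); last by rewrite setD1K.
rewrite mem_filter; apply/andP; split.
  apply/hasPn=> u; rewrite alE => vu; apply/negP=> /forall_inP uM.
  have uMv : u \in M.
    apply: M_ext; apply/subsetP=> x xM; rewrite inE.
    have [->|xv] := eqVneq x v; first by rewrite e_sym.
    by apply: uM; rewrite !inE xv.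
  have uv : u != v by apply: contraTneq vu => ->; rewrite -topredE /= e_irr.
  by have := uM u; rewrite !inE uv uMv e_irr => /(_ isT).
apply: (branching_complete e_sym e_irr bL).
- apply/subsetP=> x; rewrite !inE RlP => /andP[xv xM].
  by rewrite (disjointFr dMX xM) adj // eq_sym.
- by apply: clique_sub M_cl; apply: subD1set.
move=> x; rewrite !inE RlP => /andP[vx xX] sx.
have xv : x != v by apply: contraTneq vx => ->; rewrite e_irr.
rewrite xv M_ext //; apply/subsetP=> y yM; rewrite inE.
have [->|yv] := eqVneq y v; first by rewrite e_sym.
by have := subsetP sx y; rewrite !inE yv yM => /(_ isT).
Qed.

(** Removing a vertex of degree at most [D] lowers the sum by twice its degree. This pays for the
    maximality tests, whose cost at [v] grows with the full degree of [v]. *)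
Lemma sum_degree_degenerate D (S : {set V}) :
  (forall S : {set V}, S != set0 -> exists2 x, x \in S & #|S :&: nbrs e x| <=
    D) ->
  \sum_(x in S) #|S :&: nbrs e x| <= 2 * D * #|S|.
Proof.
move=> degen; have [k] := ubnP #|S|; elim: k S => // k IHk S /ltnSE leSk.
have [->|S0] := eqVneq S set0; first by rewrite big_set0.
have [x xS xD] := degen S S0.
have cS : #|S| = #|S :\ x|.+1 by rewrite (cardsD1 x S) xS.
have := IHk (S :\ x); rewrite -ltnS -cS => /(_ leSk) IH.
rewrite (big_setD1 x) //=.
have E : \sum_(y in S :\ x) #|S :&: nbrs e y| =
    \sum_(y in S :\ x) #|(S :\ x) :&: nbrs e y| + \sum_(y in S :\ x) e y x.
  rewrite -big_split /=; apply: eq_bigr => y; rewrite !inE => /andP[yx yS].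
  rewrite (cardsD1 x) !inE xS addnC; congr (_ + _).
  by apply: eq_card => z; rewrite !inE andbA.
have E2 : \sum_(y in S :\ x) e y x = #|S :&: nbrs e x|.
  rewrite -sum1_card big_mkcond [RHS]big_mkcond; apply: eq_bigr => y _.
  rewrite !inE e_sym; have [->|yx] /= := eqVneq y x;
    first by rewrite e_irr andbF.
  by case: (y \in S); case: (e x y).
rewrite E E2 cS mulnS; lia.
Qed.

End Vertex.

(** * The lower bound *)

Section BlockGraph.
Variables (n q : nat).
Hypothesis q0 : 0 < q.

(** The quotient by 3 names the part of a vertex, and the further quotient by [q] names its copy of
    the complete multipartite graph. The leftover vertices form a truncated copy. *)
Definition block_graph : rel 'I_n :=
  fun u v => (u %/ 3 != v %/ 3) && (u %/ 3 %/ q == v %/ 3 %/ q).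

Lemma block_graph_simple : simple_graph block_graph.
Proof.
split=> [u v|u]; last by rewrite /block_graph eqxx.
by rewrite /block_graph eq_sym [X in _ && X]eq_sym.
Qed.

Lemma block_graph_path x p : path block_graph x p ->
  last x p %/ 3 %/ q = x %/ 3 %/ q.
Proof. by elim: p x => //= y p IHp x /andP[/andP[_ /eqP->] /IHp]. Qed.

(** Paths stay inside a copy, so all branch vertices lie in one copy and are told apart by their
    residues modulo [3 * q], of which there are fewer than [t]. *)
Lemma block_graph_no_immersion t : 3 * q < t ->
  ~ has_immersion (@complete_graph t) block_graph.
Proof.
move=> qt [phi [P [phi_inj Ppath _ _]]].
have same_block i j : phi i %/ 3 %/ q = phi j %/ 3 %/ q.
  have [->//|nij] := eqVneq i j; have := Ppath i j nij.
  case: (P _) => //= x p /and3P[/block_graph_path xp _ /eqP E].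
  have := set21 (phi i) (phi j); have := set22 (phi i) (phi j).
  by rewrite -!E => /set2P[] -> /set2P[] ->.
have q3 : 0 < 3 * q by lia.
pose r (i : 'I_t) : 'I_(3 * q) := Ordinal (ltn_pmod (phi i) q3).
have : injective r.
  move=> i j /(congr1 val)/= E; apply/phi_inj/val_inj => /=.
  by rewrite (divn_eq (phi i) (3 * q)) (divn_eq (phi j) (3 * q)) E !divnMA
    (same_block i j).
by move/leq_card; rewrite !card_ord leqNgt qt.
Qed.

Definition transversal_clique (b : nat) (f : {ffun 'I_q -> 'I_3}) : {set 'I_n}
  :=
  [set v : 'I_n | (v %/ 3 %/ q == b) &&
                  (v %% 3 == f (Ordinal (ltn_pmod (v %/ 3) q0)))].

Lemma transversal_div b (f : {ffun 'I_q -> 'I_3}) (g : 'I_q) :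
  (b * q * 3 + g * 3 + f g) %/ 3 = b * q + g.
Proof. by rewrite -mulnDl divnMDl // divn_small ?addn0. Qed.

Lemma transversal_cliqueE b (f : {ffun 'I_q -> 'I_3}) (g : 'I_q) (h : b * q * 3
  + g * 3 + f g < n) :
  Ordinal h \in transversal_clique b f.
Proof.
have d3 := transversal_div b f g.
have E : Ordinal (ltn_pmod ((b * q * 3 + g * 3 + f g) %/ 3) q0) = g.
  by apply: val_inj; rewrite /= d3 modnMDl modn_small.
rewrite inE /= E d3 divnMDl // divn_small // addn0 eqxx /=.
by rewrite -mulnDl modnMDl modn_small.
Qed.

Lemma transversal_bound b (f : {ffun 'I_q -> 'I_3}) (g : 'I_q) : b < n %/ (3 *
  q) ->
  b * q * 3 + g * 3 + f g < n.
Proof.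
move=> bn; have := ltn_ord g; have := ltn_ord (f g).
have : (b.+1 * (3 * q) <= n) by rewrite -leq_divRL //; lia.
by move: (f g : nat) (g : nat) => y x; nia.
Qed.

(** A vertex adjacent to the whole clique would lie in the same copy, hence in one of its parts,
    where the clique already has a vertex not adjacent to it. *)
Lemma transversal_clique_maximal b f : b < n %/ (3 * q) ->
  transversal_clique b f \in maximal_cliques block_graph.
Proof.
move=> bn; rewrite inE; apply/maxsetP; split.
  apply/forall_inP=> u; rewrite inE => /andP[/eqP bu /eqP fu].
  apply/forall_inP=> v; rewrite inE => /andP[/eqP bv /eqP fv].
  apply/implyP; rewrite /block_graph bu bv eqxx andbT; apply: contraNneq => uv.
  apply/eqP/val_inj; rewrite /= (divn_eq u 3) (divn_eq v 3) fu fv uv.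
  by congr (_ + val (f _)); apply: val_inj; rewrite /= uv.
move=> D /forall_inP D_cl sCD; apply/eqP; rewrite eqEsubset sCD andbT.
have adj x y : x \in D -> y \in transversal_clique b f -> x != y -> block_graph
  x y.
  by move=> xD /(subsetP sCD) yD; apply/implyP/(forall_inP (D_cl x xD)).
apply/subsetP=> x xD; apply/negPn/negP=> xC.
have neqC y : y \in transversal_clique b f -> x != y.
  by move=> yC; apply: contraNneq xC => ->.
pose g0 : 'I_q := Ordinal q0.
have w0C := transversal_cliqueE (transversal_bound f g0 bn).
have /andP[_ /eqP bx] := adj _ _ xD w0C (neqC _ w0C).
move: w0C; rewrite inE -bx => /andP[/eqP {}bx _].
pose g := Ordinal (ltn_pmod (x %/ 3) q0).
have wC := transversal_cliqueE (transversal_bound f g bn).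
have /andP[/eqP []] := adj _ _ xD wC (neqC _ wC).
by rewrite /= transversal_div -bx -divn_eq.
Qed.

Lemma transversal_clique_inj b b' (f f' : {ffun 'I_q -> 'I_3}) : b < n %/ (3 *
  q) ->
  transversal_clique b f = transversal_clique b' f' -> b = b' /\ f = f'.
Proof.
move=> bn E; have wC g := transversal_cliqueE (transversal_bound f g bn).
have := wC (Ordinal q0); rewrite inE /= => /andP[/eqP eb _].
split.
  by have := wC (Ordinal q0); rewrite E inE /= eb => /andP[/eqP].
apply/ffunP=> g; apply: val_inj.
have := wC g; rewrite E inE /= => /andP[_ /eqP].
rewrite -[in LHS]mulnDl modnMDl modn_small // => ->.
congr (val (f' _)); apply: val_inj => /=.
by rewrite transversal_div modnMDl modn_small.
Qed.

Lemma block_graph_maximal_cliques :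
  n %/ (3 * q) * 3 ^ q <= #|maximal_cliques block_graph|.
Proof.
pose F (p : 'I_(n %/ (3 * q)) * {ffun 'I_q -> 'I_3}) := transversal_clique p.1
  p.2.
have F_inj : injective F.
  move=> [b f] [b' f'] /(transversal_clique_inj (ltn_ord b))[/= /val_inj->
    ->//].
have -> : n %/ (3 * q) * 3 ^ q = #|F @: setT|.
  by rewrite card_imset // cardsT card_prod card_ord card_ffun !card_ord.
apply/subset_leq_card/subsetP=> _ /imsetP[[b f] _ ->].
exact: transversal_clique_maximal.
Qed.

End BlockGraph.

Theorem many_maximal_cliques t n : 4 <= t -> t <= n ->
  exists e : rel 'I_n, [/\ simple_graph e,
    ~ has_immersion (@complete_graph t) e
    & exists q, t <= 3 * q /\ n * 3 ^ q <= 6 * t * #|maximal_cliques e|].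
Proof.
move=> t4 tn; pose q := t.-1 %/ 3.
have q0 : 0 < q by rewrite divn_gt0 //; lia.
exists (@block_graph n q); split.
- exact: block_graph_simple.
- by apply: block_graph_no_immersion => //; rewrite /q; lia.
(* The successor is needed for [t <= 3 * q.+1]. The factor 3 that it costs, and the factor of at
   most [2 * t] between [n] and [n %/ (3 * q)], make up [6 * t]. *)
exists q.+1; split; first by rewrite /q; lia.
have := block_graph_maximal_cliques n q0.
move/(leq_mul (leqnn (6 * t))); apply: leq_trans; rewrite expnS.
have qt : 3 * q < t by rewrite /q; lia.
set m := n %/ _; have : n < m.+1 * (3 * q) by rewrite -ltn_divLR //; lia.
have : 0 < m by rewrite divn_gt0; lia.
move: (3 ^ q) => y m0 nm; have : n * 3 <= 6 * t * m by nia.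
by move/(leq_mul (leqnn y)); nia.
Qed.

(** * A structured language for the random access machine *)

(* A structured language with a read-only input, registers and sixteen arrays.
   Entry [i] of array [j] is kept in the memory cell [16 * i + base + j], where
   [base] is the length of the input. *)
Inductive cmd : Type :=
| CSkip
| CConst of nat & nat
| CAdd of nat & nat & nat
| CSub of nat & nat & nat
| CMul of nat & nat & nat
| CRead of nat & nat          (* r := input[a] *)
| CLoad of nat & nat & nat    (* r := array_j[a] *)
| CStore of nat & nat & nat   (* array_j[a] := b *)
| CEmit of nat
| CSeq of cmd & cmd
| CIfz of nat & cmd & cmd
| CWhile of nat & cmd.

Record state := State {
  rg : nat -> nat;
  ar : nat -> nat -> nat;
  ou : seq nat
}.

Definition upd (T : Type) (f : nat -> T) (i : nat) (x : T) : nat -> T :=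
  fun j => if j == i then x else f j.

Definition setr (s : state) r x := State (upd (rg s) r x) (ar s) (ou s).
Definition seta (s : state) j i x :=
  State (rg s) (upd (ar s) j (upd (ar s j) i x)) (ou s).
Definition seto (s : state) x := State (rg s) (ar s) (rcons (ou s) x).

Section Semantics.
Variables (w : nat) (inp : nat -> nat) (len : nat).

(** The last index is the cost. The side conditions with [w] are what later bounds the numbers held
    by the machine. *)
Inductive ev : cmd -> state -> state -> nat -> Prop :=
| EvSkip s : ev CSkip s s 0
| EvConst s r k : k <= w -> ev (CConst r k) s (setr s r k) 1
| EvAdd s r a b : rg s a + rg s b <= w ->
    ev (CAdd r a b) s (setr s r (rg s a + rg s b)) 1
| EvSub s r a b : rg s a - rg s b <= w ->
    ev (CSub r a b) s (setr s r (rg s a - rg s b)) 1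
| EvMul s r a b : rg s a * rg s b <= w ->
    ev (CMul r a b) s (setr s r (rg s a * rg s b)) 1
| EvRead s r a : rg s a < len -> inp (rg s a) <= w ->
    ev (CRead r a) s (setr s r (inp (rg s a))) 1
| EvLoad s r j a : rg s a <= w -> ar s j (rg s a) <= w ->
    ev (CLoad r j a) s (setr s r (ar s j (rg s a))) 1
| EvStore s j a b : rg s a <= w -> rg s b <= w ->
    ev (CStore j a b) s (seta s j (rg s a) (rg s b)) 1
| EvEmit s a : ev (CEmit a) s (seto s (rg s a)) 1
| EvSeq c1 c2 s s1 s2 k1 k2 : ev c1 s s1 k1 -> ev c2 s1 s2 k2 ->
    ev (CSeq c1 c2) s s2 (k1 + k2)
| EvIfzT a c1 c2 s s1 k : rg s a = 0 -> ev c1 s s1 k ->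
    ev (CIfz a c1 c2) s s1 k.+1
| EvIfzF a c1 c2 s s1 k : rg s a <> 0 -> ev c2 s s1 k ->
    ev (CIfz a c1 c2) s s1 k.+1
| EvWhile0 a c s : rg s a = 0 -> ev (CWhile a c) s s 1
| EvWhileS a c s s1 s2 k1 k2 : rg s a <> 0 -> ev c s s1 k1 ->
    ev (CWhile a c) s1 s2 k2 -> ev (CWhile a c) s s2 (k1 + k2).+1.

End Semantics.

Fixpoint arrays_ok (c : cmd) : bool :=
  match c with
  | CLoad _ j _ | CStore j _ _ => j < 16
  | CSeq c1 c2 | CIfz _ c1 c2 => arrays_ok c1 && arrays_ok c2
  | CWhile _ c => arrays_ok c
  | _ => true
  end.

(* Registers 0 and 1 of the machine hold [base] and 16; registers 2 and 3 are
   used to compute addresses. *)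
Definition compile_address (j a : nat) : program :=
  [:: IMul 2 (a + 4) 1; IAdd 2 2 0; IConst 3 j; IAdd 2 2 3].

Fixpoint compile (off : nat) (c : cmd) : program :=
  match c with
  | CSkip => [::]
  | CConst r k => [:: IConst (r + 4) k]
  | CAdd r a b => [:: IAdd (r + 4) (a + 4) (b + 4)]
  | CSub r a b => [:: ISub (r + 4) (a + 4) (b + 4)]
  | CMul r a b => [:: IMul (r + 4) (a + 4) (b + 4)]
  | CRead r a => [:: ILoad (r + 4) (a + 4)]
  | CLoad r j a => compile_address j a ++ [:: ILoad (r + 4) 2]
  | CStore j a b => compile_address j a ++ [:: IStore 2 (b + 4)]
  | CEmit a => [:: IWrite (a + 4)]
  | CSeq c1 c2 =>
      let p1 := compile off c1 in p1 ++ compile (off + size p1) c2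
  | CIfz a c1 c2 =>
      let p2 := compile off.+1 c2 in
      let l := off + (size p2).+2 in
      let p1 := compile l c1 in
      IJumpZ (a + 4) l :: p2 ++ IJump (l + size p1) :: p1
  | CWhile a c =>
      let p := compile off.+1 c in
      IJumpZ (a + 4) (off + (size p).+2) :: p ++ [:: IJump off]
  end.

(** * Correctness of the compiler *)

Section Compile.
Variables (w W : nat) (inp : nat -> nat) (len : nat) (pr : program).
Hypotheses (lenW : 16 * w + len + 16 <= W).

Definition code_at (off : nat) (q : program) : Prop :=
  forall i, i < size q -> nth IHalt pr (off + i) = nth IHalt q i.

Lemma code_at_cat off q1 q2 : code_at off (q1 ++ q2) ->
  code_at off q1 /\ code_at (off + size q1) q2.
Proof.
move=> H; split=> i iq.
  by rewrite H ?nth_cat ?iq // size_cat ltn_addr.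
by rewrite -addnA H ?size_cat ?ltn_add2l // nth_cat ltnNge leq_addr /= addKn.
Qed.

Lemma code_at_cons off x q : code_at off (x :: q) ->
  nth IHalt pr off = x /\ code_at off.+1 q.
Proof.
move=> H; split; first by have := H 0 isT; rewrite addn0.
by move=> i iq; rewrite addSnnS; apply: (H i.+1).
Qed.

Definition steps (k : nat) (c c' : config) : Prop :=
  iter k (step pr) c = c' /\ forall j, j <= k -> fits_in W (iter j (step pr) c).

Lemma steps_fits k c c' : steps k c c' -> fits_in W c'.
Proof. by move=> [<- F]; apply: F. Qed.

Lemma steps0 c : fits_in W c -> steps 0 c c.
Proof. by move=> H; split=> // j; rewrite leqn0 => /eqP->. Qed.

Lemma steps_trans k1 k2 c1 c2 c3 : steps k1 c1 c2 -> steps k2 c2 c3 ->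
  steps (k1 + k2) c1 c3.
Proof.
move=> [E1 F1] [E2 F2]; split; first by rewrite addnC iterD E1.
move=> j jk; have [/F1//|/ltnW k1j] := leqP j k1.
rewrite -(subnK k1j) iterD E1; apply: F2; move: jk; clear; lia.
Qed.

Lemma steps1 c c' : fits_in W c -> fits_in W c' -> step pr c = c' -> steps 1 c
  c'.
Proof. by move=> Fc Fc' E; split=> // -[|[|]] //= _; rewrite E. Qed.

Lemma steps_reg i rg m o r x : fits_in W (Config i rg m o) -> x <= W ->
  step pr (Config i rg m o) = Config i.+1 [eta rg with r |-> x] m o ->
  steps 1 (Config i rg m o) (Config i.+1 [eta rg with r |-> x] m o).
Proof.
move=> F xW; apply: steps1 => // l /=; split; last by have [] := F l.
by case: ifP => _ //; have [] := F l.
Qed.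

Definition sim (s : state) (c : config) : Prop :=
  [/\ forall r, regs c (r + 4) = rg s r,
      regs c 0 = len /\ regs c 1 = 16,
      forall i, i < len -> memory c i = inp i,
      forall j i, j < 16 -> memory c (16 * i + len + j) = ar s j i
    & output c = ou s].

Lemma steps_set off rg' m o s r x : sim s (Config off rg' m o) ->
  fits_in W (Config off rg' m o) -> x <= W ->
  step pr (Config off rg' m o) = Config off.+1 [eta rg' with r + 4 |-> x] m o ->
  exists c', [/\ steps 1 (Config off rg' m o) c', sim (setr s r x) c' & pc c' =
    off + 1].
Proof.
move=> [S1 [S2 S3] S4 S5 S6] F xW E.
exists (Config off.+1 [eta rg' with r + 4 |-> x] m o).
split; [exact: steps_reg | split=> //= | by rewrite addn1].
- by move=> r'; rewrite /upd eqn_add2r; case: ifP.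
- by rewrite !ifF //; lia.
Qed.

Lemma steps_address off rg' m o s j a : code_at off (compile_address j a) ->
  sim s (Config off rg' m o) -> fits_in W (Config off rg' m o) ->
  rg s a <= w -> j < 16 ->
  exists rg2, [/\ steps 4 (Config off rg' m o) (Config (off + 4) rg2 m o),
    sim s (Config (off + 4) rg2 m o) & rg2 2 = 16 * rg s a + len + j].
Proof.
move=> /code_at_cons[c1 /code_at_cons[c2 /code_at_cons[c3 /code_at_cons[c4
  _]]]].
move=> [S1 [S2 S3] S4 S5 S6] F aw j16 /=.
rewrite /= in S1 S2 S3.
pose x1 := rg s a * 16; pose x2 := x1 + len.
pose r1 := [eta rg' with 2 |-> x1]; pose r2 := [eta r1 with 2 |-> x2].
pose r3 := [eta r2 with 3 |-> j]; pose r4 := [eta r3 with 2 |-> x2 + j].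
have st1 : steps 1 (Config off rg' m o) (Config off.+1 r1 m o).
  by apply: steps_reg => //; [rewrite /x1;
    lia | rewrite /step /current /= c1 S1 S3].
have st2 : steps 1 (Config off.+1 r1 m o) (Config off.+2 r2 m o).
  apply: steps_reg; [exact: steps_fits st1 | rewrite /x2 /x1; lia|].
  by rewrite /step /current /= c2 /r1 /= S2.
have st3 : steps 1 (Config off.+2 r2 m o) (Config off.+3 r3 m o).
  apply: steps_reg; [exact: steps_fits st2 | lia|].
  by rewrite /step /current /= c3.
have st4 : steps 1 (Config off.+3 r3 m o) (Config off.+4 r4 m o).
  apply: steps_reg; [exact: steps_fits st3 | rewrite /x2 /x1; lia|].
  by rewrite /step /current /= c4 /r3 /=.
exists r4; rewrite addn4; split.
- exact: steps_trans st1 (steps_trans st2 (steps_trans st3 st4)).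
- split=> //= r; rewrite !ifF //; lia.
by rewrite /r4 /= /x2 /x1 mulnC.
Qed.

(** The factor 5 is the price of an array access: four instructions for the address and one for the
    memory. The closing jump of a loop or of a conditional is covered by the unit charged for the
    test. *)
Lemma compile_correct c s s' k : ev w inp len c s s' k -> arrays_ok c ->
  forall off cf, code_at off (compile off c) -> pc cf = off -> sim s cf ->
    fits_in W cf ->
  exists k' cf', [/\ k' <= 5 * k, steps k' cf cf', sim s' cf'
                   & pc cf' = off + size (compile off c)].
Proof.
have lift s1 cf off n : (exists c', [/\ steps 1 cf c', sim s1 c' & pc c' = off
  + 1]) ->
   n = 1 -> exists k' cf', [/\ k' <= 5 * 1, steps k' cf cf', sim s1 cf' & pc
     cf' = off + n].
  by move=> [c' [H1 H2 H3]] ->; exists 1, c'.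
elim=> {c s s' k}.
- move=> s _ off cf _ pc_cf S F; exists 0, cf; split=> //;
  last by rewrite addn0.
  exact: steps0.
- move=> s r k kw _ off [i rg' m o] /code_at_cons[c1 _] /= ? S F; subst i.
  by apply: lift => //; apply: steps_set => //;
    [lia | rewrite /step /current /= c1].
- move=> s r a b kw _ off [i rg' m o] /code_at_cons[c1 _] /= ? S F; subst i.
  apply: lift => //; apply: steps_set => //; first lia.
  by case: S => S1 _ _ _ _; rewrite /step /current /= c1 -!S1.
- move=> s r a b kw _ off [i rg' m o] /code_at_cons[c1 _] /= ? S F; subst i.
  apply: lift => //; apply: steps_set => //; first lia.
  by case: S => S1 _ _ _ _; rewrite /step /current /= c1 -!S1.
- move=> s r a b kw _ off [i rg' m o] /code_at_cons[c1 _] /= ? S F; subst i.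
  apply: lift => //; apply: steps_set => //; first lia.
  by case: S => S1 _ _ _ _; rewrite /step /current /= c1 -!S1.
- move=> s r a al kw _ off [i rg' m o] /code_at_cons[c1 _] /= ? S F; subst i.
  apply: lift => //; apply: steps_set => //; first lia.
  by case: S => /= S1 _ S3 _ _; rewrite /step /current /= c1 S1 S3.
- move=> s r j a aw kw /= j16 off [i rg' m o] /(@code_at_cat off
  (compile_address j a) [:: _]).
  move=> [/steps_address H /code_at_cons[c1 _]] /= ? S F; subst i.
  have [rg2 [st S' ad]] := H _ _ _ _ S F aw j16.
  have [||c' [st' S'' pc']] := @steps_set _ _ _ _ _ r (ar s j (rg s a)) S'
    (steps_fits st).
  + lia.
  + case: S' => /= _ _ _ S5 _; rewrite /step /current /= c1 ad S5 //.
  exists 5, c'; split=> //; first exact: (steps_trans st st').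
  by rewrite pc' -addnA.
- move=> s j a b aw bw /= j16 off [i rg' m o] /(@code_at_cat off
  (compile_address j a) [:: _]).
  move=> [/steps_address H /code_at_cons[c1 _]] /= ? S F; subst i.
  have [rg2 [st S' ad]] := H _ _ _ _ S F aw j16.
  have F' := steps_fits st.
  case: S' => /= S1 S2 S3 S5 S6.
  pose c' := Config (off + 4).+1 rg2 [eta m with rg2 2 |-> rg s b] o.
  exists 5, c'; split=> //; last by rewrite addnS.
    apply: (steps_trans st); apply: steps1 => //.
      by move=> l /=; have [] := F' l => /= ? ?; split=> //;
        case: ifP => _ //; lia.
    by rewrite /step /current /= c1 S1.
  split=> //= [l ll|j' l j'16].
    by rewrite ifF ?S3 //; rewrite ad; lia.
  rewrite ad /upd; have [->|nj] := eqVneq j' j.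
    have [->|nl] := eqVneq l (rg s a); first by rewrite eqxx.
    by rewrite ifF ?S5 //; lia.
  by rewrite ifF ?S5 //; lia.
- move=> s a _ off [i rg' m o] /code_at_cons[c1 _] /= ? S F; subst i.
  case: S => /= S1 S2 S3 S5 S6.
  exists 1, (Config off.+1 rg' m (rcons o (rg s a))); split=> //;
    last by rewrite addn1.
    by apply: steps1 => //; rewrite /step /current /= c1 S1.
  by split=> //=; rewrite S6.
- move=> c1 c2 s s1 s2 k1 k2 _ IH1 _ IH2 /= /andP[ok1 ok2] off cf.
  move=> /code_at_cat[at1 at2] pcf S F.
  have [k1' [cf1 [le1 st1 S1 pc1]]] := IH1 ok1 _ _ at1 pcf S F.
  have [k2' [cf2 [le2 st2 S2 pc2]]] := IH2 ok2 _ _ at2 pc1 S1 (steps_fits st1).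
  exists (k1' + k2'), cf2; split=> //; first lia;
    first exact: steps_trans st1 st2.
  by rewrite size_cat addnA.
- move=> a c1 c2 s s1 k a0 _ IH /= /andP[ok1 ok2] off [i rg' m o].
  move=> /code_at_cons[j1 /code_at_cat[at2 /code_at_cons[j2 at1]]] /= ? S F;
    subst i.
  move: at1; rewrite !addSn -!addnS => at1.
  have st0 : steps 1 (Config off rg' m o) (Config (off + (size (compile off.+1
    c2)).+2) rg' m o).
    by apply: steps1 => //; rewrite /step /current /= j1; case: S => /= -> *;
      rewrite a0.
  have S' : sim s (Config (off + (size (compile off.+1 c2)).+2) rg' m o) by [].
  have [k' [cf1 [le1 st1 S1 pc1]]] := IH ok1 _ (Config (off + (size (compile
    off.+1 c2)).+2) rg' m o) at1 erefl S' (steps_fits st0).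
  exists (1 + k'), cf1; split=> //; first lia; first exact: steps_trans st0 st1.
  by rewrite pc1 size_cat /=; lia.
- move=> a c1 c2 s s1 k a0 _ IH /= /andP[ok1 ok2] off [i rg' m o].
  move=> /code_at_cons[j1 /code_at_cat[at2 /code_at_cons[j2 at1]]] /= ? S F;
    subst i.
  have st0 : steps 1 (Config off rg' m o) (Config off.+1 rg' m o).
    apply: steps1 => //; rewrite /step /current /= j1; case: S => /= -> *.
    by case: eqP a0.
  have S' : sim s (Config off.+1 rg' m o) by [].
  have [k' [[i1 rg1 m1 o1] [le1 st1 S1 pc1]]] := IH ok2 _ (Config off.+1 rg' m
    o) at2 erefl S' (steps_fits st0).
  rewrite /= in pc1.
  set l := _ + size (compile (off + _) c1) in j2 *.
  exists (1 + k' + 1), (Config l rg1 m1 o1); split=> //=; first lia; last first.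
    by rewrite size_cat /l /=; lia.
  apply: steps_trans (steps_trans st0 st1) _.
  apply: steps1; [exact: steps_fits st1 | exact: steps_fits st1|].
  by rewrite /step /current /= pc1 j2.
- move=> a c s a0 /= ok off [i rg' m o] /code_at_cons[j1 _] /= ? S F; subst i.
  exists 1, (Config (off + (size (compile off.+1 c)).+2) rg' m o); split=> //.
    by apply: steps1 => //; rewrite /step /current /= j1; case: S => /= -> *;
      rewrite a0.
  by rewrite /= size_cat /=; lia.
move=> a c s s1 s2 k1 k2 a0 _ IH1 _ IH2 /= ok off [i rg' m o] atw.
have := atw => /code_at_cons[j1 /code_at_cat[at1 /code_at_cons[j2 _]]] /= ? S
  F; subst i.
have st0 : steps 1 (Config off rg' m o) (Config off.+1 rg' m o).
  apply: steps1 => //; rewrite /step /current /= j1; case: S => /= -> *.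
  by case: eqP a0.
have S' : sim s (Config off.+1 rg' m o) by [].
have [k1' [[i1 rg1 m1 o1] [le1 st1 S1 /= pc1]]] := IH1 ok _ (Config off.+1 rg'
  m o) at1 erefl S' (steps_fits st0).
have st2 : steps 1 (Config i1 rg1 m1 o1) (Config off rg1 m1 o1).
  apply: steps1; [exact: steps_fits st1 | exact: steps_fits st1|].
  by rewrite /step /current /= pc1 j2.
have S1' : sim s1 (Config off rg1 m1 o1) by [].
have [k2' [cf2 [le2 st3 S2 pc2]]] := IH2 ok _ (Config off rg1 m1 o1) atw erefl
  S1' (steps_fits st2).
exists (1 + k1' + 1 + k2'), cf2; split=> //; first lia.
exact: steps_trans (steps_trans (steps_trans st0 st1) st2) st3.
Qed.

End Compile.

(** Cell [n + 2] of the input is the end of the last adjacency list, hence the length of the input.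
    It is loaded as [base], the place where the arrays begin. *)
Definition prelude : program :=
  [:: IConst 0 1; ILoad 0 0; IConst 1 2; IAdd 0 0 1; ILoad 0 0; IConst 1 16].

Definition compile_program (c : cmd) : program :=
  prelude ++ compile 6 c ++ [:: IHalt].

Definition initial_state := State (fun=> 0) (fun _ => fun=> 0) [::].

Lemma compile_program_correct (c : cmd) w W (input : seq nat) s k :
  arrays_ok c -> 16 * w + size input + 16 <= W ->
  (forall i, nth 0 input i <= W) ->
  nth 0 input 1 + 2 <= W -> nth 0 input (nth 0 input 1 + 2) = size input ->
  ev w (nth 0 input) (size input) c initial_state s k ->
  exists2 k', k' <= 5 * k + 6 &
    computes (compile_program c) W input (ou s) k'.
Proof.
move=> ok leW inW n2W lenE evc.
set pr := compile_program c.
have at0 : code_at pr 6 (compile 6 c).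
  move=> i ic; rewrite /pr /compile_program nth_cat ltnNge leq_addr /= addKn.
  by rewrite nth_cat ic.
pose cf' := iter 6 (step pr) (initial input).
have r0 : regs cf' 0 = size input by rewrite -lenE.
have st : steps W pr 6 (initial input) cf'.
  split=> // j; have n1 := inW 1.
  do 7 (case: j => [_ i|j]; first by
    rewrite /initial /fits_in /=; split=> //; do ?case: ifP => //; lia).
  by [].
have S : sim (nth 0 input) (size input) initial_state cf'.
  split=> //=.
  - by move=> r; rewrite !ifF //; lia.
  - by move=> j i _; rewrite nth_default //; lia.
have [k' [c2 [le2 st2 S2 pc2]]] := compile_correct leW evc ok at0 (erefl : pc
  cf' = 6) S (steps_fits st).
have [E2 F2] := steps_trans st st2.
exists (6 + k'); first lia.
split.
- rewrite /run E2 /halted /current pc2 /pr /compile_program nth_cat ltnNge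
  leq_addr /=.
  by rewrite addKn nth_cat ltnn subnn.
- by rewrite /run E2; case: S2.
by move=> j jk; apply: F2.
Qed.

(** * Frame rule and weakest preconditions with cost *)

Fixpoint modr (c : cmd) : seq nat :=
  match c with
  | CConst r _ | CAdd r _ _ | CSub r _ _ | CMul r _ _ | CRead r _ | CLoad r _ _
      => [:: r]
  | CSeq c1 c2 | CIfz _ c1 c2 => modr c1 ++ modr c2
  | CWhile _ c => modr c
  | _ => [::]
  end.

Fixpoint moda (c : cmd) : seq nat :=
  match c with
  | CStore j _ _ => [:: j]
  | CSeq c1 c2 | CIfz _ c1 c2 => moda c1 ++ moda c2
  | CWhile _ c => moda c
  | _ => [::]
  end.

Fixpoint emits (c : cmd) : bool :=
  match c with
  | CEmit _ => true
  | CSeq c1 c2 | CIfz _ c1 c2 => emits c1 || emits c2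
  | CWhile _ c => emits c
  | _ => false
  end.

(** What may change is read off the text of the command, so that the side conditions of the frame
    rule are settled by computation. *)
Definition frame (c : cmd) (s s' : state) : Prop :=
  [/\ forall r, r \notin modr c -> rg s' r = rg s r,
      forall j, j \notin moda c -> ar s' j = ar s j
    & ~~ emits c -> ou s' = ou s].

Lemma frame_refl c s : frame c s s. Proof. by []. Qed.

Lemma frame_trans c s1 s2 s3 : frame c s1 s2 -> frame c s2 s3 -> frame c s1 s3.
Proof.
move=> [r1 a1 o1] [r2 a2 o2]; split=> [r rc|j jc|ec].
- by rewrite r2 // r1.
- by rewrite a2 // a1.
by rewrite o2 // o1.
Qed.

Lemma frame_sub c c' s s' : {subset modr c <= modr c'} ->
  {subset moda c <= moda c'} -> (emits c -> emits c') ->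
  frame c s s' -> frame c' s s'.
Proof.
move=> sr sa se [r a o]; split=> [x xc|x xc|xc].
- by apply: r; apply: contra xc => /sr.
- by apply: a; apply: contra xc => /sa.
by apply: o; apply: contra xc.
Qed.

Section Logic.
Variables (w : nat) (inp : nat -> nat) (len : nat).
Notation ev := (ev w inp len).

Lemma ev_frame c s s' k : ev c s s' k -> frame c s s'.
Proof.
elim=> {c s s' k}; try by move=> *; apply: frame_refl.
1-6: by move=> *; split=> // r' /=; rewrite inE /upd => /negPf->.
- by move=> *; split=> // r' /=; rewrite inE /upd => /negPf->.
- by move=> *; split.
- move=> c1 c2 s s1 s2 k1 k2 _ F1 _ F2; apply: (@frame_trans _ _ s1).
    by apply: frame_sub F1 => [x|x|] /=; rewrite ?mem_cat => ->.
  by apply: frame_sub F2 => [x|x|] /=; rewrite ?mem_cat => ->; rewrite orbT.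
- move=> a c1 c2 s s1 k _ _.
  by apply: frame_sub => [x|x|] /=; rewrite ?mem_cat => ->.
- move=> a c1 c2 s s1 k _ _.
  by apply: frame_sub => [x|x|] /=; rewrite ?mem_cat => ->; rewrite orbT.
by move=> a c s s1 s2 k1 k2 _ _ F1 _ F2; apply: frame_trans F1 F2.
Qed.

Definition wp (c : cmd) (s : state) (Q : state -> nat -> Prop) : Prop :=
  exists s' k, ev c s s' k /\ Q s' k.

(** Weakening supplies the frame as well, so a specification needs to mention only what the command
    changes. *)
Lemma wp_conseq c s (Q Q' : state -> nat -> Prop) : wp c s Q ->
  (forall s' k, frame c s s' -> Q s' k -> Q' s' k) -> wp c s Q'.
Proof.
move=> [s' [k [H q]]] QQ'; exists s', k; split=> //.
by apply: QQ' q; apply: ev_frame H.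
Qed.

Lemma wp_skip s (Q : state -> nat -> Prop) : Q s 0 -> wp CSkip s Q.
Proof. by move=> q; exists s, 0; split=> //; constructor. Qed.

Lemma wp_const s r k (Q : state -> nat -> Prop) : k <= w -> Q (setr s r k) 1 ->
  wp (CConst r k) s Q.
Proof. by move=> kw q; exists (setr s r k), 1; split=> //; constructor. Qed.

Lemma wp_add s r a b (Q : state -> nat -> Prop) : rg s a + rg s b <= w ->
  Q (setr s r (rg s a + rg s b)) 1 -> wp (CAdd r a b) s Q.
Proof. by move=> kw q; eexists; exists 1; split; [constructor|]. Qed.

Lemma wp_sub s r a b (Q : state -> nat -> Prop) : rg s a - rg s b <= w ->
  Q (setr s r (rg s a - rg s b)) 1 -> wp (CSub r a b) s Q.
Proof. by move=> kw q; eexists; exists 1; split; [constructor|]. Qed.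

Lemma wp_mul s r a b (Q : state -> nat -> Prop) : rg s a * rg s b <= w ->
  Q (setr s r (rg s a * rg s b)) 1 -> wp (CMul r a b) s Q.
Proof. by move=> kw q; eexists; exists 1; split; [constructor|]. Qed.

Lemma wp_read s r a (Q : state -> nat -> Prop) : rg s a < len ->
  inp (rg s a) <= w -> Q (setr s r (inp (rg s a))) 1 -> wp (CRead r a) s Q.
Proof. by move=> *; eexists; exists 1; split; [constructor|]. Qed.

Lemma wp_load s r j a (Q : state -> nat -> Prop) : rg s a <= w ->
  ar s j (rg s a) <= w -> Q (setr s r (ar s j (rg s a))) 1 -> wp (CLoad r j a)
    s Q.
Proof. by move=> *; eexists; exists 1; split; [constructor|]. Qed.

Lemma wp_store s j a b (Q : state -> nat -> Prop) : rg s a <= w -> rg s b <= w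
  ->
  Q (seta s j (rg s a) (rg s b)) 1 -> wp (CStore j a b) s Q.
Proof. by move=> *; eexists; exists 1; split; [constructor|]. Qed.

Lemma wp_emit s a (Q : state -> nat -> Prop) : Q (seto s (rg s a)) 1 ->
  wp (CEmit a) s Q.
Proof. by move=> *; eexists; exists 1; split; [constructor|]. Qed.

Lemma wp_seq c1 c2 s (Q : state -> nat -> Prop) :
  wp c1 s (fun s1 k1 => wp c2 s1 (fun s2 k2 => Q s2 (k1 + k2))) ->
  wp (CSeq c1 c2) s Q.
Proof.
move=> [s1 [k1 [H1 [s2 [k2 [H2 q]]]]]]; exists s2, (k1 + k2); split=> //.
exact: EvSeq H1 H2.
Qed.

Lemma wp_ifz a c1 c2 s (Q : state -> nat -> Prop) :
  (rg s a = 0 -> wp c1 s (fun s1 k => Q s1 k.+1)) ->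
  (rg s a <> 0 -> wp c2 s (fun s1 k => Q s1 k.+1)) ->
  wp (CIfz a c1 c2) s Q.
Proof.
move=> H1 H2; case: (eqVneq (rg s a) 0) => [/[dup] a0 /H1|/eqP/[dup] a0 /H2].
  by move=> [s1 [k [H q]]]; exists s1, k.+1; split=> //; apply: EvIfzT.
by move=> [s1 [k [H q]]]; exists s1, k.+1; split=> //; apply: EvIfzF.
Qed.

(** A stretch of the run of a loop that need not reach its exit. Consecutive stretches can be
    composed, which allows the recursion of [branching] to be matched with a single loop. *)
Inductive iters (a : nat) (c : cmd) : state -> state -> nat -> Prop :=
| Iters0 s : iters a c s s 0
| ItersS s s1 s2 k1 k2 : rg s a <> 0 -> ev c s s1 k1 -> iters a c s1 s2 k2 ->
    iters a c s s2 (k1 + k2).+1.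

Lemma iters_trans a c s1 s2 s3 k1 k2 : iters a c s1 s2 k1 ->
  iters a c s2 s3 k2 -> iters a c s1 s3 (k1 + k2).
Proof.
move=> H; elim: H k2 => {s1 s2 k1} [s //|s s1 s2 k1 k2 a0 H _ IH] k3 /IH H'.
by rewrite addSn -addnA; apply: ItersS H H'.
Qed.

Lemma iters1 a c s s1 k : rg s a <> 0 -> ev c s s1 k -> iters a c s s1 k.+1.
Proof. by move=> a0 H; rewrite -(addn0 k); apply: ItersS H (Iters0 _ _ _). Qed.

Lemma iters_frame a c s s' k : iters a c s s' k -> frame c s s'.
Proof.
elim=> {s s' k} [s|s s1 s2 k1 k2 _ /ev_frame F1 _ F2]; first exact: frame_refl.
exact: frame_trans F1 F2.
Qed.

Lemma wp_while a c s s' k (Q : state -> nat -> Prop) : iters a c s s' k ->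
  rg s' a = 0 -> Q s' k.+1 -> wp (CWhile a c) s Q.
Proof.
move=> H a0 q; exists s', k.+1; split=> // {q}; elim: H a0 => {s s' k}.
  by move=> s a0; apply: EvWhile0.
move=> s s1 s2 k1 k2 a0 H _ IH /IH H'; rewrite -addnS;
  apply: EvWhileS H H' => //.
Qed.

(* Register 0 holds the constant 1, and [z] the number of remaining rounds. *)
Definition CFor (i n z : nat) (body : cmd) : cmd :=
  CSeq (CSub z n i) (CWhile z (CSeq body (CSeq (CAdd i i 0) (CSub z n i)))).

(** [Inv] is required after the counter and the number of remaining rounds have been updated, hence
    the two [setr]. A round costs 3 beyond its body, for the increment, the subtraction and the loop
    test; the final 2 pays for the first subtraction and the last test. *)
Lemma wp_for i n z body s (Inv : nat -> state -> Prop) lo hi (B : nat -> nat)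
    (Q : state -> nat -> Prop) :
  uniq [:: 0; i; n; z] -> 0 \notin modr body -> i \notin modr body ->
  n \notin modr body ->
  rg s 0 = 1 -> rg s i = lo -> rg s n = hi -> lo <= hi -> hi <= w ->
  Inv lo (setr s z (hi - lo)) ->
  (forall j s1, lo <= j -> j < hi -> frame (CFor i n z body) s s1 ->
     rg s1 i = j -> Inv j s1 ->
     wp body s1 (fun s2 k => k <= B j /\
       Inv j.+1 (setr (setr s2 i j.+1) z (hi - j.+1)))) ->
  (forall s2 k, frame (CFor i n z body) s s2 -> rg s2 i = hi -> Inv hi s2 ->
     k <= \sum_(lo <= j < hi) (B j + 3) + 2 -> Q s2 k) ->
  wp (CFor i n z body) s Q.
Proof.
move=> u0 b0 bi bn s0 si sn lohi hiw inv0 step_inv post.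
have /and4P[] := u0; rewrite !inE !negb_or => /and3P[n0i n0n n0z] /andP[nin
  niz] nnz _.
pose wbody := CSeq body (CSeq (CAdd i i 0) (CSub z n i)).
have modFor r : r \notin modr (CFor i n z body) =
    [&& r != z, r \notin modr body & r != i].
  rewrite /= !(inE, mem_cat) !negb_or.
  by case: (r != z) => //=; case: (r \notin modr body); rewrite //= andbT.
suff loop m s1 j : hi - j < m -> frame (CFor i n z body) s s1 -> lo <= j <= hi
  ->
    rg s1 i = j -> rg s1 z = hi - j -> Inv j s1 ->
    exists s' k, iters z wbody s1 s' k /\
    [/\ frame (CFor i n z body) s s', rg s' i = hi /\ rg s' z = 0, Inv hi s'
      & k <= \sum_(j <= l < hi) (B l + 3)].
  apply: wp_seq; apply: wp_sub; first by rewrite sn si; lia.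
  rewrite sn si; set s1 := setr s z _.
  have F1 : frame (CFor i n z body) s s1.
    by split=> // r; rewrite modFor => /and3P[/negPf rz _ _];
      rewrite /= /upd rz.
  have [|||s' [k [H [F' [si' sz'] inv' leK]]]] := loop _ s1 lo (ltnSn _) F1 _ _
    _ inv0.
  - by rewrite leqnn.
  - by rewrite /= /upd (negPf niz).
  - by rewrite /= /upd eqxx.
  by apply: (wp_while H) => //; apply: post => //; rewrite add1n addn2 !ltnS.
elim: m s1 j => // m IHm s1 j ltm F1 /andP[loj jhi] s1i s1z inv.
case: (ltngtP j hi) jhi => // [lt_jhi _|eq_jhi _]; last first.
  exists s1, 0; split; first exact: Iters0.
  by rewrite s1i s1z eq_jhi subnn; split=> //; rewrite -eq_jhi.
have [s2 [k [H2 [leB inv2]]]] := step_inv j s1 loj lt_jhi F1 s1i inv.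
have [F2r F2a F2o] := ev_frame H2; have [F1r F1a F1o] := F1.
have s2i : rg s2 i = j by rewrite F2r.
have s20 : rg s2 0 = 1 by rewrite F2r // F1r // modFor b0 n0i n0z.
have s2n : rg s2 n = hi.
  by rewrite F2r // F1r // modFor bn nnz eq_sym nin.
set s4 := setr _ z _ in inv2.
have H4 : ev wbody s1 s4 (k + (1 + 1)).
  apply: EvSeq H2 _.
  have E3 : setr s2 i j.+1 = setr s2 i (rg s2 i + rg s2 0) by rewrite s2i s20
    addn1.
  have s3i : rg (setr s2 i j.+1) i = j.+1 by rewrite /= /upd eqxx.
  have s3n : rg (setr s2 i j.+1) n = hi by rewrite /= /upd eq_sym (negPf nin).
  apply: (@EvSeq _ _ _ _ _ _ (setr s2 i j.+1)).
    by rewrite E3; constructor; rewrite s2i s20; lia.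
  have -> : s4 = setr (setr s2 i j.+1) z (rg (setr s2 i j.+1) n - rg (setr s2 i
    j.+1) i).
    by rewrite s3i s3n.
  by constructor; rewrite s3i s3n; lia.
have F4 : frame (CFor i n z body) s s4.
  apply: frame_trans F1 _; apply: (frame_sub _ _ _ (ev_frame H4)) => [x|x|] /=.
  - by rewrite !(inE, mem_cat) => ->; rewrite orbT.
  - by rewrite !(inE, mem_cat).
  - by [].
have [||||s' [k' [H' [F' E' inv' leK]]]] := IHm s4 j.+1 _ F4 _ _ _ inv2.
- lia.
- by rewrite lt_jhi leqW.
- by rewrite /= /upd (negPf niz) eqxx.
- by rewrite /= /upd eqxx.
exists s', (k + 2 + k').+1; split; first by apply: ItersS H4 H'; rewrite s1z;
  lia.
split=> //; rewrite big_ltn //; lia.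
Qed.

Lemma wp_for_const i n z body s (Inv : nat -> state -> Prop) hi B
    (Q : state -> nat -> Prop) :
  uniq [:: 0; i; n; z] -> 0 \notin modr body -> i \notin modr body ->
  n \notin modr body ->
  rg s 0 = 1 -> rg s i = 0 -> rg s n = hi -> hi <= w ->
  Inv 0 (setr s z hi) ->
  (forall j s1, j < hi -> frame (CFor i n z body) s s1 ->
     rg s1 i = j -> Inv j s1 ->
     wp body s1 (fun s2 k => k <= B /\
       Inv j.+1 (setr (setr s2 i j.+1) z (hi - j.+1)))) ->
  (forall s2 k, frame (CFor i n z body) s s2 -> rg s2 i = hi -> Inv hi s2 ->
     k <= hi * (B + 3) + 2 -> Q s2 k) ->
  wp (CFor i n z body) s Q.
Proof.
move=> u0 b0 bi bn s0 si sn hiw inv0 step_inv post.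
apply: (wp_for (Inv := Inv) (lo := 0) (B := fun=> B) u0 b0 bi bn s0 si sn) =>
  //.
- by rewrite subn0.
- by move=> j s1 _; apply: step_inv.
by move=> s2 k F s2i inv; rewrite sum_nat_const_nat subn0; apply: post.
Qed.

End Logic.

(** * The program *)

Local Notation vone := 0 (only parsing).
Local Notation vN := 1 (only parsing).
Local Notation vD := 2 (only parsing).
Local Notation vV := 3 (only parsing).
Local Notation vlo := 4 (only parsing).
Local Notation vhi := 5 (only parsing).
Local Notation vR := 6 (only parsing).
Local Notation vsp := 7 (only parsing).
Local Notation vmx := 8 (only parsing).
Local Notation vmi := 9 (only parsing).
Local Notation vhead := 10 (only parsing).
Local Notation vtail := 11 (only parsing).
Local Notation vmore := 12 (only parsing).
Local Notation vi := 20 (only parsing).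
Local Notation vzi := 21 (only parsing).
Local Notation vj := 22 (only parsing).
Local Notation vzj := 23 (only parsing).
Local Notation vp := 24 (only parsing).
Local Notation vzp := 25 (only parsing).
Local Notation vu := 26 (only parsing).
Local Notation vub := 27 (only parsing).
Local Notation vd := 28 (only parsing).
Local Notation vc := 29 (only parsing).
Local Notation vx := 30 (only parsing).
Local Notation vy := 31 (only parsing).
Local Notation vsb := 32 (only parsing).
Local Notation vbad := 33 (only parsing).
Local Notation vci := 34 (only parsing).

(* ADJ is the adjacency matrix, DEG counts the neighbours that are not yet
   removed, QU is the queue of vertices, REM marks the removed ones, RL lists
     the
   remaining neighbours of the current vertex, STK is the stack of subproblems
     and
   CUR the current one. In a subproblem, 0 marks the undecided vertices, 1 the
   chosen ones and 2 the discarded ones. *)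
Local Notation ADJ := 0 (only parsing).
Local Notation DEG := 1 (only parsing).
Local Notation QU := 2 (only parsing).
Local Notation REM := 3 (only parsing).
Local Notation RL := 4 (only parsing).
Local Notation STK := 5 (only parsing).
Local Notation CUR := 6 (only parsing).

Local Notation "c1 ;; c2" := (CSeq c1 c2) (at level 80, right associativity).

Definition CMov r a := CMul r a vone.

(* Register [vub] holds the offset of a row of the adjacency matrix, as set by
   [load_row]. *)
Definition load_adj (a : nat) : cmd :=
  CLoad vx RL a ;; CAdd vx vub vx ;; CLoad vx ADJ vx.

Definition load_row (a : nat) : cmd := CLoad vu RL a ;; CMul vub vu vN.

Definition codeg_cmd : cmd :=
  load_row vi ;; CConst vd 0 ;; CConst vj 0 ;;
  CFor vj vR vzj
    (CLoad vc CUR vj ;;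
     CIfz vc (load_adj vj ;; CIfz vx (CAdd vd vd vone) CSkip) CSkip).

(** An undecided vertex is among its own non-neighbours, so 0 is a safe start, and a final maximum
    of 0 means that nothing is undecided. *)
Definition argmax_cmd : cmd :=
  CConst vmx 0 ;; CConst vi 0 ;;
  CFor vi vR vzi
    (CLoad vci CUR vi ;;
     CIfz vci
       (codeg_cmd ;; CSub vx vd vmx ;;
        CIfz vx CSkip (CMov vmx vd ;; CMov vmi vi))
       CSkip).

(** Subtraction is truncated, so the sum of the two differences of [vi] and [vmi] vanishes exactly
    when they are equal. *)
Definition push_include_cmd : cmd :=
  load_row vmi ;; CMul vsb vsp vR ;; CConst vi 0 ;;
  CFor vi vR vzi
    (CLoad vc CUR vi ;;
     CIfz vc
       (CSub vx vi vmi ;; CSub vy vmi vi ;; CAdd vx vx vy ;;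
        CIfz vx (CConst vc 1)
          (load_adj vi ;; CIfz vx (CConst vc 2) CSkip))
       CSkip ;;
     CAdd vx vsb vi ;; CStore STK vx vc) ;;
  CAdd vsp vsp vone.

Definition push_cmd : cmd :=
  CMul vsb vsp vR ;; CConst vi 0 ;;
  CFor vi vR vzi
    (CLoad vc CUR vi ;; CAdd vx vsb vi ;; CStore STK vx vc) ;;
  CAdd vsp vsp vone.

Definition pop_cmd : cmd :=
  CSub vsp vsp vone ;; CMul vsb vsp vR ;; CConst vi 0 ;;
  CFor vi vR vzi
    (CAdd vx vsb vi ;; CLoad vc STK vx ;; CStore CUR vi vc).

(** At a leaf the undecided vertices all join the clique, so its members are those with mark 0 or 1.
    Truncated subtraction of 1 recognises them. *)
Definition count_row_cmd : cmd :=
  CConst vd 0 ;; CConst vi 0 ;;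
  CFor vi vR vzi
    (CLoad vc CUR vi ;; CSub vx vc vone ;;
     CIfz vx (load_adj vi ;; CIfz vx (CAdd vd vd vone) CSkip) CSkip).

Definition check_cmd : cmd :=
  CConst vbad 0 ;; CMov vp vlo ;;
  CFor vp vhi vzp
    (CRead vu vp ;; CMul vub vu vN ;; count_row_cmd ;;
     CIfz vd (CConst vbad 1) CSkip).

Definition print_cmd : cmd :=
  CConst vd 1 ;; CConst vi 0 ;;
  CFor vi vR vzi
    (CLoad vc CUR vi ;; CSub vx vc vone ;; CIfz vx (CAdd vd vd vone) CSkip) ;;
  CEmit vd ;; CEmit vV ;; CConst vi 0 ;;
  CFor vi vR vzi
    (CLoad vc CUR vi ;; CSub vx vc vone ;;
     CIfz vx (CLoad vx RL vi ;; CEmit vx) CSkip).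

Definition leaf_cmd : cmd := check_cmd ;; CIfz vbad print_cmd CSkip.

Definition node_cmd : cmd :=
  pop_cmd ;; argmax_cmd ;; CSub vx vmx vone ;;
  CIfz vx leaf_cmd
    (push_include_cmd ;; CConst vc 2 ;; CStore CUR vmi vc ;; push_cmd).

Definition enum_cmd : cmd :=
  CConst vx 0 ;; CConst vi 0 ;;
  CFor vi vR vzi (CStore STK vi vx) ;;
  CConst vsp 1 ;; CWhile vsp node_cmd.

Definition bounds_cmd : cmd :=
  CConst vx 2 ;; CAdd vx vV vx ;; CRead vlo vx ;;
  CAdd vx vx vone ;; CRead vhi vx.

Definition enqueue_cmd (a : nat) : cmd :=
  CStore QU vtail a ;; CAdd vtail vtail vone.

(** A vertex is enqueued when its remaining degree becomes equal to the threshold, that is, when it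
    drops from one above it. This happens at most once per vertex. *)
Definition scan_cmd : cmd :=
  CStore REM vV vone ;; CConst vR 0 ;; CMov vp vlo ;;
  CFor vp vhi vzp
    (CRead vu vp ;; CLoad vx REM vu ;;
     CIfz vx
       (CStore RL vR vu ;; CAdd vR vR vone ;;
        CLoad vd DEG vu ;; CSub vd vd vone ;; CStore DEG vu vd ;;
        CSub vx vd vD ;; CSub vy vD vd ;; CAdd vx vx vy ;;
        CIfz vx (enqueue_cmd vu) CSkip)
       CSkip).

Definition vertex_cmd : cmd :=
  CLoad vV QU vhead ;; CAdd vhead vhead vone ;;
  bounds_cmd ;; scan_cmd ;; enum_cmd ;; CSub vmore vtail vhead.

(** The matrix is never cleared, since unwritten array entries are 0. The time is thus proportional
    to the number of vertices and edges and not to [n ^ 2]. *)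
Definition load_graph_cmd : cmd :=
  CConst vtail 0 ;; CConst vV 0 ;;
  CFor vV vN vzi
    (bounds_cmd ;; CMul vub vV vN ;; CMov vp vlo ;;
     CFor vp vhi vzp
       (CRead vu vp ;; CAdd vx vub vu ;; CStore ADJ vx vone) ;;
     CSub vd vhi vlo ;; CStore DEG vV vd ;;
     CSub vx vd vD ;; CIfz vx (enqueue_cmd vV) CSkip).

(* The empty graph is treated apart: its only maximal clique is empty. *)
Definition main_cmd : cmd :=
  CConst vone 1 ;; CConst vx 0 ;; CRead vx vx ;; CRead vN vone ;;
  CMul vD vx vx ;; CConst vx 6 ;; CMul vD vD vx ;;
  CIfz vN
    (CEmit vN)
    (load_graph_cmd ;; CConst vhead 0 ;; CSub vmore vtail vhead ;;
     CWhile vmore vertex_cmd).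

Arguments upd T f i x j /.

(* Symbolic execution of straight-line code, rewriting the values of registers
   with [E]. *)
Ltac exec_step E :=
  lazymatch goal with
  | |- wp _ _ _ (CSeq _ _) _ _ => apply: wp_seq; exec_step E
  | |- wp _ _ _ CSkip _ _ => apply: wp_skip; rewrite /= ?E
  | |- wp _ _ _ (CConst _ _) _ _ => apply: wp_const;
    [try solve [done | lia] | rewrite /= ?E]
  | |- wp _ _ _ (CAdd _ _ _) _ _ => apply: wp_add; rewrite /= ?E;
    [try solve [done | lia] | ]
  | |- wp _ _ _ (CSub _ _ _) _ _ => apply: wp_sub; rewrite /= ?E;
    [try solve [done | lia] | ]
  | |- wp _ _ _ (CMul _ _ _) _ _ => apply: wp_mul; rewrite /= ?E;
    [try solve [done | lia] | ]
  | |- wp _ _ _ (CRead _ _) _ _ => apply: wp_read; rewrite /= ?E;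
    [try solve [done | lia] | try solve [done | lia] | ]
  | |- wp _ _ _ (CLoad _ _ _) _ _ => apply: wp_load; rewrite /= ?E;
    [try solve [done | lia] | try solve [done | lia] | ]
  | |- wp _ _ _ (CStore _ _ _) _ _ => apply: wp_store; rewrite /= ?E;
    [try solve [done | lia] | try solve [done | lia] | ]
  | |- wp _ _ _ (CEmit _) _ _ => apply: wp_emit; rewrite /= ?E
  end.

(** * Correctness of the operations on one subproblem *)

Section Node.
Variables (w : nat) (inp : nat -> nat) (len : nat).
Variables (n : nat) (e : rel 'I_n) (v : 'I_n) (Rl : seq 'I_n).
Hypotheses (e_irr : irreflexive e) (Rl_uniq : uniq Rl).
Hypothesis (w_large : (n + 5) * (n + 5) + len <= w).

Local Notation r := (size Rl).
Local Notation el := (nth v Rl).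

Lemma size_Rl : r <= n.
Proof. by have := max_card (mem Rl); rewrite (card_uniqP Rl_uniq) card_ord. Qed.

Lemma adj_index (x y : 'I_n) : x * n + y <= w.
Proof. have := ltn_ord x; have := ltn_ord y; move: w_large; clear; nia. Qed.

Lemma row_index (x : 'I_n) : x * n <= w.
Proof. by apply: leq_trans (adj_index x x); apply: leq_addr. Qed.

Lemma n_le_w : n + 5 <= w.
Proof. move: w_large; clear; nia. Qed.

Lemma stack_index q i : q <= r.+1 -> i < r -> q * r + i <= w.
Proof. move=> qr ir; have := size_Rl; move: w_large; nia. Qed.

Definition ctx (s : state) : Prop :=
  [/\ rg s vone = 1, rg s vN = n, rg s vR = r,
      forall x y : 'I_n, ar s ADJ (x * n + y) = e x y
    & forall i, i < r -> ar s RL i = el i].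

Lemma ctx_frame c s s' : frame c s s' ->
  all (fun x => x \notin modr c) [:: vone; vN; vR] ->
  all (fun x => x \notin moda c) [:: ADJ; RL] -> ctx s -> ctx s'.
Proof.
move=> [Fr Fa _] /and4P[m0 m1 m2 _] /and3P[a0 a1 _] [c1 c2 c3 c4 c5].
by split; rewrite ?Fr ?Fa.
Qed.

Definition code (S K : {set 'I_n}) (x : 'I_n) : nat :=
  if x \in S then 0 else if x \in K then 1 else 2.

Definition status (S K : {set 'I_n}) (f : nat -> nat) : Prop :=
  forall i, i < r -> f i = code S K (el i).

Lemma code_le2 S K x : code S K x <= 2.
Proof. by rewrite /code; case: ifP => // _; case: ifP. Qed.

Lemma code_eq0 S K x : code S K x = 0 -> x \in S.
Proof. by rewrite /code; case: ifP => // _; case: ifP. Qed.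

Lemma code_neq0 S K x : code S K x <> 0 -> x \notin S.
Proof. by rewrite /code; case: ifP. Qed.

Lemma wp_codeg s S K i : ctx s -> status S K (ar s CUR) ->
  S \subset Rl -> rg s vi = i -> i < r ->
  wp w inp len codeg_cmd s
    (fun s' k => rg s' vd = codeg e S (el i) /\ k <= r * 20 + 20).
Proof.
move=> [c1 c2 c3 c4 c5] stat sS si ir; have := n_le_w; have := size_Rl => rn nw.
have el_n k : el k < n by apply: ltn_ord.
have rowi := row_index (el i).
have E := (si, c1, c2, c3, c5 _ ir).
have eli := el_n i; rewrite /codeg_cmd /load_row; do 4 exec_step E.
pose P : pred 'I_n := fun x => (x \in S) && ~~ e (el i) x.
have codegE : count P Rl = codeg e S (el i).
  rewrite -size_filter /codeg -(card_uniqP (filter_uniq P Rl_uniq)).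
  apply: eq_card => x; rewrite mem_filter !inE /P.
  case xS: (x \in S); rewrite ?andbF ?andbT //=.
  by rewrite (subsetP sS) ?andbT.
apply: (wp_for_const (B := 12) (Inv := fun j s1 => rg s1 vd = count P (take j
  Rl)) (hi := r)) => //=.
- exact: leq_trans rn (leq_trans (leq_addr _ _) nw).
- by rewrite take0.
- move=> j s1 jr [Fr Fa _] s1j inv.
  have E1 : (rg s1 vone = 1) * (rg s1 vub = el i * n) *
     (ar s1 RL j = el j) * (ar s1 ADJ = ar s ADJ) * (ar s1 CUR = ar s CUR).
    by rewrite Fa // !Fr // !Fa //= c5.
  have takeS : count P (take j.+1 Rl) = count P (take j Rl) + P (el j).
    by rewrite (take_nth v) // -cats1 count_cat /= addn0.
  have cnt : count P (take j Rl) <= n.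
    by apply: leq_trans (count_size _ _) _; move: rn; rewrite size_take;
      case: ltnP; lia.
  have adjij := adj_index (el i) (el j).
  have eln := el_n j.
  exec_step (E1, s1j).
    by rewrite stat //; have := code_le2 S K (el j); lia.
  apply: wp_ifz => /=; rewrite ?E1 ?s1j (stat _ jr) => cj.
    rewrite /load_adj; do 3 exec_step (E1, s1j, c4).
    have jS := code_eq0 cj.
    apply: wp_ifz => /=; rewrite ?c4 => adj.
      exec_step (E1, s1j, inv).
      split=> //.
      by rewrite takeS /P jS /=; case: (e _ _) adj.
    exec_step (E1, s1j, inv); split=> //.
    by rewrite takeS /P jS /=; case: (e _ _) adj => //; rewrite addn0.
  exec_step (E1, s1j, inv); split=> //.
  by rewrite takeS /P (negPf (code_neq0 cj)) addn0.
move=> s2 k _ _; rewrite take_size codegE => -> leK; split=> //; lia.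
Qed.

Lemma el_inj i j : i < r -> j < r -> el i = el j -> i = j.
Proof. by move=> ir jr /eqP; rewrite nth_uniq // => /eqP. Qed.

Lemma mem_take_el i x : i < r -> (x \in take i.+1 Rl) = (x == el i) || (x \in
  take i Rl).
Proof. by move=> ir; rewrite (take_nth v) // mem_rcons inE. Qed.

Lemma codeg_le S x : codeg e S x <= n.
Proof. by apply: leq_trans (max_card _) _; rewrite card_ord. Qed.

Lemma wp_argmax s S K : ctx s -> status S K (ar s CUR) -> S \subset Rl ->
  wp w inp len argmax_cmd s (fun s' k =>
    [/\ forall x, x \in S -> codeg e S x <= rg s' vmx,
        rg s' vmx <= n,
        rg s' vmx = 0 \/ [/\ rg s' vmi < r, el (rg s' vmi) \in S
                           & codeg e S (el (rg s' vmi)) = rg s' vmx]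
      & k <= r * (r * 20 + 40) + 10]).
Proof.
move=> cs stat sS; have := n_le_w; have := size_Rl => rn nw.
have [c1 c2 c3 c4 c5] := cs.
rewrite /argmax_cmd; do 2 exec_step (c1, c2).
apply: (wp_for_const (B := r * 20 + 35) (hi := r) (Inv := fun i s1 =>
  [/\ forall x, x \in S -> x \in take i Rl -> codeg e S x <= rg s1 vmx,
        rg s1 vmx <= n &
        rg s1 vmx = 0 \/ [/\ rg s1 vmi < r, el (rg s1 vmi) \in S
                           & codeg e S (el (rg s1 vmi)) = rg s1 vmx]])) => //=.
- lia.
- by rewrite take0; split=> //; left.
- move=> i s1 ir F s1i [inv1 inv2 inv3].
  have cs1 : ctx s1 by apply: ctx_frame F _ _ _.
  have [d1 d2 d3 d4 d5] := cs1; have [_ Fa _] := F.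
  have stat1 : status S K (ar s1 CUR) by rewrite Fa.
  have E1 := (s1i, d1, d2, d3, stat1 _ ir).
  have le2 := code_le2 S K (el i).
  exec_step E1.
  apply: wp_ifz => /=; rewrite ?stat1 // => ci; last first.
    exec_step E1; split; first lia.
    split=> // x xS; rewrite mem_take_el // => /orP[/eqP xi|]; last exact: inv1.
    by move: (code_neq0 ci); rewrite -xi xS.
  have iS := code_eq0 ci.
  apply: wp_seq; apply: wp_conseq.
    exact: (@wp_codeg (setr s1 vci _) S K i cs1 stat1 sS s1i ir).
  move=> s2 k [Fr2 Fa2 _] [s2d leK] /=.
  have E2 : (rg s2 vone = 1) * (rg s2 vmx = rg s1 vmx) * (rg s2 vmi = rg s1
    vmi) *
      (rg s2 vi = i) by rewrite !Fr2 //= s1i d1.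
  have cn := codeg_le S (el i).
  exec_step (E2, s2d).
  apply: wp_ifz => /=; rewrite ?E2 ?s2d => cx.
    exec_step (E2, s2d); split; first lia.
    split=> // x xS; rewrite mem_take_el // => /orP[/eqP->|]; last exact: inv1.
    by apply/eqP.
  rewrite /CMov; do 2 exec_step (E2, s2d); split; first lia.
  rewrite !muln1; split=> //; last by right.
  move=> x xS; rewrite mem_take_el // => /orP[/eqP->//|xi].
  by apply: leq_trans (inv1 x xS xi) _; move: cx; clear; lia.
move=> s2 k F s2i [inv1 inv2 inv3] leK; split=> //; last lia.
by move=> x xS; apply: inv1; rewrite // take_size (subsetP sS).
Qed.

Lemma wp_pop s S K q : ctx s -> q <= r.+1 -> rg s vsp = q.+1 ->
  status S K (fun i => ar s STK (q * r + i)) ->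
  wp w inp len pop_cmd s (fun s' k =>
    [/\ rg s' vsp = q, status S K (ar s' CUR) & k <= r * 10 + 10]).
Proof.
move=> cs qr sq stat; have := n_le_w; have := size_Rl => rn nw.
have [c1 c2 c3 c4 c5] := cs.
have qrw : q * r <= w.
  have [r0|r0] := posnP r; first by rewrite r0 muln0.
  by have := stack_index qr r0; rewrite addn0.
rewrite /pop_cmd; exec_step (c1, c2, c3, sq); rewrite subn1 /=.
do 2 exec_step (c1, c2, c3, sq).
apply: (wp_for_const (B := 3) (hi := r) (Inv := fun i s1 =>
  forall j, j < i -> ar s1 CUR j = code S K (el j))) => //=.
- lia.
- move=> i s1 ir F s1i inv.
  have cs1 : ctx s1 by apply: ctx_frame F _ _ _.
  have [d1 d2 d3 d4 d5] := cs1; have [Fr Fa _] := F.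
  have sb1 : rg s1 vsb = q * r by rewrite Fr.
  have E1 := (s1i, sb1).
  have le2 := code_le2 S K (el i).
  have qi := stack_index qr ir.
  have sti : ar s1 STK (q * r + i) = code S K (el i) by rewrite Fa //= stat.
  do 3 exec_step (E1, sti); split=> // j; rewrite ltnS leq_eqVlt.
  case: eqVneq => [->|_ /= ji]; first by [].
  by rewrite inv.
move=> s2 k [Fr _ _] s2i inv leK; split; rewrite ?Fr //=; lia.
Qed.

(** The third clause protects the subproblems pending below height [q]. *)
Lemma wp_push s S K q : ctx s -> q <= r.+1 -> rg s vsp = q ->
  status S K (ar s CUR) ->
  wp w inp len push_cmd s (fun s' k =>
    [/\ rg s' vsp = q.+1, status S K (fun i => ar s' STK (q * r + i)),
        forall a, a < q * r -> ar s' STK a = ar s STK a & k <= r * 10 + 10]).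
Proof.
move=> cs qr sq stat; have := n_le_w; have := size_Rl => rn nw.
have [c1 c2 c3 c4 c5] := cs.
have qrw : q * r <= w.
  have [r0|r0] := posnP r; first by rewrite r0 muln0.
  by have := stack_index qr r0; rewrite addn0.
rewrite /push_cmd; do 2 exec_step (c1, c2, c3, sq).
apply: wp_seq.
apply: (wp_for_const (B := 3) (hi := r) (Inv := fun i s1 =>
  (forall j, j < i -> ar s1 STK (q * r + j) = code S K (el j)) /\
  (forall a, a < q * r -> ar s1 STK a = ar s STK a))) => //=.
- lia.
- move=> i s1 ir F s1i [inv1 inv2].
  have cs1 : ctx s1 by apply: ctx_frame F _ _ _.
  have [d1 d2 d3 d4 d5] := cs1; have [Fr Fa _] := F.
  have sb1 : rg s1 vsb = q * r by rewrite Fr.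
  have le2 := code_le2 S K (el i).
  have qi := stack_index qr ir.
  have sti : ar s1 CUR i = code S K (el i) by rewrite Fa //= stat.
  do 3 exec_step (s1i, sb1, sti); split=> //; split=> [j|a aq].
    rewrite ltnS leq_eqVlt; case: (eqVneq j i) => [->|ji /= jlt];
      first by rewrite eqxx.
    by rewrite ifF ?inv1 // eqn_add2l (negPf ji).
  by rewrite ifF ?inv2 //; lia.
move=> s2 k F s2i [inv1 inv2] leK.
have cs2 : ctx s2 by apply: ctx_frame F _ _ _.
have [d1 d2 d3 d4 d5] := cs2; have [Fr Fa _] := F.
have s2q : rg s2 vsp = q by rewrite Fr.
exec_step (d1, s2q); split=> //; lia.
Qed.

Lemma wp_push_include s (S K : {set 'I_n}) q m : ctx s -> q <= r.+1 -> rg s vsp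
  = q ->
  rg s vmi = m -> m < r -> el m \in S -> [disjoint S & K] ->
  status S K (ar s CUR) ->
  wp w inp len push_include_cmd s (fun s' k =>
    [/\ rg s' vsp = q.+1,
        status (S :&: nbrs e (el m)) (el m |: K) (fun i => ar s' STK (q * r +
          i)),
        forall a, a < q * r -> ar s' STK a = ar s STK a & k <= r * 20 + 20]).
Proof.
move=> cs qr sq sm mr mS dSK stat; have := n_le_w; have := size_Rl => rn nw.
have [c1 c2 c3 c4 c5] := cs.
have qrw : q * r <= w.
  have [r0|r0] := posnP r; first by rewrite r0 muln0.
  by have := stack_index qr r0; rewrite addn0.
have elm : el m < n by apply: ltn_ord.
have rowm := row_index (el m).
rewrite /push_include_cmd /load_row;
  do 4 exec_step (c1, c2, c3, sq, sm, c5 _ mr).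
apply: wp_seq.
set S' := S :&: _; set K' := _ |: K.
apply: (wp_for_const (B := 16) (hi := r) (Inv := fun i s1 =>
  (forall j, j < i -> ar s1 STK (q * r + j) = code S' K' (el j)) /\
  (forall a, a < q * r -> ar s1 STK a = ar s STK a))) => //=.
- lia.
- move=> i s1 ir F s1i [inv1 inv2].
  have cs1 : ctx s1 by apply: ctx_frame F _ _ _.
  have [d1 d2 d3 d4 d5] := cs1; have [Fr Fa _] := F.
  have E1 : (rg s1 vsb = q * r) * (rg s1 vub = el m * n) * (rg s1 vmi = m).
    by rewrite !Fr.
  have le2 := code_le2 S K (el i).
  have le2' := code_le2 S' K' (el i).
  have qi := stack_index qr ir.
  have sti : ar s1 CUR i = code S K (el i) by rewrite Fa //= stat.
  have eli : el i < n by apply: ltn_ord.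
  have adji := adj_index (el m) (el i).
  exec_step (s1i, E1, sti).
  apply: wp_seq; apply: (wp_conseq (Q := fun s2 k => k <= 12 /\ rg s2 vc = code
    S' K' (el i))).
    apply: wp_ifz => /=; rewrite ?sti => ci; last first.
      exec_step (E1, s1i); split=> //.
      have iS := code_neq0 ci.
      have im : el i != el m by apply: contraNneq iS => ->.
      by rewrite /code /S' /K' !inE (negPf iS) (negPf im).
    have iS := code_eq0 ci.
    have iK : (el i \in K) = false by apply: (disjointFr dSK).
    do 3 exec_step (E1, s1i).
    apply: wp_ifz => /= cx.
      have im : i = m by move: cx; clear; lia.
      exec_step (E1, s1i); split=> //.
      by rewrite im /code /S' /K' !inE eqxx e_irr andbF.
    have im : el i != el m by apply/eqP=> /(el_inj ir mr); move: cx; clear; lia.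
    rewrite /load_adj; do 3 exec_step (E1, s1i, d5 _ ir, d4).
    apply: wp_ifz => /=; rewrite ?d4 => adj.
      exec_step (E1, s1i); split=> //.
      by rewrite /code /S' /K' !inE iK (negPf im) iS; case: (e _ _) adj.
    exec_step (E1, s1i); split=> //.
    by rewrite /code /S' /K' !inE iS; case: (e _ _) adj.
  move=> s2 k [Fr2 Fa2 _] [leK s2c].
  have E2 : (rg s2 vsb = q * r) * (rg s2 vi = i) by rewrite !Fr2 //= E1 s1i.
  have E3 : ar s2 STK = ar s1 STK by rewrite Fa2.
  do 2 exec_step (E2, s2c); split; first lia.
  rewrite E3; split=> [j|a aq].
    rewrite ltnS leq_eqVlt; case: (eqVneq j i) => [->|ji /= jlt];
      first by rewrite eqxx.
    by rewrite ifF ?inv1 // eqn_add2l (negPf ji).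
  by rewrite ifF ?inv2 //; lia.
move=> s2 k F s2i [inv1 inv2] leK.
have cs2 : ctx s2 by apply: ctx_frame F _ _ _.
have [d1 d2 d3 d4 d5] := cs2; have [Fr Fa _] := F.
have s2q : rg s2 vsp = q by rewrite Fr.
exec_step (d1, s2q); split=> //; lia.
Qed.

End Node.

(** * The stack realises a derivation of [branching] *)

Section Stack.
Variables (w : nat) (inp : nat -> nat) (len : nat).
Variables (n : nat) (e : rel 'I_n) (v : 'I_n) (Rl al : seq 'I_n) (lo : nat).
Hypotheses (e_irr : irreflexive e) (Rl_uniq : uniq Rl).
Hypothesis (w_large : (n + 5) * (n + 5) + len <= w).
Hypothesis (inpE : forall i, i < size al -> inp (lo + i) = nth v al i).
Hypothesis (al_len : lo + size al <= len).

Local Notation r := (size Rl).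
Local Notation el := (nth v Rl).
Let rn : r <= n. Proof. exact: size_Rl. Qed.
Let nw : n + 5 <= w. Proof. exact: n_le_w w_large. Qed.
Let lw : len <= w. Proof. by apply: leq_trans w_large; apply: leq_addl. Qed.

Definition vctx (s : state) : Prop :=
  [/\ ctx e v Rl s, rg s vV = v, rg s vlo = lo & rg s vhi = lo + size al].

Lemma vctx_frame c s s' : frame c s s' ->
  all (fun x => x \notin modr c) [:: vone; vN; vR; vV; vlo; vhi] ->
  all (fun x => x \notin moda c) [:: ADJ; RL] -> vctx s -> vctx s'.
Proof.
move=> F /and5P[m1 m2 m3 m4 /and3P[m5 m6 _]] ma [cs sV slo shi].
have [Fr _ _] := F; split; rewrite ?Fr //.
by apply: ctx_frame F _ ma cs; rewrite /= m1 m2 m3.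
Qed.

Lemma setU_sub_seq (A B : {set 'I_n}) (l : seq 'I_n) :
  A \subset l -> B \subset l -> A :|: B \subset l.
Proof.
by move=> sA sB; apply/subsetP=> x /setUP[];
  [apply: (subsetP sA) | apply: (subsetP sB)].
Qed.

Lemma code_member (S K : {set 'I_n}) x : (code S K x - 1 == 0) = (x \in S :|:
  K).
Proof. by rewrite /code inE; case: ifP => // _; case: ifP. Qed.

Lemma count_le (P : pred 'I_n) i : count P (take i Rl) <= n.
Proof.
apply: leq_trans (count_size _ _) _; apply: leq_trans rn.
by rewrite size_take; case: ltnP => //; lia.
Qed.

Lemma count_takeS (P : pred 'I_n) i : i < r ->
  count P (take i.+1 Rl) = count P (take i Rl) + P (el i).
Proof. by move=> ir; rewrite (take_nth v) // -cats1 count_cat /= addn0. Qed.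

Lemma wp_count_row s (S K : {set 'I_n}) (u : 'I_n) : ctx e v Rl s ->
  status v Rl S K (ar s CUR) -> rg s vub = u * n ->
  wp w inp len count_row_cmd s (fun s' k =>
    rg s' vd = count (fun x => (x \in S :|: K) && ~~ e u x) Rl /\ k <= r * 20 +
      20).
Proof.
move=> cs stat su; have [c1 c2 c3 c4 c5] := cs.
rewrite /count_row_cmd; do 2 exec_step (c1, c2).
pose P : pred 'I_n := fun x => (x \in S :|: K) && ~~ e u x.
apply: (wp_for_const (B := 14) (hi := r) (Inv := fun i s1 =>
   rg s1 vd = count P (take i Rl))) => //=.
- lia.
- by rewrite take0.
- move=> i s1 ir F s1i inv.
  have cs1 : ctx e v Rl s1 by apply: ctx_frame F _ _ _.
  have [d1 d2 d3 d4 d5] := cs1; have [Fr Fa _] := F.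
  have s1u : rg s1 vub = u * n by rewrite Fr.
  have le2 := code_le2 S K (el i).
  have sti : ar s1 CUR i = code S K (el i) by rewrite Fa //= stat.
  have adji := adj_index w_large u (el i).
  have cnt := count_le P i.
  have eli : el i < n by apply: ltn_ord.
  have E1 := (s1i, d1, s1u, sti).
  do 2 exec_step E1.
  apply: wp_ifz => /= /eqP; rewrite ?d1 code_member => iM; last first.
    exec_step E1; split=> //; rewrite inv count_takeS //.
    by rewrite /P (negPf iM) addn0.
  rewrite /load_adj; do 3 exec_step (E1, d5 _ ir, d4).
  apply: wp_ifz => /=; rewrite ?d4 => adj.
    exec_step (E1, inv); split=> //; rewrite count_takeS //.
    by rewrite /P iM; case: (e _ _) adj.
  exec_step (E1, inv); split=> //; rewrite count_takeS //.
  by rewrite /P iM; case: (e _ _) adj => //; rewrite addn0.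
move=> s2 k _ _; rewrite take_size => -> leK; split=> //; lia.
Qed.

Definition extendable (M : {set 'I_n}) : bool :=
  has (fun u => [forall x in M, e u x]) al.

Lemma wp_check s (S K : {set 'I_n}) : vctx s -> status v Rl S K (ar s CUR) ->
  S :|: K \subset Rl ->
  wp w inp len check_cmd s (fun s' k =>
    rg s' vbad = extendable (S :|: K) /\ k <= size al * (r * 20 + 40) + 10).
Proof.
move=> [cs sV slo shi] stat sM; have [c1 c2 c3 c4 c5] := cs.
rewrite /check_cmd /CMov; do 2 exec_step (c1, slo).
pose P u := [forall x in S :|: K, e u x].
apply: (wp_for (B := fun=> r * 20 + 30) (lo := lo) (hi := lo + size al) (Inv :=
  fun p s1 =>
   rg s1 vbad = has P (take (p - lo) al))) => //=.
- by rewrite muln1.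
- by rewrite leq_addr.
- lia.
- by rewrite subnn take0.
- move=> p s1 lop phi F s1p inv.
  have cs1 : ctx e v Rl s1 by apply: ctx_frame F _ _ _.
  have [d1 d2 d3 d4 d5] := cs1; have [Fr Fa _] := F.
  have pal : p - lo < size al by lia.
  set u := nth v al (p - lo).
  have inpu : inp p = u by rewrite -inpE // subnKC.
  have un : u < n by apply: ltn_ord.
  have urow := row_index w_large u.
  do 2 exec_step (s1p, inpu, d2).
  have stat1 : status v Rl S K (ar s1 CUR) by rewrite Fa.
  apply: wp_seq; apply: wp_conseq.
    exact: (@wp_count_row (setr (setr s1 vu u) vub (u * n)) S K u cs1 stat1
      erefl).
  move=> s2 k [Fr2 _ _] [s2d leK] /=.
  have E2 : (rg s2 vbad = has P (take (p - lo) al)) by rewrite !Fr2.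
  have takeS : has P (take (p.+1 - lo) al) = has P (take (p - lo) al) || P u.
    by rewrite subSn // (take_nth v) // has_rcons orbC.
  have Pu : P u = (rg s2 vd == 0).
    rewrite s2d -leqn0 leqNgt -has_count;
      apply/forall_inP/hasPn => [uM x _|noM x xM].
      by rewrite negb_and negbK; case: (boolP (x \in _)) => //= /uM.
    by have := noM x; rewrite (subsetP sM) // xM negbK; apply.
  apply: wp_ifz => /= /eqP d0.
    exec_step d1; split; first lia.
    by rewrite takeS Pu d0 orbT.
  exec_step d1; split; first lia.
  by rewrite takeS Pu (negPf d0) orbF.
move=> s2 k _ _; rewrite addKn take_size => -> leK; split=> //.
by move: leK; rewrite sum_nat_const_nat addKn; nia.
Qed.

Definition members (M : {set 'I_n}) : seq 'I_n := [seq x <- Rl | x \in M].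

Lemma filter_takeS (P : pred 'I_n) i : i < r ->
  [seq x <- take i.+1 Rl | P x] =
  [seq x <- take i Rl | P x] ++ (if P (el i) then [:: el i] else [::]).
Proof.
by move=> ir; rewrite (take_nth v) // filter_rcons; case: ifP;
  rewrite ?cats1 ?cats0.
Qed.

Lemma wp_print s (S K : {set 'I_n}) : vctx s -> status v Rl S K (ar s CUR) ->
  wp w inp len print_cmd s (fun s' k =>
    ou s' = ou s ++ (size (members (S :|: K))).+1 :: val v ::
              [seq val x | x <- members (S :|: K)] /\ k <= r * 40 + 40).
Proof.
move=> vs stat; have [cs sV slo shi] := vs; have [c1 c2 c3 c4 c5] := cs.
rewrite /print_cmd; do 2 exec_step (c1, slo).
pose P : pred 'I_n := fun x => x \in S :|: K.
apply: wp_seq.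
apply: (wp_for_const (B := 8) (hi := r) (Inv := fun i s1 =>
   rg s1 vd = (count P (take i Rl)).+1)) => //=.
- lia.
- by rewrite take0.
- move=> i s1 ir F s1i inv.
  have cs1 : ctx e v Rl s1 by apply: ctx_frame F _ _ _.
  have [d1 d2 d3 d4 d5] := cs1; have [Fr Fa _] := F.
  have le2 := code_le2 S K (el i).
  have sti : ar s1 CUR i = code S K (el i) by rewrite Fa //= stat.
  have cnt := count_le P i.
  have E1 := (s1i, d1, sti, inv).
  do 2 exec_step E1.
  apply: wp_ifz => /= /eqP; rewrite ?d1 code_member => iM.
    exec_step E1; split=> //; rewrite count_takeS //.
    by rewrite /P iM /= !addn1.
  exec_step E1; split=> //; rewrite count_takeS //.
  by rewrite /P (negPf iM) addn0.
move=> s1 k F _; rewrite take_size => s1d leK.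
have vs1 : vctx s1 by apply: vctx_frame F _ _ _.
have [cs1 sV1 slo1 shi1] := vs1; have [d1 d2 d3 d4 d5] := cs1.
have ou1 : ou s1 = ou s by case: F => _ _ ->.
have stat1 : status v Rl S K (ar s1 CUR) by case: F => _ Fa _; rewrite Fa.
do 3 exec_step (s1d, sV1, ou1).
apply: (wp_for_const (B := 10) (hi := r) (Inv := fun i s2 =>
   ou s2 = ou s ++ (count P Rl).+1 :: val v ::
     [seq val x | x <- [seq x <- take i Rl | P x]])) => //=.
- lia.
- by rewrite take0 ou1 -!cats1 -!catA.
- move=> i s2 ir F2 s2i inv.
  have cs2 : ctx e v Rl s2 by apply: ctx_frame F2 _ _ _.
  have [f1 f2 f3 f4 f5] := cs2; have [Fr Fa _] := F2.
  have le2 := code_le2 S K (el i).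
  have sti : ar s2 CUR i = code S K (el i) by rewrite Fa //= stat1.
  have eli : el i < n by apply: ltn_ord.
  have E1 := (s2i, f1, sti, f5 _ ir).
  do 2 exec_step E1.
  apply: wp_ifz => /= /eqP; rewrite ?f1 code_member => iM.
    do 2 exec_step E1; split=> //; rewrite filter_takeS // inv /P iM map_cat /=.
    by rewrite -cats1 -catA.
  exec_step E1; split=> //; rewrite filter_takeS // inv /P (negPf iM) cats0 //.
move=> s2 k2 F2 _; rewrite take_size => -> leK2; rewrite /members size_filter.
split=> //; lia.
Qed.

Definition leaf_output (M : {set 'I_n}) : seq nat :=
  if extendable M then [::]
  else (size (members M)).+1 :: val v :: [seq val x | x <- members M].

Definition leaf_cost := size al * (r * 20 + 40) + r * 40 + 60.

Lemma wp_leaf s (S K : {set 'I_n}) : vctx s -> status v Rl S K (ar s CUR) ->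
  S :|: K \subset Rl ->
  wp w inp len leaf_cmd s (fun s' k =>
    ou s' = ou s ++ leaf_output (S :|: K) /\ k <= leaf_cost).
Proof.
move=> vs stat sM; rewrite /leaf_cmd; apply: wp_seq; apply: wp_conseq.
  exact: wp_check vs stat sM.
move=> s1 k F [s1b leK].
have vs1 : vctx s1 by apply: vctx_frame F _ _ vs.
have stat1 : status v Rl S K (ar s1 CUR) by case: F => _ Fa _; rewrite Fa.
have ou1 : ou s1 = ou s by case: F => _ _ ->.
rewrite /leaf_output /leaf_cost; apply: wp_ifz; rewrite s1b => b.
  apply: wp_conseq; first exact: wp_print vs1 stat1.
  move=> s2 k2 _ [-> leK2]; rewrite ou1; case: (extendable _) b => // _;
    split=> //; lia.
apply: wp_skip; rewrite ou1; case: (extendable _) b => // _; rewrite cats0;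
  split=> //; lia.
Qed.

Definition node_cost := r * (r * 20 + 40) + r * 40 + 80 + leaf_cost.

(** [q + #|S| <= r] bounds the height of the stack: the child left on top sits one level higher, but
    has one undecided vertex less. *)
Lemma wp_node s (S K : {set 'I_n}) q : vctx s -> S \subset Rl -> K \subset Rl ->
  [disjoint S & K] -> q + #|S| <= r -> rg s vsp = q.+1 ->
  status v Rl S K (fun i => ar s STK (q * r + i)) ->
  wp w inp len node_cmd s (fun s' k =>
    [/\ k <= node_cost, forall a, a < q * r -> ar s' STK a = ar s STK a
      & [/\ clique e S, rg s' vsp = q & ou s' = ou s ++ leaf_output (K :|: S)]
        \/
        exists u, [/\ ~~ clique e S, u \in S,
          forall x, x \in S -> codeg e S x <= codeg e S u
          & [/\ rg s' vsp = q.+2, ou s' = ou s,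
             status v Rl (S :&: nbrs e u) (u |: K) (fun i => ar s' STK (q * r +
               i))
           & status v Rl (S :\ u) K (fun i => ar s' STK (q.+1 * r + i))]]]).
Proof.
move=> vs sS sK dSK qr sq stat; rewrite /node_cmd.
have qr1 : q <= r.+1 by lia.
have [cs _ _ _] := vs.
apply: wp_seq; apply: wp_conseq;
  first exact: (wp_pop inp Rl_uniq w_large cs qr1 sq stat).
move=> s1 k1 F1 [s1q stat1 leK1].
have vs1 : vctx s1 by apply: vctx_frame F1 _ _ vs.
have [cs1 _ _ _] := vs1.
apply: wp_seq; apply: wp_conseq;
  first exact: (wp_argmax inp Rl_uniq w_large cs1 stat1 sS).
move=> s2 k2 F2 [mx1 mx2 mx3 leK2].
have vs2 : vctx s2 by apply: vctx_frame F2 _ _ vs1.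
have [cs2 _ _ _] := vs2; have [c1 c2 c3 c4 c5] := cs2.
have stat2 : status v Rl S K (ar s2 CUR) by case: F2 => _ Fa _; rewrite Fa.
have stk2 : ar s2 STK = ar s STK.
  by case: F2 => _ Fa2 _; case: F1 => _ Fa1 _; rewrite Fa2 // Fa1.
have ou2 : ou s2 = ou s.
  by case: F2 => _ _ Fo2; case: F1 => _ _ Fo1; rewrite Fo2 // Fo1.
have s2q : rg s2 vsp = q by case: F2 => Fr2 _ _; rewrite Fr2.
exec_step (c1, c2).
have clE : clique e S = (rg s2 vmx <= 1).
  rewrite clique_codeg //; apply/forall_inP/idP => [leS|le1 x xS].
    by case: mx3 => [->//|[_ uS <-]]; apply: leS.
  exact: leq_trans (mx1 x xS) le1.
apply: wp_ifz => /= mx.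
  apply: wp_conseq.
    apply: (@wp_leaf (setr s2 vx _) S K vs2 stat2); exact: setU_sub_seq.
  move=> s3 k3 F3 [ou3 leK3]; split.
  - rewrite /node_cost; lia.
  - by move=> a aq; case: F3 => _ Fa _; rewrite Fa //= stk2.
  left; split; first by rewrite clE; move: mx; clear; lia.
    by case: F3 => Fr _ _; rewrite Fr.
  by rewrite ou3 /= ou2 setUC.
have mx_gt1 : 1 < rg s2 vmx by move: mx; clear; lia.
case: mx3 => [mx0|[mi_r uS cu]]; first by move: mx_gt1; rewrite mx0.
set u := nth v Rl (rg s2 vmi) in uS cu.
apply: wp_seq; apply: wp_conseq.
  exact: (@wp_push_include w inp len n e v Rl e_irr Rl_uniq w_large
            (setr s2 vx _) S K q (rg s2 vmi) cs2 qr1 s2q erefl mi_r uS dSK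
              stat2).
move=> s3 k3 F3 [s3q inc3 low3 leK3].
have vs3 : vctx s3 by apply: vctx_frame F3 _ _ vs2.
have [cs3 _ _ _] := vs3; have [d1 d2 d3 d4 d5] := cs3.
have [Fr3 Fa3 Fo3] := F3.
have s3mi : rg s3 vmi = rg s2 vmi by rewrite Fr3.
do 2 exec_step s3mi.
have u_gt0 : 0 < #|S| by apply/card_gt0P; exists u.
have qr2 : q.+1 <= r.+1 by lia.
have stat4 : status v Rl (S :\ u) K (upd (ar s3 CUR) (rg s2 vmi) 2).
  move=> i ir /=; case: (eqVneq i (rg s2 vmi)) => [->|ni].
    by rewrite /code -/u !inE eqxx /= (disjointFr dSK uS).
  rewrite Fa3 //= stat2 // /code !inE.
  suff -> : el i != u by [].
  by apply: contraNneq ni => /(el_inj Rl_uniq ir mi_r)/eqP.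
apply: wp_conseq.
  exact: (@wp_push w inp len n e v Rl Rl_uniq w_large (seta (setr s3 vc 2) CUR
    (rg s2 vmi) 2)
     (S :\ u) K q.+1 cs3 qr2 s3q stat4).
move=> s4 k4 F4 [s4q exc4 low4 leK4]; split.
- rewrite /node_cost; lia.
- move=> a aq; rewrite low4 /=; last by rewrite mulSn; lia.
  by rewrite low3 //= stk2.
right; exists u; split=> //.
- by rewrite clE -ltnNge.
- by move=> x xS; rewrite cu; apply: mx1.
split=> //.
- by case: F4 => _ _ -> //=; rewrite Fo3.
move=> i ir; rewrite low4 /=; last by rewrite mulSn; lia.
exact: inc3.
Qed.

(** One round handles the subproblem itself, the next stretch its child without [u], which is on
    top, and the last stretch the child with [u]. A binary tree with [size L] leaves has one node
    less than twice that number; writing the missing node on the left makes the bound additive over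
    the children. *)
Lemma run_stack (S K : {set 'I_n}) s q : vctx s -> S \subset Rl -> K \subset Rl
  ->
  [disjoint S & K] -> q + #|S| <= r -> rg s vsp = q.+1 ->
  status v Rl S K (fun i => ar s STK (q * r + i)) ->
  exists L s' k, [/\ branching e S L, iters w inp len vsp node_cmd s s' k,
    rg s' vsp = q,
    (forall a, a < q * r -> ar s' STK a = ar s STK a) /\
    ou s' = ou s ++ flatten [seq leaf_output (K :|: C) | C <- L]
    & k + node_cost.+1 <= (size L).*2 * node_cost.+1].
Proof.
have [m] := ubnP #|S|; elim: m S K s q => // m IHm S K s q ltm vs sS sK dSK qr
  sq stat.
have [s1 [k1 [H1 [leK1 low1 next]]]] := wp_node vs sS sK dSK qr sq stat.
have F1 := ev_frame H1.
have vs1 : vctx s1 by apply: vctx_frame F1 _ _ vs.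
have it1 : iters w inp len vsp node_cmd s s1 k1.+1 by apply: iters1;
  rewrite ?sq.
case: next => [[S_cl s1q ou1]|[u [S_ncl uS u_max [s1q ou1 inc exc]]]].
  exists [:: S], s1, k1.+1; split=> //=; first exact: BranchLeaf.
    by rewrite cats0.
  by lia.
have cardU : #|S :\ u|.+1 = #|S| by rewrite (cardsD1 u S) uS.
have sSu : S :&: nbrs e u \subset S :\ u.
  by apply/subsetP=> x; rewrite !inE => /andP[-> ux]; rewrite andbT;
     apply: contraTneq ux => ->; rewrite e_irr.
have leU := subset_leq_card sSu.
have [||||L2 [s2 [k2 [b2 it2 s2q [low2 ou2] leK2]]]] :=
    IHm (S :\ u) K s1 q.+1 _ vs1 _ sK _ _ s1q exc.
- lia.
- by apply: (subset_trans _ sS); apply: subD1set.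
- by apply: disjointWl dSK; apply: subD1set.
- lia.
have vs2 : vctx s2 by apply: vctx_frame (iters_frame it2) _ _ vs1.
have inc2 : status v Rl (S :&: nbrs e u) (u |: K) (fun i => ar s2 STK (q * r +
  i)).
  by move=> i ir; rewrite low2 ?inc // mulSn; lia.
have [|||||L1 [s3 [k3 [b1 it3 s3q [low3 ou3] leK3]]]] :=
    IHm (S :&: nbrs e u) (u |: K) s2 q _ vs2 _ _ _ _ s2q inc2.
- lia.
- by apply: (subset_trans _ sS); apply: subsetIl.
- by apply: setU_sub_seq => //; apply/subsetP=> x /set1P->; apply: (subsetP sS).
- rewrite -setI_eq0; apply/eqP/setP=> x; rewrite !inE.
  apply/negP=> /andP[/andP[xS ux] /orP[/eqP xu|xK]].
    by rewrite xu e_irr in ux.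
  by rewrite (disjointFr dSK xS) in xK.
- lia.
exists (L2 ++ [seq u |: C | C <- L1]), s3, (k1.+1 + (k2 + k3)); split=> //.
- exact: BranchNode b1 b2.
- exact: iters_trans it1 (iters_trans it2 it3).
- split=> [a aq|].
    rewrite low3 // low2 ?low1 //.
    by apply: leq_trans aq _; rewrite leq_mul2r leqnSn orbT.
  rewrite ou3 ou2 ou1 map_cat flatten_cat -!catA -map_comp;
    congr (_ ++ (_ ++ flatten _)).
  by apply: eq_map => C /=; rewrite setUCA setUA.
rewrite size_cat size_map doubleD mulnDl.
have arith a b c x y z : x <= c -> y + c.+1 <= a -> z + c.+1 <= b ->
    x.+1 + (y + z) + c.+1 <= a + b by lia.
exact: arith leK1 leK2 leK3.
Qed.

End Stack.

Section Enum.
Variables (w : nat) (inp : nat -> nat) (len : nat).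
Variables (n : nat) (e : rel 'I_n) (v : 'I_n) (Rl al : seq 'I_n) (lo : nat).
Hypotheses (e_irr : irreflexive e) (Rl_uniq : uniq Rl).
Hypothesis (w_large : (n + 5) * (n + 5) + len <= w).
Hypothesis (inpE : forall i, i < size al -> inp (lo + i) = nth v al i).
Hypothesis (al_len : lo + size al <= len).

Lemma wp_enum s : vctx e v Rl al lo s ->
  wp w inp len enum_cmd s (fun s' k => exists L,
    [/\ branching e [set x in Rl] L,
        ou s' = ou s ++ flatten [seq leaf_output e v Rl al C | C <- L]
      & k <= (size L).*2 * (node_cost Rl al).+1 + size Rl * 5 + 10]).
Proof.
move=> vs; have nw := n_le_w w_large; have rn := size_Rl Rl_uniq.
have [[c1 c2 c3 c4 c5] _ _ _] := vs.
rewrite /enum_cmd; do 2 exec_step c1.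
apply: wp_seq.
apply: (wp_for_const (B := 1) (hi := size Rl) (Inv := fun i s1 =>
   forall j, j < i -> ar s1 STK j = 0)) => //=.
- lia.
- move=> i s1 ir [Fr Fa _] s1i inv.
  have s1x : rg s1 vx = 0 by rewrite Fr.
  exec_step (s1i, s1x); split=> // j; rewrite ltnS leq_eqVlt.
  by case: eqVneq => //= _ /inv.
move=> s1 k F _ inv leK.
have vs1 : vctx e v Rl al lo s1 by apply: vctx_frame F _ _ vs.
have ou1 : ou s1 = ou s by case: F => _ _ ->.
exec_step c1.
have stat : status v Rl [set x in Rl] set0 (fun i => ar (setr s1 vsp 1) STK (0
  * size Rl + i)).
  by move=> i ir; rewrite mul0n add0n /= inv // /code inE mem_nth.
have sR : [set x in Rl] \subset Rl by apply/subsetP=> x; rewrite inE.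
have s0R : (set0 : {set 'I_n}) \subset Rl by apply/subsetP=> x; rewrite inE.
have cR : 0 + #|[set x in Rl]| <= size Rl.
  by rewrite add0n cardsE (card_uniqP Rl_uniq).
have d0 : [disjoint [set x in Rl] & set0] by rewrite -setI_eq0 setI0.
have [L [s2 [k2 [bL it2 s2q [_ ou2] leK2]]]] :=
  @run_stack w inp len n e v Rl al lo e_irr Rl_uniq w_large inpE al_len
   [set x in Rl] set0 (setr s1 vsp 1) 0 vs1 sR s0R d0 cR erefl stat.
apply: (wp_while it2) => //; exists L; split=> //; last lia.
rewrite ou2 /= ou1; congr (_ ++ flatten _); apply: eq_map => C;
  by rewrite set0U.
Qed.

End Enum.

(** * Removal of the vertices of small degree *)

Section Main.
Variables (w : nat) (inp : nat -> nat) (len : nat).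
Variables (n D Lb : nat) (e : rel 'I_n) (adj : 'I_n -> seq 'I_n) (lo : 'I_n ->
  nat).
Hypotheses (e_sym : symmetric e) (e_irr : irreflexive e).
Hypothesis (w_large : (n + 5) * (n + 5) + len + D <= w).
Hypothesis (adjP : adjacency_lists e adj).
Hypothesis (inp_lo : forall x : 'I_n, inp (x + 2) = lo x).
Hypothesis (inp_hi : forall x : 'I_n, inp (x + 3) = lo x + size (adj x)).
Hypothesis (inpE : forall (x : 'I_n) i d, i < size (adj x) ->
  inp (lo x + i) = nth d (adj x) i).
Hypothesis (adj_len : forall x : 'I_n, lo x + size (adj x) <= len).
Hypothesis (n_len : n + 3 <= len).
Hypothesis (degenerate : forall S : {set 'I_n}, S != set0 ->
  exists2 x, x \in S & #|S :&: nbrs e x| <= D).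
Hypothesis (Lb_gt0 : 0 < Lb).
Hypothesis (branching_le : forall (S : {set 'I_n}) L, #|S| <= D ->
  branching e S L -> size L <= Lb).

Let w_large' : (n + 5) * (n + 5) + len <= w.
Proof. by apply: leq_trans w_large; apply: leq_addr. Qed.
Let nw : n + 5 <= w. Proof. exact: n_le_w w_large'. Qed.
Let lw : len <= w. Proof. by apply: leq_trans w_large'; apply: leq_addl. Qed.
Let Dw : D <= w. Proof. by apply: leq_trans w_large; apply: leq_addl. Qed.

Lemma adj_uniq x : uniq (adj x). Proof. by case: (adjP x). Qed.

Lemma mem_adj x y : (y \in adj x) = e x y. Proof. by case: (adjP x) => _ ->.
  Qed.

Lemma size_adj (X : {set 'I_n}) x :
  size [seq u <- adj x | u \notin X] = #|nbrs e x :\: X|.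
Proof.
rewrite -(card_uniqP (filter_uniq _ (adj_uniq x))); apply: eq_card => y.
by rewrite mem_filter mem_adj !inE.
Qed.

Lemma size_adj0 x : size (adj x) = #|nbrs e x :\: set0|.
Proof.
by rewrite -size_adj (eq_filter (a2 := predT)) ?filter_predT // => y;
  rewrite inE.
Qed.

Definition removed (Qs : seq 'I_n) h : {set 'I_n} := [set x in take h Qs].

(** The first [h] entries of the queue are the removed vertices. By the last clause the others in it
    are exactly the vertices that may be removed next. *)
Definition ginv (s : state) (h : nat) (Qs : seq 'I_n) : Prop :=
  [/\ [/\ rg s vone = 1, rg s vN = n, rg s vD = D, rg s vhead = h & rg s vtail
    = size Qs],
      [/\ forall x y : 'I_n, ar s ADJ (x * n + y) = e x y,
          forall i d, i < size Qs -> ar s QU i = nth d Qs i,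
          forall x : 'I_n, ar s REM x = (x \in removed Qs h)
        & forall x : 'I_n, x \notin removed Qs h ->
            ar s DEG x = #|nbrs e x :\: removed Qs h|],
      uniq Qs, h <= size Qs
    & forall x, x \notin removed Qs h ->
        (x \in Qs) = (#|nbrs e x :\: removed Qs h| <= D)].

Lemma wp_bounds s (x : 'I_n) : rg s vone = 1 -> rg s vV = x ->
  wp w inp len bounds_cmd s (fun s' k =>
    [/\ rg s' vlo = lo x, rg s' vhi = lo x + size (adj x) & k = 5]).
Proof.
move=> s1 sV; have xn := ltn_ord x; have := adj_len x => xl.
rewrite /bounds_cmd; do 4 exec_step (s1, sV, inp_lo x).
by exec_step (s1, sV, inp_lo x); rewrite -addnA inp_hi; try lia; split.
Qed.

(** [X] does not yet contain the vertex being removed: its remaining neighbours of degree [D.+1] are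
    those about to drop to [D]. *)
Definition enqueued (X : {set 'I_n}) (Qs U : seq 'I_n) : seq 'I_n :=
  Qs ++ [seq u <- U | #|nbrs e u :\: X| == D.+1].

Lemma enqueued_uniq (X : {set 'I_n}) Qs U : uniq Qs -> uniq U ->
  (forall x, x \notin X -> (x \in Qs) = (#|nbrs e x :\: X| <= D)) ->
  (forall x, x \in U -> x \notin X) -> uniq (enqueued X Qs U).
Proof.
move=> Qu Uu QP UX; rewrite cat_uniq Qu filter_uniq // andbT.
apply/hasPn=> x; rewrite mem_filter => /andP[/eqP xD /UX xX].
by rewrite /= QP // xD ltnn.
Qed.

Lemma uniq_size_le (U : seq 'I_n) : uniq U -> size U <= n.
Proof. exact: size_Rl. Qed.

Lemma deg_le (X : {set 'I_n}) x : #|nbrs e x :\: X| <= n.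
Proof. by apply: leq_trans (max_card _) _; rewrite card_ord. Qed.

Lemma wp_scan s (X : {set 'I_n}) (Qs : seq 'I_n) (v : 'I_n) :
  [/\ rg s vone = 1, rg s vD = D & rg s vtail = size Qs] ->
  [/\ rg s vV = v, rg s vlo = lo v & rg s vhi = lo v + size (adj v)] ->
  (forall i d, i < size Qs -> ar s QU i = nth d Qs i) ->
  (forall x : 'I_n, ar s REM x = (x \in X)) ->
  (forall x : 'I_n, x \notin X -> ar s DEG x = #|nbrs e x :\: X|) ->
  uniq Qs -> v \notin X ->
  (forall x, x \notin X -> (x \in Qs) = (#|nbrs e x :\: X| <= D)) ->
  let Rl := [seq u <- adj v | u \notin X] in
  wp w inp len scan_cmd s (fun s' k =>
    [/\ [/\ rg s' vR = size Rl & forall i d, i < size Rl -> ar s' RL i = nth d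
      Rl i],
        [/\ rg s' vtail = size (enqueued X Qs Rl) &
          forall i d, i < size (enqueued X Qs Rl) ->
            ar s' QU i = nth d (enqueued X Qs Rl) i],
        forall x : 'I_n, ar s' REM x = (x \in v |: X),
        forall x : 'I_n, x \notin X ->
          ar s' DEG x = #|nbrs e x :\: X| - (x \in Rl)
      & k <= size (adj v) * 40 + 20]).
Proof.
move=> [c1 cD ct] [sV slo shi] QUs REMs DEGs Qu vX QP Rl.
have vn := ltn_ord v; have := adj_len v => vl.
rewrite /scan_cmd /CMov; do 3 exec_step (c1, sV, slo); rewrite muln1.
pose U i := [seq u <- take i (adj v) | u \notin X].
apply: (wp_for (B := fun=> 30) (lo := lo v) (hi := lo v + size (adj v))
  (Inv := fun p s1 => let Ui := U (p - lo v) in let Qi := enqueued X Qs Ui in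
   [/\ rg s1 vR = size Ui, forall i d, i < size Ui -> ar s1 RL i = nth d Ui i,
       rg s1 vtail = size Qi, forall i d, i < size Qi -> ar s1 QU i = nth d Qi i
     & forall x : 'I_n, x \notin X ->
          ar s1 DEG x = #|nbrs e x :\: X| - (x \in Ui)])) => //=.
- by rewrite leq_addr.
- lia.
- rewrite subnn /U take0 /= /enqueued /= cats0; split=> // x xX.
  by rewrite DEGs // subn0.
- move=> p s1 lop phi F s1p [invR invRL invt invQ invD].
  have [Fr Fa _] := F; set i := p - lo v in invR invRL invt invQ invD *.
  have ial : i < size (adj v) by rewrite /i; lia.
  set u := nth v (adj v) i.
  have inpu : inp p = u by rewrite /u -inpE // subnKC.
  have un : u < n by apply: ltn_ord.
  have vu : e v u by rewrite -mem_adj mem_nth.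
  have uv : u != v by apply: contraTneq vu => ->; rewrite e_irr.
  have d1 : rg s1 vone = 1 by rewrite Fr.
  have dD : rg s1 vD = D by rewrite Fr.
  have REM1 : ar s1 REM u = (u \in X).
    by rewrite Fa //= REMs; case: eqVneq => // /val_inj uv';
      rewrite uv' eqxx in uv.
  have Ui : U (p.+1 - lo v) = if u \in X then U i else rcons (U i) u.
    by rewrite subSn // -/i /U (take_nth v) // filter_rcons -/u;
      case: (u \in X).
  have bX : (u \in X) <= w by case: (u \in X); lia.
  do 2 exec_step (s1p, inpu, REM1).
  rewrite Ui; apply: wp_ifz => /=; case uX: (u \in X) => // _; last first.
    by exec_step d1; split.
  have uU : u \notin U i.
    rewrite mem_filter negb_and; apply/orP; right.
    apply/negP=> /(nthP v)[j]; rewrite size_take ial => ji; rewrite nth_take //.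
    by move/eqP; rewrite nth_uniq ?adj_uniq ?(ltn_trans ji) // => /eqP E;
      rewrite E ltnn in ji.
  have Uu j : uniq (U j) by apply/filter_uniq/take_uniq/adj_uniq.
  have UX j x : x \in U j -> x \notin X by rewrite mem_filter => /andP[].
  have sU := uniq_size_le (Uu i).
  have sQ := uniq_size_le (enqueued_uniq Qu (Uu i) QP (@UX i)).
  have DEGu : ar s1 DEG u = #|nbrs e u :\: X| by rewrite invD ?uX // (negPf uU)
    subn0.
  have degu : ar s1 DEG u <= n by rewrite DEGu deg_le.
  have deg_gt0 : 0 < ar s1 DEG u.
    by rewrite DEGu; apply/card_gt0P; exists v; rewrite !inE vX e_sym.
  rewrite DEGu in degu deg_gt0.
  have [dg dgE] : exists dg, dg = #|nbrs e u :\: X| by exists #|nbrs e u :\: X|.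
  rewrite -dgE in DEGu degu deg_gt0.
  do 8 exec_step (d1, dD, invR, DEGu).
  have RL' : forall j d, j < (size (U i)).+1 ->
      (if j == size (U i) then val u else ar s1 RL j) = nth d (rcons (U i) u) j.
    move=> j d; rewrite ltnS leq_eqVlt nth_rcons.
    by case: ltngtP => //= jU _; apply: invRL.
  have DEG' : forall x : 'I_n, x \notin X ->
      (if val x == val u then dg - 1 else ar s1 DEG x) =
      #|nbrs e x :\: X| - (x \in rcons (U i) u).
    move=> x xX; rewrite mem_rcons inE; case: (eqVneq x u) => [->|xu];
      first by rewrite eqxx dgE.
    by rewrite ifF ?invD //; apply/negbTE; apply: contraNneq xu => /val_inj->.
  have Qrcons : enqueued X Qs (rcons (U i) u) = if dg == D.+1
      then rcons (enqueued X Qs (U i)) u else enqueued X Qs (U i).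
    by rewrite dgE /enqueued filter_rcons; case: ifP => // _; rewrite rcons_cat.
  apply: wp_ifz => /= tst; rewrite /enqueue_cmd.
    have degD : dg == D.+1 by move: tst deg_gt0; clear; lia.
    do 2 exec_step (d1, invt); split; first lia.
    rewrite Qrcons degD; split; rewrite ?size_rcons ?addn1 //.
    move=> j d; rewrite ltnS leq_eqVlt nth_rcons.
    by case: ltngtP => //= jU _; apply: invQ.
  have degD : (dg == D.+1) = false by move: tst deg_gt0; clear; lia.
  exec_step d1; split; first lia.
  by rewrite Qrcons degD; split; rewrite ?size_rcons ?addn1.
move=> s2 k F s2p; rewrite addKn /U take_size -/Rl => -[i1 i2 i3 i4 i5] leK.
split=> //.
  move=> x; case: F => _ Fa _; rewrite Fa //= !inE REMs.
  by rewrite -val_eqE /=; case: (_ == _).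
move: leK; rewrite sum_nat_const_nat addKn; lia.
Qed.

Lemma removedS (Qs : seq 'I_n) h (d : 'I_n) : h < size Qs ->
  removed Qs h.+1 = nth d Qs h |: removed Qs h.
Proof. by move=> hQ; apply/setP=> x;
  rewrite !inE (take_nth d) // mem_rcons inE. Qed.

Definition leaf_words (v : 'I_n) (Rl al : seq 'I_n) (L : seq {set 'I_n}) :
    seq (seq 'I_n) :=
  [seq v :: members Rl C | C : {set 'I_n} <- L & ~~ extendable e al C].

Lemma leaf_output_words v Rl al (L : seq {set 'I_n}) :
  flatten [seq leaf_output e v Rl al C | C <- L] =
  encode_output (leaf_words v Rl al L).
Proof.
rewrite /encode_output /leaf_words; elim: L => //= C L IHL.
by rewrite IHL /leaf_output; case: (extendable e al C).
Qed.

(** At most [Lb] leaves, hence fewer than twice as many rounds; each needs order [D ^ 2] steps for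
    the codegrees and order [D] steps per neighbour of [v] for the maximality test. *)
Definition vertex_cost (v : 'I_n) : nat :=
  Lb * (1000 * D.+1 ^ 2) * (size (adj v)).+1.

Lemma wp_vertex s h Qs (v : 'I_n) : ginv s h Qs -> h < size Qs -> nth v Qs h =
  v ->
  let X := removed Qs h in
  let Rl := [seq u <- adj v | u \notin X] in
  wp w inp len vertex_cmd s (fun s' k => exists L,
    [/\ branching e [set x in Rl] L, v \notin X,
        ou s' = ou s ++ encode_output (leaf_words v Rl (adj v) L) &
        [/\ ginv s' h.+1 (enqueued X Qs Rl),
            rg s' vmore = size (enqueued X Qs Rl) - h.+1,
            removed (enqueued X Qs Rl) h.+1 = v |: X & k < vertex_cost v]]).
Proof.
move=> [[c1 cN cD ch ct] [ADJs QUs REMs DEGs] Qu hs QP] hQ hv X Rl.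
have vX : v \notin X.
  rewrite inE -hv; apply/negP=> /(nthP v)[j]; rewrite size_take hQ => jh.
  rewrite nth_take // => /eqP; rewrite nth_uniq ?(ltn_trans jh) //.
  by move/eqP=> E; rewrite E ltnn in jh.
have vn := ltn_ord v; have sQs := uniq_size_le Qu.
have QUv : ar s QU h = v by rewrite (QUs _ v) // hv.
rewrite /vertex_cmd; do 2 exec_step (c1, ch, QUv).
set s1 := setr _ vhead _.
apply: wp_seq; apply: wp_conseq; first exact: (@wp_bounds s1 v).
move=> s2 k2 F2 [s2lo s2hi ->].
have [Fr2 Fa2 Fo2] := F2.
have Rl_uniq : uniq Rl by apply/filter_uniq/adj_uniq.
apply: wp_seq; apply: wp_conseq.
  apply: (@wp_scan s2 X Qs v) => //.
  - by rewrite !Fr2.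
  - by rewrite Fr2.
  - by rewrite Fa2.
  - by rewrite Fa2.
  - by rewrite Fa2.
move=> s3 k3 F3; rewrite -/Rl.
set Q' := enqueued X Qs Rl; move=> [[s3R s3RL] [s3t s3QU] s3REM s3DEG leK3].
have [Fr3 Fa3 Fo3] := F3.
have vs3 : vctx e v Rl (adj v) (lo v) s3.
  split; rewrite ?Fr3 //; last by rewrite Fr2.
  split=> // [||x y|i ir]; [by rewrite Fr3 // Fr2 | by rewrite Fr3 // Fr2 | |
    exact: s3RL].
  by rewrite Fa3 // Fa2 //= ADJs.
have ou3 : ou s3 = ou s by rewrite Fo3 // Fo2.
have al_len := adj_len v.
apply: wp_seq; apply: wp_conseq.
  exact: (wp_enum e_irr Rl_uniq w_large' (fun i => @inpE v i v) al_len vs3).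
move=> s4 k4 F4 [L [bL ou4 leK4]].
have [Fr4 Fa4 Fo4] := F4.
have sRl : size Rl = #|nbrs e v :\: X| by apply: size_adj.
have sRlD : size Rl <= D by rewrite sRl -QP // -hv mem_nth.
have Q'u : uniq Q'.
  by apply: enqueued_uniq => // x; rewrite mem_filter => /andP[].
have sQ' : size Qs <= size Q' by rewrite size_cat leq_addr.
have sQ'n := uniq_size_le Q'u.
have Q'v : nth v Q' h = v by rewrite nth_cat hQ.
have s4h : rg s4 vhead = h.+1 by rewrite Fr4 // Fr3 // Fr2 //= addn1.
have s4t : rg s4 vtail = size Q' by rewrite Fr4 // s3t.
exec_step (s4h, s4t); exists L.
have X' : removed Q' h.+1 = v |: X.
  rewrite (removedS v) ?(leq_trans hQ) // Q'v; congr (_ |: _).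
  by apply/setP=> x; rewrite !inE take_cat hQ.
have L_le : size L <= Lb.
  by apply: branching_le bL; rewrite cardsE (card_uniqP Rl_uniq).
split=> //.
  by rewrite ou4 ou3 leaf_output_words.
split=> //; last first.
  have L0 : 0 < size L by apply: branching_size_gt0 bL.
  move: leK4; rewrite /node_cost /leaf_cost /vertex_cost -doubleMl -muln2 =>
    leK4.
  set a := size (adj v) in leK3 leK4 *; set r := size Rl in sRlD leK4 *.
  set nc := (_ + _).+1 in leK4.
  have nc_le : nc <= 300 * (D.+1 ^ 2 * a.+1).
    rewrite /nc; have : r * r <= D * D by apply: leq_mul.
    have : r * a <= D * a by rewrite leq_mul2r sRlD orbT.
    by rewrite -mulnn; move: sRlD; clear; nia.
  have h1 : size L * nc <= Lb * (300 * (D.+1 ^ 2 * a.+1)) by apply: leq_mul.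
  have h2 : 1 * (D.+1 ^ 2 * a.+1) <= Lb * (D.+1 ^ 2 * a.+1).
    by rewrite leq_mul2r Lb_gt0 orbT.
  have h3 : a + D + 1 <= D.+1 ^ 2 * a.+1 by rewrite -mulnn; clear; nia.
  have -> : Lb * (1000 * D.+1 ^ 2) * a.+1 = 1000 * (Lb * (D.+1 ^ 2 * a.+1)).
    by clear; move: (D.+1 ^ 2) => x; nia.
  rewrite mulnCA in h1.
  have arith a' d' r' y y' z x3 x4 : x3 <= a' * 40 + 20 -> x4 <= z * 2 + r' * 5
    + 10 ->
      r' <= d' -> z <= 300 * y' -> 1 * y <= y' -> a' + d' + 1 <= y ->
      1 + (1 + (5 + (x3 + (x4 + 1)))) < 1000 * y' by lia.
  exact: arith leK3 leK4 sRlD h1 h2 h3.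
have nbrsX' x : x \notin v |: X ->
    #|nbrs e x :\: (v |: X)| = #|nbrs e x :\: X| - (x \in Rl).
  rewrite in_setU1 negb_or => /andP[xv xX].
  rewrite mem_filter mem_adj xX /= (cardsD1 v (nbrs e x :\: X)) in_setD vX inE
    e_sym addKn.
  by apply: eq_card => y; rewrite !(in_setD, in_setU1, in_set1) negb_or -andbA.
split=> //.
- by split=> //=; rewrite ?Fr4 ?Fr3 ?Fr2.
- split=> [x y|i d|x|x].
  + by rewrite /= Fa4 // Fa3 // Fa2 //= ADJs.
  + by rewrite /= Fa4 //; apply: s3QU.
  + by rewrite /= Fa4 // X' s3REM.
  + by rewrite X' /= Fa4 // => xX'; rewrite nbrsX' // s3DEG //; move: xX';
      rewrite in_setU1 negb_or => /andP[].
- exact: leq_trans hQ sQ'.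
move=> x; rewrite X' => xX'; rewrite nbrsX' //.
have xX : x \notin X by move: xX'; rewrite in_setU1 negb_or => /andP[].
rewrite mem_cat mem_filter QP //.
have [xRl|xRl] := boolP (x \in Rl); last by rewrite andbF orbF subn0.
rewrite andbT; have : 0 < #|nbrs e x :\: X|.
  apply/card_gt0P; exists v; rewrite in_setD vX inE e_sym /=.
  by move: xRl; rewrite mem_filter mem_adj => /andP[].
by move: #|nbrs e x :\: X| => d; clear; lia.
Qed.

Lemma members_set (v : 'I_n) (Rl : seq 'I_n) (C : {set 'I_n}) : C \subset [set
  x in Rl] ->
  [set x in v :: members Rl C] = v |: C.
Proof.
move=> /subsetP sC; apply/setP=> x; rewrite !inE mem_filter.
by case: (x == v) => //=; case xC: (x \in C) => //=; have := sC x xC;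
  rewrite inE.
Qed.

(** A maximal clique that avoids the vertices removed so far either contains the next vertex [v],
    and is then written now, or avoids [v] as well and is left to the induction hypothesis. *)
Lemma run_vertices (x0 : 'I_n) s h Qs : ginv s h Qs -> rg s vmore = size Qs - h
  ->
  exists s' k Ls,
    [/\ iters w inp len vmore vertex_cmd s s' k, rg s' vmore = 0,
        ou s' = ou s ++ encode_output Ls,
        [/\ all uniq Ls, uniq [seq [set x in l] | l : seq 'I_n <- Ls]
          & forall M, (M \in [seq [set x in l] | l : seq 'I_n <- Ls]) =
              (M \in maximal_cliques e) && [disjoint M & removed Qs h]]
      & k <= \sum_(x in ~: removed Qs h) vertex_cost x].
Proof.
have [m] := ubnP (n - h); elim: m s h Qs => // m IHm s h Qs ltm gi more.
have [_ _ Qu leh QP] := gi.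
case: (ltngtP h (size Qs)) leh => // [hQ _|eq_h _]; last first.
  (* The queue is exhausted only when every vertex is removed: otherwise degeneracy provides a
     remaining vertex of small degree, which [ginv] puts into the queue. *)
  have X1 : ~: removed Qs h = set0.
    apply/eqP/negPn/negP=> /degenerate[x xX degx]; rewrite inE in xX.
    have : x \in Qs.
      rewrite QP //; apply: leq_trans degx; apply/subset_leq_card/subsetP=> y.
      by rewrite in_setD in_setI in_setC => /andP[-> ->].
    by move: xX; rewrite inE eq_h take_size => /negPf->.
  exists s, 0, [::]; split=> //; first exact: Iters0.
  - by rewrite more eq_h subnn.
  - by rewrite cats0.
  split=> // M; rewrite in_nil; apply/esym/negP=> /andP[M_max].
  have -> : removed Qs h = setT by rewrite -[LHS]setCK X1 setC0.
  rewrite -setI_eq0 setIT => /eqP M0.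
  by move: M_max; rewrite M0; apply/negP/set0_not_maximal.
pose v := nth x0 Qs h; set X := removed Qs h.
have [s1 [k1 [H1 [L [bL vX ou1 [gi1 more1 X1 leK1]]]]]] :=
  wp_vertex gi hQ (set_nth_default x0 v hQ : nth v Qs h = v).
have [|s2 [k2 [Ls [it2 more2 ou2 [Ls1 Ls2 Ls3] leK2]]]] := IHm _ _ _ _ gi1
  more1.
  by have := uniq_size_le Qu; lia.
set Rl := [seq u <- adj v | u \notin X] in bL ou1 X1 Ls3 leK2 gi1 *.
have sets_v : [seq [set x in l] | l : seq 'I_n <- leaf_words v Rl (adj v) L] =
    [seq v |: C | C : {set 'I_n} <- L & ~~ extendable e (adj v) C].
  rewrite -map_comp; apply/eq_in_map => C; rewrite mem_filter => /andP[_ CL] /=.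
  by apply: members_set; apply: branching_sub bL CL.
have [] := maximal_cliques_at e_sym e_irr (mem_adj v : adj v =i e v) (erefl Rl)
  vX bL.
rewrite -/(extendable e (adj v)) -sets_v => uniq_v mem_v.
exists s2, (k1.+1 + k2), (leaf_words v Rl (adj v) L ++ Ls); split=> //.
- apply: iters_trans it2; apply: iters1 H1.
  by rewrite more; move: hQ; clear; lia.
- by rewrite ou2 ou1 -catA /encode_output map_cat flatten_cat.
- rewrite map_cat all_cat cat_uniq Ls1 Ls2 uniq_v !andbT /=; split.
  + apply/allP=> l /mapP[C _ ->] /=;
    rewrite filter_uniq ?filter_uniq ?adj_uniq //.
    by rewrite mem_filter mem_filter mem_adj e_irr !andbF.
  + apply/hasPn=> M; rewrite Ls3 X1 => /andP[_ dM]; rewrite /= mem_v !negb_and.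
    by rewrite (disjointFl dM (setU11 _ _)) !orbT.
  move=> M; rewrite mem_cat mem_v Ls3 X1.
  case: (M \in maximal_cliques e) => //=.
  rewrite -[in X in _ || X]setI_eq0 setIUr setU_eq0 !setI_eq0.
  rewrite [in X in _ || X]disjoint_sym disjoints1.
  by case: (v \in M); rewrite /= ?orbF ?andbT ?andbF.
have -> : ~: X = v |: ~: (v |: X).
  apply/setP=> x; rewrite !(in_setU1, in_setC) negb_or.
  by case: eqVneq => [->|//]; rewrite vX.
rewrite big_setU1 /=; last by rewrite !inE eqxx.
by rewrite X1 in leK2; apply: leq_add.
Qed.

Lemma index_inj (x y x' y' : 'I_n) : (x * n + y == x' * n + y') = (x == x') &&
  (y == y').
Proof.
have := ltn_ord y; have := ltn_ord y'; move: (ltn_ord x) => xn y'n yn.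
apply/eqP/andP=> [E|[/eqP-> /eqP->]//].
have n0 : 0 < n by apply: leq_ltn_trans xn.
have := congr1 (divn^~ n) E; rewrite /= !divnMDl // !divn_small // !addn0 =>
  /val_inj Ex.
by move: E; rewrite Ex => /addnI/val_inj->.
Qed.

Definition first_queue i : seq 'I_n :=
  [seq x <- take i (enum 'I_n) | size (adj x) <= D].

Lemma first_queue_uniq i : uniq (first_queue i).
Proof. by apply/filter_uniq/take_uniq/enum_uniq. Qed.

Lemma wp_load_graph (x0 : 'I_n) s : rg s vone = 1 -> rg s vN = n -> rg s vD = D
  ->
  (forall i, ar s ADJ i = 0) ->
  wp w inp len load_graph_cmd s (fun s' k =>
    [/\ forall x y : 'I_n, ar s' ADJ (x * n + y) = e x y,
        rg s' vtail = size (first_queue n),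
        forall i d, i < size (first_queue n) -> ar s' QU i = nth d (first_queue
          n) i,
        forall x : 'I_n, ar s' DEG x = size (adj x)
      & k <= \sum_x (size (adj x)).+1 * 50 + 10]).
Proof.
move=> c1 cN cD ADJ0; rewrite /load_graph_cmd; do 2 exec_step c1.
have n_gt0 : 0 < n by apply: leq_ltn_trans (ltn_ord x0).
pose nthv i := nth x0 (enum 'I_n) i.
apply: (wp_for (lo := 0) (hi := n) (B := fun i => size (adj (nthv i)) * 10 + 40)
  (Inv := fun i s1 =>
   [/\ forall x y : 'I_n, ar s1 ADJ (x * n + y) = (x < i) && e x y,
       rg s1 vtail = size (first_queue i),
       forall j d, j < size (first_queue i) -> ar s1 QU j = nth d (first_queue
         i) j
     & forall x : 'I_n, x < i -> ar s1 DEG x = size (adj x)])) => //=.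
- lia.
- by rewrite /first_queue take0 /=; split.
- move=> i s1 _ iN F s1i [inv1 inv2 inv3 inv4].
  pose v : 'I_n := Ordinal iN; have vi : nthv i = v.
    by apply: val_inj; rewrite /= nth_enum_ord.
  have [Fr Fa _] := F; have d1 : rg s1 vone = 1 by rewrite Fr.
  have dN : rg s1 vN = n by rewrite Fr.
  have dD : rg s1 vD = D by rewrite Fr.
  apply: wp_seq; apply: wp_conseq; first exact: (@wp_bounds s1 v d1 s1i).
  move=> s2 k2 F2 [s2lo s2hi ->].
  have [Fr2 Fa2 _] := F2.
  have f1 : rg s2 vone = 1 by rewrite Fr2.
  have fN : rg s2 vN = n by rewrite Fr2.
  have fD : rg s2 vD = D by rewrite Fr2.
  have fV : rg s2 vV = v by rewrite Fr2.
  have ft : rg s2 vtail = size (first_queue i) by rewrite Fr2.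
  have vrow := row_index w_large' v; have vl := adj_len v.
  have vn : v < n by [].
  rewrite /CMov; do 2 exec_step (f1, fN, fD, fV, s2lo, s2hi).
  rewrite muln1; apply: wp_seq.
  apply: (wp_for (lo := lo v) (hi := lo v + size (adj v)) (B := fun=> 4)
   (Inv := fun p s3 => forall x y : 'I_n, ar s3 ADJ (x * n + y) =
      ((x < i) && e x y) || ((x == v) && (y \in take (p - lo v) (adj v))))) =>
        //=.
  + by rewrite leq_addr.
  + lia.
  + by move=> x y; rewrite subnn take0 andbF orbF Fa2.
  + move=> p s3 lop phi F3 s3p inv.
    have [Fr3 Fa3 _] := F3; have g1 : rg s3 vone = 1 by rewrite Fr3.
    have gub : rg s3 vub = v * n by rewrite Fr3.
    have pal : p - lo v < size (adj v) by lia.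
    set u := nth v (adj v) (p - lo v).
    have inpu : inp p = u by rewrite /u -inpE // subnKC.
    have un : u < n by apply: ltn_ord.
    have vu := adj_index w_large' v u.
    do 3 exec_step (s3p, inpu, g1, gub); split=> // x y.
    rewrite (index_inj x y v u : (_ == i * n + u) = _) subSn // (take_nth v) //
      mem_rcons inE inv -/u.
    by case: (x == v); case: (y == u); rewrite ?orbT.
  move=> s3 k3 F3 s3p; rewrite addKn take_size => inv leK3.
  have [Fr3 Fa3 _] := F3.
  have E3 : (rg s3 vone = 1) * (rg s3 vhi = lo v + size (adj v)) * (rg s3 vlo =
    lo v) *
     (rg s3 vV = v) * (rg s3 vD = D) * (rg s3 vtail = size (first_queue i)).
    by rewrite !Fr3 //= f1 s2lo s2hi fV fD ft.
  have QU3 : ar s3 QU = ar s1 QU by rewrite Fa3 // Fa2.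
  have DEG3 : ar s3 DEG = ar s1 DEG by rewrite Fa3 // Fa2.
  have ADJ' : forall x y : 'I_n, ar s3 ADJ (x * n + y) = (x < i.+1) && e x y.
    move=> x y; rewrite inv; have [->|xv] := eqVneq x v.
      by rewrite /= ltnn ltnSn mem_adj.
    have nxi : (x == i :> nat) = false.
      by apply: contraNF xv => /eqP xi; apply/eqP/val_inj.
    by rewrite orbF ltnS [in RHS]leq_eqVlt nxi.
  have sq := uniq_size_le (first_queue_uniq i).
  have qS : first_queue i.+1 =
      if size (adj v) <= D then rcons (first_queue i) v else first_queue i.
    by rewrite /first_queue (take_nth x0) ?size_enum_ord // filter_rcons
      -/(nthv i) vi.
  have leK3' : k3 <= size (adj v) * 7 + 2.
    by move: leK3; rewrite sum_nat_const_nat addKn.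
  have DEG' : forall x : 'I_n, x < i.+1 ->
      (if val x == i then size (adj v) else ar s1 DEG x) = size (adj x).
    move=> x; rewrite ltnS leq_eqVlt; case: eqVneq => /= [xi _|_ xi];
      last exact: inv4.
    by congr (size (adj _)); apply: val_inj.
  do 3 exec_step E3; rewrite addKn.
  apply: wp_ifz => /= tst; rewrite /enqueue_cmd.
    have leD : size (adj v) <= D by move: tst; clear; lia.
    do 2 exec_step E3; split; first by rewrite vi; lia.
    rewrite qS leD; split=> //; last by rewrite DEG3.
      by rewrite size_rcons addn1.
    move=> j d; rewrite size_rcons ltnS leq_eqVlt nth_rcons QU3.
    by case: ltngtP => //= jU _; apply: inv3.
  have gtD : (size (adj v) <= D) = false by move: tst; clear; lia.
  exec_step E3; split; first by rewrite vi; lia.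
  by rewrite qS gtD QU3 DEG3; split.
move=> s2 k F _ [inv1 inv2 inv3 inv4] leK; split=> //.
- by move=> x y; rewrite inv1 ltn_ord.
- by move=> x; apply: inv4.
apply: (@leq_trans (\sum_(0 <= i < n) (size (adj (nthv i)) * 10 + 40 + 3) +
  10)); first by lia.
rewrite leq_add2r big_mkord; apply: leq_sum => i _.
have -> : nthv i = i by apply: val_inj; rewrite /= nth_enum_ord.
lia.
Qed.

Lemma run_main t (x0 : 'I_n) : D = t * t * 6 -> inp 0 = t -> inp 1 = n ->
  exists s k Ls,
    [/\ ev w inp len main_cmd initial_state s k, ou s = encode_output Ls,
        lists_maximal_cliques e Ls & k <= \sum_x vertex_cost x * 2 + 30].
Proof.
move=> DE inp0 inp1.
have n_gt0 : 0 < n by apply: leq_ltn_trans (ltn_ord x0).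
suff [s [k [H [Ls [ouE LsP leK]]]]] : wp w inp len main_cmd initial_state
   (fun s k => exists Ls, [/\ ou s = encode_output Ls,
      lists_maximal_cliques e Ls & k <= \sum_x vertex_cost x * 2 + 30]).
  by exists s, k, Ls.
have tD : t <= D by rewrite DE; clear; nia.
have ttD : t * t <= D by rewrite DE; clear; nia.
rewrite /main_cmd; do 7 exec_step (inp0, inp1, esym DE).
apply: wp_ifz => /= [n0|_]; first by rewrite n0 in n_gt0.
set s1 := setr _ vD _.
apply: wp_seq; apply: wp_conseq; first exact: (@wp_load_graph x0 s1).
move=> s2 k2 F2 [ADJ2 t2 QU2 DEG2 leK2].
have [Fr2 Fa2 Fo2] := F2.
have sQ := uniq_size_le (first_queue_uniq n).
do 2 exec_step t2; rewrite subn0.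
set s3 := setr _ vmore _.
pose Q := first_queue n.
have X0 : removed Q 0 = set0 by apply/setP=> x; rewrite !inE take0.
have gi : ginv s3 0 Q.
  split=> //=.
  - by split=> //; rewrite Fr2.
  - split=> // x; rewrite X0; last by rewrite DEG2 -size_adj0.
    by rewrite inE Fa2.
  - exact: first_queue_uniq.
  move=> x _; rewrite X0 mem_filter take_oversize ?size_enum_ord // mem_enum
    andbT.
  by rewrite -size_adj0.
have [s4 [k4 [Ls [it4 more4 ou4 [Ls1 Ls2 Ls3] leK4]]]] := run_vertices x0 gi
  (esym (subn0 _)).
apply: (wp_while it4) => //; exists Ls; split.
- by rewrite ou4 /= Fo2.
- split=> //; apply: uniq_perm; rewrite ?enum_uniq // => M.
  by rewrite Ls3 X0 mem_enum -setI_eq0 setI0 eqxx andbT.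
have leK2' : k2 <= \sum_x vertex_cost x + 10.
  apply: leq_trans leK2 _; rewrite leq_add2r; apply: leq_sum => x _.
  by rewrite /vertex_cost mulnC leq_mul2r; apply/orP; right;
     apply: leq_trans (leq_pmull _ Lb_gt0); rewrite -mulnn; clear; nia.
rewrite X0 setC0 in leK4; move: leK4.
rewrite (eq_bigl xpredT) => [leK4|x]; last by rewrite inE.
by rewrite -big_distrl /=; move: leK2' leK4;
  move: (\sum_x vertex_cost x) => c; clear; lia.
Qed.

End Main.

(** * Layout of the encoded input *)

Lemma foldl_addn x s : foldl addn x s = x + sumn s.
Proof. by elim: s x => [|y s IHs] x /=; rewrite ?addn0 // IHs addnA. Qed.

Lemma nth_flatten_block (T : Type) (d : T) (ss : seq (seq T)) v i :
  i < size (nth [::] ss v) ->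
  nth d (flatten ss) (sumn (take v (map size ss)) + i) = nth d (nth [::] ss v)
    i.
Proof.
elim: ss v => [|s ss IHss] [|v] //= iv; first by rewrite nth_cat iv.
by rewrite nth_cat -addnA ltnNge leq_addr /= addKn IHss.
Qed.

Lemma sumn_take_le (l : seq nat) i : sumn (take i l) <= sumn l.
Proof. by rewrite -{2}(cat_take_drop i l) sumn_cat leq_addr. Qed.

Lemma sumn_takeS (l : seq nat) i : i < size l ->
  sumn (take i.+1 l) = sumn (take i l) + nth 0 l i.
Proof. by move=> il; rewrite (take_nth 0) // sumn_rcons. Qed.

Section Input.
Variables (t n : nat) (adj : 'I_n -> seq 'I_n).

Let lists := [seq [seq val u | u <- adj v] | v <- enum 'I_n].
Let sizes := [seq size l | l <- lists].
Let input := encode_input t adj.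

Definition block_start (v : nat) : nat := n + 3 + sumn (take v sizes).

Lemma size_sizes : size sizes = n.
Proof. by rewrite 2!size_map size_enum_ord. Qed.

Lemma size_input : size input = n + 3 + sumn sizes.
Proof.
rewrite /input /encode_input size_cat /= size_scanl size_flatten -/lists
  -/sizes.
by rewrite size_sizes /shape -/sizes addn3.
Qed.

Lemma input_bound i : i <= n -> nth 0 input (i + 2) = block_start i.
Proof.
move=> ilen; rewrite /input /encode_input addn2 /= -/lists -/sizes.
case: i ilen => [|i] ilen /=; first by rewrite /block_start take0 addn0.
by rewrite nth_cat size_scanl size_sizes ilen nth_scanl ?size_sizes //
  foldl_addn.
Qed.

Lemma size_lists : size lists = n.
Proof. by rewrite size_map size_enum_ord. Qed.

Lemma nth_lists (v : 'I_n) : nth [::] lists v = [seq val u | u <- adj v].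
Proof.
rewrite (nth_map v) ?size_enum_ord //; congr (map _ (adj _)).
exact: nth_ord_enum.
Qed.

Lemma nth_sizes (v : 'I_n) : nth 0 sizes v = size (adj v).
Proof. by rewrite (nth_map [::]) ?size_lists // nth_lists size_map. Qed.

Lemma block_startS (v : 'I_n) : block_start v.+1 = block_start v + size (adj v).
Proof. by rewrite /block_start sumn_takeS ?size_sizes // nth_sizes addnA. Qed.

Lemma block_end (v : 'I_n) : block_start v + size (adj v) <= size input.
Proof. by rewrite -block_startS size_input leq_add2l sumn_take_le. Qed.

Lemma input_block (v : 'I_n) i d : i < size (adj v) ->
  nth 0 input (block_start v + i) = nth d (adj v) i.
Proof.
move=> iv; rewrite /input /encode_input -[_ :: _ :: _]/([:: t, n, n+3 & _])
  nth_cat /= size_scanl -/lists -/sizes.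
rewrite size_sizes /block_start ltnNge (_ : n.+3 <= _) /=; last by lia.
rewrite (_ : _ - _ = sumn (take v sizes) + i); last by lia.
by rewrite nth_flatten_block nth_lists ?size_map // (nth_map d).
Qed.

Lemma sumn_sizes : sumn sizes = \sum_v size (adj v).
Proof.
rewrite sumnE 2!big_map big_enum /=.
by apply: eq_bigr => v _; rewrite size_map.
Qed.

Lemma input_le i : nth 0 input i <= t + size input.
Proof.
move: size_input; move: (size input) => N NE.
rewrite /input /encode_input -/lists -/sizes; case: i => [|[|[|i]]] /=.
- exact: leq_addr.
- by rewrite NE; lia.
- by rewrite NE; lia.
rewrite nth_cat size_scanl size_sizes; case: ltnP => [iN|ni].
  rewrite nth_scanl ?size_sizes // foldl_addn NE.
  by have := sumn_take_le sizes i.+1; lia.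
have [inl|/(nth_default 0)->//] := ltnP (i - n) (size (flatten lists)).
have /flattenP[l /mapP[v _ ->] /mapP[u _ ->]] := mem_nth 0 inl.
by have := ltn_ord u; rewrite /= NE; lia.
Qed.

End Input.

Definition clique_program : program := compile_program main_cmd.

(** Two of the three factors [(t * t * 6).+1] come from the cost of a vertex and one from the sum of
    the degrees. [maxn n 1] keeps the bound positive for the empty graph. *)
Theorem clique_program_correct t n Lb (e : rel 'I_n) (adj : 'I_n -> seq 'I_n) :
  0 < t -> simple_graph e -> ~ has_immersion (@complete_graph t) e ->
  adjacency_lists e adj -> 0 < Lb ->
  (forall (S : {set 'I_n}) L, #|S| <= t * t * 6 -> branching e S L -> size L <=
    Lb) ->
  exists (L : seq (seq 'I_n)) k,
    [/\ computes clique_program ((n + t + 1) ^ 11) (encode_input t adj)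
          (encode_output L) k,
        lists_maximal_cliques e L
      & k <= maxn n 1 * (200 * 200 * Lb * (t * t * 6).+1 ^ 3)].
Proof.
move=> t0 [e_sym e_irr] no_imm adjP Lb0 Lb_le.
set D := t * t * 6 in Lb_le *; set input := encode_input t adj.
have degen (S : {set 'I_n}) : S != set0 -> exists2 x, x \in S & #|S :&: nbrs e
  x| <= D.
  move=> S0; have [/exists_inP[x xS xD]|] := boolP [exists x in S, #|S :&: nbrs
    e x| <= D].
    by exists x.
  rewrite negb_exists_in => /forall_inP degS; case: no_imm.
  apply: (immersion_of_min_degree e_sym t0 S0) => x xS.
  by rewrite (_ : 6 * t * t = D) ?ltnNge ?degS // /D; clear; lia.
have adj_size x : size (adj x) = #|nbrs e x|.
  have [adj_u adjE] := adjP x; rewrite -(card_uniqP adj_u).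
  by apply: eq_card => y; rewrite adjE inE.
pose w := (n + 5) * (n + 5) + size input + D.
have nn : \sum_v size (adj v) <= n * n.
  rewrite -[X in X * _]card_ord -sum_nat_const; apply: leq_sum => v _.
  by rewrite adj_size; apply: leq_trans (max_card _) _; rewrite card_ord.
have len_le : size input <= n * n + n + 3.
  by rewrite size_input sumn_sizes addnC -[X in _ <= X]addnA leq_add2r.
(* The memory needed is at most [512 * (M * M)], and [512 = 2 ^ 9] is absorbed by [M ^ 9] since [M]
   is at least 2. This explains the exponent 11. *)
have W_ge : 16 * w + size input + 16 + t <= (n + t + 1) ^ 11.
  set M := n + t + 1; have M2 : 2 <= M by rewrite /M; lia.
  have : 16 * w + size input + 16 + t <= 512 * (M * M).
    have : n + t + 1 = M by []; rewrite /w /D; move: len_le; clear -M2; nia.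
  have M9 : 2 ^ 9 <= M ^ 9 by rewrite leq_exp2r.
  have -> : 512 = 2 ^ 9 by rewrite !expnS; lia.
  move=> h; apply: leq_trans h _.
  have -> : M ^ 11 = M ^ 9 * (M * M) by rewrite mulnn -expnD.
  by rewrite leq_mul2r M9 orbT.
move: ((n + t + 1) ^ 11) W_ge => W W_ge.
have input_leW i : nth 0 input i <= W.
  by apply: leq_trans (input_le t adj i) _; rewrite -/input; lia.
have input1 : nth 0 input 1 = n by [].
have input0 : nth 0 input 0 = t by [].
have lenE : nth 0 input (nth 0 input 1 + 2) = size input.
  rewrite input1 input_bound // size_input /block_start take_oversize //.
  by rewrite size_sizes.
have n2W : nth 0 input 1 + 2 <= W.
  by rewrite input1; move: W_ge; rewrite /w; clear; nia.
have W_ge' : 16 * w + size input + 16 <= W.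
  by apply: leq_trans W_ge; apply: leq_addr.
have ok : arrays_ok main_cmd by [].
(* Without vertices the empty set is a maximal clique. It is written as the single number 0, its
   size. *)
have [n0|n_gt0] := posnP n.
  have [s [k [H [ouE kE]]]] : wp w (nth 0 input) (size input) main_cmd
    initial_state
      (fun s k => ou s = [:: 0] /\ k = 9).
    have len3 : 3 <= size input by rewrite size_input; lia.
    have tw : t <= w by rewrite /w /D; clear -t0; nia.
    have ttw : t * t <= w by rewrite /w /D; clear -t0; nia.
    have Dw : t * t * 6 <= w by rewrite /w /D; clear; nia.
    have nw : n <= w by rewrite /w; clear; nia.
    have w6 : 6 <= w by rewrite /w; clear; nia.
    rewrite /main_cmd; do 7 exec_step (input0, input1).
    apply: wp_ifz => /= [_|/(_ n0)//].
    by exec_step input1; split=> //; congr [:: _].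
  have [k' k'le comp] := compile_program_correct ok W_ge' input_leW n2W lenE H.
  exists [:: [::]], k'; split.
  - by rewrite ouE in comp.
  - split=> //; apply: uniq_perm; rewrite ?enum_uniq // => M.
    have M0 : M = set0 by apply/setP=> x; move: (ltn_ord x); rewrite {2}n0.
    rewrite mem_enum M0 inE; have -> : [set x in [::]] = set0 :> {set 'I_n}.
      by apply/setP=> x; rewrite !inE.
    rewrite eqxx; apply/esym/maximal_cliqueP => //; split.
      by apply/cliqueP=> x; rewrite inE.
    by move=> u; move: (ltn_ord u); rewrite {2}n0.
  rewrite n0 max0n mul1n; apply: leq_trans k'le _; rewrite kE.
  have : 0 < Lb * D.+1 ^ 3 by rewrite muln_gt0 Lb0 expn_gt0.
  by rewrite -mulnA; move: (Lb * _) => y; clear; lia.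
have n_len : n + 3 <= size input by rewrite size_input leq_addr.
have inp_lo (x : 'I_n) : nth 0 input (x + 2) = block_start adj x.
  by apply: input_bound; apply: ltnW.
have inp_hi (x : 'I_n) : nth 0 input (x + 3) = block_start adj x + size (adj x).
  by rewrite -block_startS -(input_bound t) // addSnnS.
have inp_block (x : 'I_n) i d : i < size (adj x) ->
    nth 0 input (block_start adj x + i) = nth d (adj x) i by apply: input_block.
have [s [k [L [H ouE LP leK]]]] := @run_main w (nth 0 input) (size input) n D
  Lb e adj
   (block_start adj) e_sym e_irr (leqnn _) adjP inp_lo inp_hi inp_block
   (block_end t adj) n_len degen Lb0 Lb_le t (Ordinal n_gt0) erefl input0
     input1.
have [k' k'le comp] := compile_program_correct ok W_ge' input_leW n2W lenE H.
exists L, k'; split=> //; first by rewrite -ouE.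
have deg_sum : \sum_(x : 'I_n) (size (adj x)).+1 <= (2 * D + 1) * n.
  have := sum_degree_degenerate e_sym e_irr [set: 'I_n] degen.
  rewrite cardsT card_ord (eq_bigl xpredT) => [|x]; last by rewrite inE.
  rewrite (eq_bigr (fun x => size (adj x))) => [h|x _];
    last by rewrite setTI adj_size.
  rewrite (eq_bigr (fun x => size (adj x) + 1)) => [|x _];
    last by rewrite addn1.
  by rewrite big_split /= sum_nat_const card_ord muln1 mulnDl mul1n leq_add2r.
have costE : \sum_x vertex_cost D Lb adj x * 2 <= 2000 * Lb * D.+1 ^ 2 * ((2 *
  D + 1) * n).
  apply: leq_trans (_ : 2000 * Lb * D.+1 ^ 2 * \sum_(x : 'I_n) (size (adj
    x)).+1 <= _); last first.
    by rewrite leq_mul2l deg_sum orbT.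
  rewrite big_distrr /=; apply: leq_sum => x _; rewrite /vertex_cost.
  by move: (D.+1 ^ 2) (size (adj x)) => y z; clear; nia.
have -> : maxn n 1 = n by apply/maxn_idPl.
apply: leq_trans k'le _.
have : 2000 * Lb * D.+1 ^ 2 * ((2 * D + 1) * n) <= 4000 * Lb * D.+1 ^ 3 * n.
  have -> : 4000 * Lb * D.+1 ^ 3 * n = 2000 * Lb * D.+1 ^ 2 * ((2 * D.+1) * n).
    by rewrite (expnSr _ 2); move: (D.+1 ^ 2) => y; clear; nia.
  by rewrite leq_mul2l leq_mul2r; apply/orP; right; apply/orP; right; clear;
    lia.
have : 1 <= Lb * D.+1 ^ 3 * n by rewrite 2!muln_gt0 Lb0 expn_gt0 n_gt0.
move: leK costE; move: (\sum_x _) (2000 * _ * _ * _) => S1 S2.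
have -> : n * (200 * 200 * Lb * D.+1 ^ 3) = 200 * 200 * (Lb * D.+1 ^ 3 * n) by
  clear; lia.
have -> : 4000 * Lb * D.+1 ^ 3 * n = 4000 * (Lb * D.+1 ^ 3 * n) by clear; lia.
by move: (Lb * _ * n) => y; clear; lia.
Qed.

(** * Counting the branches *)

From mathcomp Require Import all_order all_algebra.
From mathcomp Require Import ring lra.
Import Order.TTheory GRing.Theory Num.Theory.

Section Weights.
Local Open Scope ring_scope.
Variables (R : realFieldType) (c r : R).
Hypotheses (c0 : 0 < c) (r0 : 0 < r) (c3 : c ^+ 3 = 3) (r2 : r ^+ 2 = 2).

(** The values at 1, 2, 3 are [k ^ (1 / k)], the rate of [k] choices on [k] vertices when a
    component of the complement is complete. From 3 on the largest value is kept, so that the weight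
    is monotone. *)
Definition weight (k : nat) : R := if (k <= 1)%N then 1 else if k == 2 then r
  else c.

Lemma c_ge : 144 / 100 <= c.
Proof.
rewrite leNgt; apply/negP=> clt.
have : c ^+ 3 < (144 / 100) ^+ 3 by rewrite ltrXn2r // ?nnegrE ?ltW //; lra.
by rewrite c3 !exprS expr0; lra.
Qed.

Lemma r_ge : 141 / 100 <= r.
Proof.
rewrite leNgt; apply/negP=> rlt.
have : r ^+ 2 < (141 / 100) ^+ 2 by rewrite ltrXn2r // ?nnegrE ?ltW //; lra.
by rewrite r2 !exprS expr0; lra.
Qed.

Lemma r_le : r <= 142 / 100.
Proof.
rewrite leNgt; apply/negP=> rlt.
have : (142 / 100) ^+ 2 < r ^+ 2 by rewrite ltrXn2r // ?nnegrE ?ltW //; lra.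
by rewrite r2 !exprS expr0; lra.
Qed.

Lemma weight_mono j k : (j <= k)%N -> weight j <= weight k.
Proof.
have := c_ge; have := r_ge; have := r_le; rewrite /weight => ? ? ? jk.
by case: (leqP j 1) => j1; case: (leqP k 1) => k1;
   case: (eqVneq j 2) => j2; case: (eqVneq k 2) => k2; try lra; lia.
Qed.

Lemma weight_ge1 k : 1 <= weight k.
Proof. by have := weight_mono (leq0n k). Qed.

Lemma weight_ge0 k : 0 <= weight k.
Proof. exact: le_trans (ler01) (weight_ge1 k). Qed.

Lemma weight_le k : weight k <= c.
Proof.
have := c_ge; have := r_ge; have := r_le; rewrite /weight => ? ? ?.
by case: ifP => _; [lra|case: ifP => _; lra].
Qed.

(* Tight for a component of the complement that is an edge or a triangle. *)
Lemma weight_branch (V : finType) (A : {set V}) (d : V -> nat) k :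
  (1 < k)%N -> #|A| = k.-1 -> (forall a, a \in A -> (1 < d a <= k)%N) ->
  1 + \prod_(a in A) weight (d a).-1 <= weight k * \prod_(a in A) weight (d a).
Proof.
move=> k1 cardA dA; have := c_ge; have := r_ge; have := r_le => hr1 hr2 hc.
have [k2|k2] := eqVneq k 2.
  have /cards1P[a eA] : #|A| == 1 by rewrite cardA k2.
  have := dA a; rewrite eA set11 k2 => /(_ isT) da.
  by rewrite !big_set1 (_ : d a = 2) ?k2 /weight /= -?expr2 ?r2; [lra|lia].
have [k3|k3] := eqVneq k 3.
  have /cards2P[a [b [nab eA]]] : #|A| == 2 by rewrite cardA k3.
  have := dA a; have := dA b; rewrite eA set21 set22 k3 => /(_ isT) db /(_ isT)
    da.
  rewrite !big_setU1 ?inE //= !big_set1.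
  have /orP[/eqP->|/eqP->] : (d a == 2) || (d a == 3) by lia.
    have /orP[/eqP->|/eqP->] : (d b == 2) || (d b == 3) by lia.
      by rewrite /weight /=; move: r2; rewrite expr2 => ->; nra.
    rewrite /weight /= mul1r; nra.
  have /orP[/eqP->|/eqP->] : (d b == 2) || (d b == 3) by lia.
    by rewrite /weight /= mulr1; nra.
  by rewrite /weight /= -!expr2 -exprS c3 r2; lra.
(* For [k >= 4] crude estimates suffice: [A] has at least three elements, the product of their
   weights is at least [r ^ 3], and [(c - 1) * r ^ 3 >= 1]. With two elements this fails, so [k = 3]
   was treated case by case. *)
have wk : weight k = c by rewrite /weight ifF ?ifF //; lia.
have leP : \prod_(a in A) weight (d a).-1 <= \prod_(a in A) weight (d a).
  apply: ler_prod => a _; rewrite weight_mono ?leq_pred // andbT.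
  by apply: le_trans (weight_ge1 _).
have geP : r ^+ 3 <= \prod_(a in A) weight (d a).
  have : \prod_(a in A) r <= \prod_(a in A) weight (d a).
    apply: ler_prod => a aA; rewrite ltW //= /weight; have := dA a aA.
    by case: ifP => [|_ _]; [lia|case: ifP => _ //; lra].
  apply: le_trans; rewrite prodr_const cardA ler_weXn2l //; last by lia.
  by lra.
rewrite wk; have : r ^+ 3 = 2 * r by rewrite exprSr r2.
by move: (\prod_(a in A) weight (d a)) (\prod_(a in A) weight (d a).-1) leP geP
  => x y; nra.
Qed.

Lemma leq_pexp2r m n k : (m <= n)%N -> (m ^ k <= n ^ k)%N.
Proof. by case: k => // k mn; rewrite leq_exp2r. Qed.

Section Count.
Variables (V : finType) (e : rel V).
Hypotheses (e_sym : symmetric e) (e_irr : irreflexive e).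

Definition potential (S : {set V}) : R := \prod_(x in S) weight (codeg e S x).

Lemma codeg_sub (S T : {set V}) x : S \subset T -> (codeg e S x <= codeg e T
  x)%N.
Proof. by move=> sST; apply/subset_leq_card/setSD. Qed.

Lemma potential_le S : potential S <= c ^+ #|S|.
Proof.
rewrite -prodr_const; apply: ler_prod => x _.
by rewrite weight_le weight_ge0.
Qed.

Lemma prod_weight_ge1 (S : {set V}) (f : V -> nat) :
  1 <= \prod_(x in S) weight (f x).
Proof.
by elim/big_rec: _ => // x y _ y1; rewrite -[1]mulr1 ler_pM ?weight_ge1.
Qed.

(** Let [A] be the other non-neighbours of [w]. Excluding [w] lowers the codegree of each vertex of
    [A] by one; including [w] discards [A]. The neighbours of [w] contribute a common factor, and
    what is left is [weight_branch]; its upper bound on codegrees is the choice of [w]. *)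
Lemma potential_branch (S : {set V}) w : ~~ clique e S -> w \in S ->
  (forall x, x \in S -> codeg e S x <= codeg e S w)%N ->
  potential (S :&: nbrs e w) + potential (S :\ w) <= potential S.
Proof.
move=> S_ncl wS w_max; pose A := (S :\: nbrs e w) :\ w.
have wA : w \in S :\: nbrs e w by rewrite !inE e_irr.
have cw : codeg e S w = #|A|.+1 by rewrite /codeg (cardsD1 w) wA.
have cw1 : (1 < codeg e S w)%N.
  move: S_ncl; rewrite clique_codeg // negb_forall_in => /existsP[x /andP[xS]].
  by rewrite -ltnNge => /leq_trans; apply; apply: w_max.
have AP a : a \in A -> [/\ a \in S, a != w & ~~ e w a].
  by rewrite !inE => /and3P[-> -> ->].
have split_prod (f : V -> R) : \prod_(x in S :\ w) f x =
    (\prod_(x in A) f x) * \prod_(x in S :&: nbrs e w) f x.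
  rewrite (big_setID (nbrs e w)) /= mulrC; congr (_ * _); apply: eq_bigl => x.
    by rewrite !inE andbCA.
  by rewrite !inE; case: (eqVneq x w) => [->|_] /=; rewrite ?e_irr ?andbF //.
have P2 : potential (S :\ w) <= (\prod_(a in A) weight (codeg e S a).-1) *
    \prod_(x in S :&: nbrs e w) weight (codeg e S x).
  rewrite /potential split_prod; apply: ler_pM.
  - by apply: prodr_ge0 => x _; apply: weight_ge0.
  - by apply: prodr_ge0 => x _; apply: weight_ge0.
  - apply: ler_prod => a /AP[aS aw nwa]; rewrite weight_ge0 /=.
    apply: weight_mono; rewrite {2}/codeg (cardsD1 w) !inE e_sym nwa wS /=.
    by apply/subset_leq_card/subsetP=> x; rewrite !inE => /and3P[-> -> ->].
  apply: ler_prod => x _; rewrite weight_ge0 /=.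
  by apply: weight_mono; apply: codeg_sub; apply: subD1set.
have P1 : potential (S :&: nbrs e w) <=
    \prod_(x in S :&: nbrs e w) weight (codeg e S x).
  apply: ler_prod => x _; rewrite weight_ge0 /=.
  by apply: weight_mono; apply: codeg_sub; apply: subsetIl.
have PS : potential S = weight (codeg e S w) * (\prod_(a in A) weight (codeg e
  S a)) *
    \prod_(x in S :&: nbrs e w) weight (codeg e S x).
  by rewrite /potential (big_setD1 w) //= split_prod mulrA.
have key := @weight_branch _ A (codeg e S) _ cw1 _ _.
rewrite PS; apply: le_trans (lerD P1 P2) _.
rewrite -[X in X + _]mul1r -mulrDl ler_wpM2r //.
  by apply: le_trans (prod_weight_ge1 _ _).
apply: key; first by rewrite cw.
move=> a /AP[aS aw nwa]; rewrite w_max // andbT.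
rewrite /codeg (cardsD1 w) !inE e_sym nwa wS /= (cardsD1 a).
by rewrite !inE aw e_irr aS.
Qed.

Lemma branching_size S L : branching e S L -> (size L)%:R <= potential S.
Proof.
elim=> {S L} [S _|S w L1 L2 S_ncl wS w_max _ IH1 _ IH2].
  exact: prod_weight_ge1.
rewrite size_cat size_map natrD addrC.
exact: le_trans (lerD IH1 IH2) (potential_branch S_ncl wS w_max).
Qed.

(** Above size [t'] an inclusion multiplies the size by less than [1 - 1 / s], so by the last
    hypothesis at most [a] inclusions occur before size [t'] is reached. The factor [#|S|.+1 ^ a]
    bounds the ways to place them among the exclusions. *)
Lemma branching_size_peel (s t' a : nat) S L : (0 < s)%N ->
  (forall S : {set V}, (t' < #|S|)%N ->
     exists2 x, x \in S & (#|S| < s * codeg e S x)%N) ->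
  branching e S L -> (#|S| * s.-1 ^ a <= t' * s ^ a)%N ->
  (size L)%:R <= (#|S|.+1 ^ a)%:R * c ^+ t'.
Proof.
move=> s0 peel; have c1 : 1 <= c by have := c_ge; lra.
have cn k : 0 <= c ^+ k by rewrite exprn_ge0 // ltW.
elim: a S L => [|a IHa] S L bSL leS.
  rewrite expn0 mul1r; apply: le_trans (branching_size bSL) _.
  by apply: le_trans (potential_le S) _; rewrite ler_weXn2l //; lia.
elim: bSL leS => {S L} [S _|S w L1 L2 S_ncl wS w_max b1 _ b2 IH2] leS.
  apply: (@le_trans _ _ (1 * 1)); first by rewrite mulr1.
  by rewrite ler_pM // ?exprn_ege1 // ler1n expn_gt0.
have [leSt|ltSt] := leqP #|S| t'.
  apply: le_trans (branching_size (BranchNode S_ncl wS w_max b1 b2)) _.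
  apply: le_trans (potential_le S) _; apply: (@le_trans _ _ (1 * c ^+ t')).
    by rewrite mul1r ler_weXn2l.
  by rewrite ler_wpM2r // ler1n expn_gt0.
have [x xS xP] := peel S ltSt.
have cwS : (#|S| < s * codeg e S w)%N.
  by apply: leq_trans xP _; rewrite leq_mul2l w_max ?orbT.
have cardN : (#|S :&: nbrs e w| + codeg e S w = #|S|)%N by rewrite /codeg
  cardsID.
have codeg_gt0 : (0 < codeg e S w)%N by move: cwS; clear;
  case: (codeg _ _ _) => //; lia.
have cardD : (#|S :\ w|.+1 = #|S|)%N by rewrite (cardsD1 w S) wS.
have leL1 : (size L1)%:R <= (#|S| ^ a)%:R * c ^+ t'.
  apply: le_trans (IHa _ _ b1 _) _.
    rewrite -(leq_pmul2r s0) -[X in (_ <= X)%N]mulnA -expnSr.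
    apply: leq_trans leS; rewrite expnS.
    have : (#|S :&: nbrs e w| * s <= #|S| * s.-1)%N by nia.
    by move/(leq_mul (leqnn (s.-1 ^ a))); nia.
  by rewrite ler_wpM2r // ler_nat leq_pexp2r //; lia.
have leL2 : (size L2)%:R <= (#|S| ^ a.+1)%:R * c ^+ t'.
  have := IH2; rewrite cardD; apply; apply: leq_trans leS.
  by rewrite leq_mul2r -cardD leqnSn orbT.
(* With [N = #|S|], exclusion gives at most [N ^ a.+1] and inclusion at most [N ^ a], in total
   [N ^ a * N.+1]. *)
rewrite size_cat size_map natrD; apply: le_trans (lerD leL2 leL1) _.
rewrite -mulrDl ler_wpM2r // -natrD ler_nat.
rewrite !expnS -[X in (_ + X)%N]mul1n -mulnDl addn1 leq_mul2l.
by rewrite leq_pexp2r ?orbT.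
Qed.

End Count.
End Weights.

(** * Conclusion *)

From mathcomp Require Import all_classical all_reals all_analysis.
Import numFieldNormedType.Exports.

Lemma expn_bernoulli u k : u ^ k.+1 + k.+1 * u ^ k <= u.+1 ^ k.+1.
Proof.
elim: k => [|k IHk]; first by rewrite !expn1 expn0; lia.
rewrite [leqRHS]expnS; apply: leq_trans (leq_mul (leqnn u.+1) IHk).
by rewrite !expnS; move: (u ^ k) => x; nia.
Qed.

(** In terms of [branching_size_peel]: [s] inclusions at least halve the set. *)
Lemma expn_double s : 0 < s -> 2 * s.-1 ^ s <= s ^ s.
Proof.
case: s => // u _; apply: leq_trans (expn_bernoulli u u).
by rewrite expnS /=; move: (u ^ u) => x; nia.
Qed.

(** Rounding up the root at most doubles it, whence [16 = 2 ^ 4]. Positivity is kept also for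
    [t = 0]. *)
Lemma fourth_root t : exists z, [/\ 0 < z, t <= z ^ 4 & 0 < t -> z ^ 4 <= 16 *
  t].
Proof.
have ex : exists z, (0 < z) && (t <= z ^ 4).
  exists t.+1; rewrite /= !expnS expn0; nia.
case: (ex_minnP ex) => z /andP[z0 tz] z_min; exists z; split=> // t0.
case: z z0 tz z_min => // [[|z]] _ tz z_min; first by rewrite exp1n; lia.
have : z.+1 ^ 4 < t.
  by rewrite ltnNge; apply/negP=> zt; have := z_min z.+1;
    rewrite zt ltnn => /(_ isT).
have : z.+2 ^ 4 <= (2 * z.+1) ^ 4 by rewrite leq_exp2r //; lia.
rewrite expnMn (_ : 2 ^ 4 = 16) //; lia.
Qed.

(** From [z < 2 ^ z]: so [8 * z + 3] halvings bring a set of [6 t^2] vertices down to one. This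
    wasteful bound on the logarithm is affordable for the chosen [z]. *)
Lemma square_le_exp t z : t <= z ^ 4 -> t * t * 6 < 2 ^ (8 * z + 3).
Proof.
move=> tz; have zt : t <= 2 ^ (4 * z).
  apply: leq_trans tz _; rewrite mulnC expnM leq_exp2r //.
  by apply: ltnW; apply: ltn_expl.
have := leq_mul zt zt; rewrite -expnD (_ : 4 * z + 4 * z = 8 * z); last by lia.
rewrite expnD (_ : 2 ^ 3 = 8) //; have : 0 < 2 ^ (8 * z) by rewrite expn_gt0.
by move: (2 ^ _) => x; lia.
Qed.

(** The first exponent is the number of inclusions, [z + 4] for each of [8 * z + 3] halvings. The
    second is one third of the threshold size, rounded up. *)
Definition clique_bound (t z : nat) : nat :=
  (t * t * 6).+1 ^ ((z + 4) * (8 * z + 3)) * 3 ^ (t * (z + 4) %/ z %/ 3).+1.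

(* By [dense_set_immersion] with [m = #|S| / (z + 4)], a set of more than
   [t * (z + 4) / z] vertices contains a vertex with many non-neighbours. *)
Lemma sparse_vertex t z (V : finType) (e : rel V) (S : {set V}) : 0 < z ->
  simple_graph e -> ~ has_immersion (@complete_graph t) e ->
  t * (z + 4) %/ z < #|S| ->
  exists2 x, x \in S & #|S| < (z + 4) * codeg e S x.
Proof.
move=> z0 [e_sym e_irr] no_imm tS.
have [/exists_inP[x xS xP]|] := boolP [exists x in S, #|S| < (z + 4) * codeg e
  S x].
  by exists x.
rewrite negb_exists_in => /forall_inP noS; case: no_imm.
apply: (@dense_set_immersion _ e t (#|S| %/ (z + 4)) S) => // [x xS|].
  by rewrite leq_divRL ?addn4 // mulnC -addn4 leqNgt noS.
rewrite ltn_divLR // in tS.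
have arith N m : t * (z + 4) < N * z -> m * (z + 4) <= N -> t + 4 * m <= N by
  nia.
exact: arith tS (leq_trunc_div _ _).
Qed.

Lemma branching_clique_bound (R : realType) t z (V : finType) (e : rel V)
    (S : {set V}) L :
  0 < t -> 0 < z -> t <= z ^ 4 -> simple_graph e ->
  ~ has_immersion (@complete_graph t) e ->
  #|S| <= t * t * 6 -> branching e S L -> size L <= clique_bound t z.
Proof.
move=> t0 z0 tz e_simple no_imm leS bL; have [e_sym e_irr] := e_simple.
pose c : R := powR 3 3^-1; pose r : R := Num.sqrt 2.
have c0 : (0 < c)%R by apply: powR_gt0; rewrite ltr0n.
have r0 : (0 < r)%R by rewrite sqrtr_gt0 ltr0n.
have c3 : (c ^+ 3 = 3)%R.
  by rewrite -powR_mulrn ?powR_ge0 // -powRrM mulVf ?powRr1 ?ler0n // pnatr_eq0.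
have r2 : (r ^+ 2 = 2)%R by rewrite sqr_sqrtr // ler0n.
set t' := t * (z + 4) %/ z.
have t'0 : 0 < t' by rewrite divn_gt0 //; nia.
have peel (T : {set V}) : t' < #|T| -> exists2 x, x \in T & #|T| < (z + 4) *
  codeg e T x.
  exact: sparse_vertex.
have leS' : #|S| * (z + 4).-1 ^ ((z + 4) * (8 * z + 3)) <=
    t' * (z + 4) ^ ((z + 4) * (8 * z + 3)).
  apply: (@leq_trans (2 ^ (8 * z + 3) * (z + 4).-1 ^ ((z + 4) * (8 * z + 3)))).
    rewrite leq_mul2r; apply/orP; right; apply: leq_trans leS _.
    by apply: ltnW; apply: square_le_exp.
  rewrite !expnM -expnMn; apply: leq_trans (leq_pmull _ t'0).
  by rewrite leq_exp2r ?addn3 // expn_double // addn4.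
have s0 : 0 < z + 4 by rewrite addn4.
have := branching_size_peel c0 r0 c3 r2 e_sym e_irr s0 peel bL leS'.
move/le_trans => size_le; rewrite -(ler_nat R); apply: size_le.
have c1 : (1 <= c)%R by have := c_ge c0 c3; lra.
rewrite /clique_bound -/t' natrM; apply: ler_pM; rewrite ?ler0n ?exprn_ge0 //.
- exact: ltW.
- by rewrite ler_nat leq_exp2r ?muln_gt0 ?addn4 ?addn3.
rewrite natrX -c3 -exprM; apply: ler_weXn2l => //.
by rewrite {1}(divn_eq t' 3); have := ltn_pmod t' (isT : 0 < 3); lia.
Qed.

(** * Estimates of the exponent *)

Section Estimates.
Local Open Scope classical_set_scope.
Local Open Scope ring_scope.
Variable R : realType.

Lemma exp_nat_powR (x : R) (E : nat) : E%:R <= x -> (3 ^ E)%:R <= 3 `^ x.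
Proof.
move=> Ex; rewrite natrX -powR_mulrn ?ler0n //.
by apply: ler_powR => //; rewrite ler1n.
Qed.

(** The quotient is [C / z t], and [z t] is at least the fourth root of [t]. *)
Lemma cvg_over_root (C : R) (z : nat -> nat) : 0 < C -> (forall t, 0 < z t)%N ->
  (forall t, t <= z t ^ 4)%N ->
  (C * t%:R / (z t)%:R) / t%:R @[t --> \oo] --> (0 : R).
Proof.
move=> C0 z0 tz; apply/cvgrPdist_lt => eps eps0.
pose m := (Num.truncn (C / eps)).+1.
have mP : C / eps < m%:R by rewrite /m; apply: truncnS_gt.
exists (m ^ 4).+1 => // t /= mt.
have t0 : (0 < t)%N by apply: leq_trans mt.
have mz : (m < z t)%N.
  by rewrite -(ltn_exp2r _ _ (isT : 0 < 4)%N); apply: leq_trans mt (tz t).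
have zR : 0 < (z t)%:R :> R by rewrite ltr0n.
have tR : 0 < t%:R :> R by rewrite ltr0n.
rewrite sub0r normrN mulrAC mulfK ?gt_eqF // ger0_norm;
  last by rewrite ltW // divr_gt0.
rewrite ltr_pdivrMr // mulrC -ltr_pdivrMr //; apply: lt_trans mP _.
by rewrite ltr_nat.
Qed.

Lemma cube_le (t z : nat) : (0 < z)%N -> (z ^ 4 <= 16 * t)%N ->
  (z ^ 3)%:R <= 16 * t%:R / z%:R :> R.
Proof.
move=> z0 zt; by rewrite ler_pdivlMr ?ltr0n // -(natrM _ 16) -natrM -expnSr
  ler_nat.
Qed.

(** All factors except the last power of 3 are bounded by powers of 2 whose exponents sum to at most
    [712 * z ^ 3], hence to [712 * 16 * t / z]. The threshold contributes at most [2 * t / z] beyond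
    [t / 3], and rounding up at most [16 * t / z]; [120 * 100] exceeds the total. *)
Lemma time_bound (t z n : nat) : (0 < t)%N -> (0 < z)%N -> (t <= z ^ 4)%N ->
  (z ^ 4 <= 16 * t)%N ->
  (maxn n 1 * (200 * 200 * clique_bound t z * (t * t * 6).+1 ^ 3))%:R <=
    (maxn n 1)%:R * 3 `^ (t%:R / 3 + 120 * 100 * t%:R / z%:R) :> R.
Proof.
move=> t0 z0 tz zt; rewrite natrM ler_wpM2l ?ler0n //.
pose b := (t * (z + 4) %/ z %/ 3)%N; pose a := ((z + 4) * (8 * z + 3))%N.
apply: (@le_trans _ _ (3 ^ (16 + (8 * z + 3) * (a + 3) + b.+1))%:R).
  rewrite ler_nat /clique_bound -/a -/b.
  have le3 k : (2 ^ k <= 3 ^ k)%N by case: k => // k; rewrite leq_exp2r.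
  have D_le k : ((t * t * 6).+1 ^ k <= 2 ^ ((8 * z + 3) * k))%N.
    by rewrite expnM; case: k => // k; rewrite leq_exp2r // square_le_exp.
  have c_le : (200 * 200 <= 2 ^ 16)%N.
    by rewrite (_ : 16 = 8 + 8)%N // expnD; apply: leq_mul.
  have := leq_mul c_le (leq_mul (D_le a) (D_le 3%N)).
  have -> : (2 ^ 16 * (2 ^ ((8 * z + 3) * a) * 2 ^ ((8 * z + 3) * 3)) =
             2 ^ (16 + (8 * z + 3) * (a + 3)))%N by rewrite -!expnD -mulnDr.
  move=> /leq_trans/(_ (le3 _)) h.
  rewrite [leqRHS]expnD; apply: leq_trans (leq_mul h (leqnn _)).
  by move: ((t * t * 6).+1 ^ a)%N ((t * t * 6).+1 ^ 3)%N (3 ^ b.+1)%N => x y u;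
    lia.
apply: exp_nat_powR.
have zR : 0 < z%:R :> R by rewrite ltr0n.
have z1 : 1 <= z%:R :> R by rewrite ler1n.
have bz : b%:R * 3 * z%:R <= t%:R * (z%:R + 4) :> R.
  rewrite -[4]/(4%:R) -!(natrM, natrD) ler_nat.
  by rewrite /b; have := leq_trunc_div (t * (z + 4) %/ z) 3;
     have := leq_trunc_div (t * (z + 4)) z; nia.
have bt : b%:R <= t%:R / 3 + 2 * (t%:R / z%:R) :> R.
  have t_eq : t%:R = t%:R / z%:R * z%:R :> R by rewrite divfK // gt_eqF.
  rewrite -(ler_pM2r zR); have tz0 : 0 <= t%:R :> R by rewrite ler0n.
  rewrite mulrDl -[2 * _ * _]mulrA -t_eq; lra.
have cube := cube_le z0 zt.
have expo : (16 + (8 * z + 3) * (a + 3) <= 712 * z ^ 3)%N.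
  rewrite /a !expnS expn0 muln1; move: z0; clear; nia.
have one : 1 <= 16 * t%:R / z%:R :> R.
  by apply: le_trans cube; rewrite ler1n expn_gt0 z0.
have expoR : (16 + (8 * z + 3) * (a + 3))%:R <= 712 * (z ^ 3)%:R :> R.
  by rewrite -(natrM _ 712) ler_nat.
rewrite natrD -natr1; move: expoR cube bt one; rewrite -!mulrA.
move: (16 + _)%:R (z ^ 3)%:R (t%:R / z%:R) => x y q; lra.
Qed.

End Estimates.

Local Open Scope classical_set_scope.
Local Open Scope ring_scope.

Theorem theorem1p3 (R : realType) :
  (exists (p : program) (c : nat) (f : nat -> R),
     (f t / t%:R @[t --> \oo] --> (0 : R)) /\
     forall (t n : nat) (e : rel 'I_n) (adj : 'I_n -> seq 'I_n),
       (0 < t)%N -> simple_graph e -> ~ has_immersion (@complete_graph t) e ->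
       adjacency_lists e adj ->
       exists (L : seq (seq 'I_n)) (k : nat),
         [/\ computes p ((n + t + 1) ^ c)%N (encode_input t adj)
               (encode_output L) k,
             lists_maximal_cliques e L
           & k%:R <= (maxn n 1)%:R * 3 `^ (t%:R / 3 + f t)]) /\
  (exists (g : nat -> R) (t0 : nat),
     (g t / t%:R @[t --> \oo] --> (0 : R)) /\
     forall t n : nat, (t0 <= t)%N -> (t <= n)%N ->
       exists e : rel 'I_n,
         [/\ simple_graph e, ~ has_immersion (@complete_graph t) e
           & n%:R * 3 `^ (t%:R / 3 - g t) <= #|maximal_cliques e|%:R]).
Proof.
have [z zP] := choice fourth_root.
have z0 t : (0 < z t)%N by case: (zP t).
have tz t : (t <= z t ^ 4)%N by case: (zP t).
have zt t : (0 < t)%N -> (z t ^ 4 <= 16 * t)%N by case: (zP t).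
have C0 : 0 < 120 * 100 :> R by lra.
have lim := cvg_over_root C0 z0 tz.
split.
  exists clique_program, 11%N, (fun t => 120 * 100 * t%:R / (z t)%:R); split=> //.
  move=> t n e adj t0 e_simple no_imm adjP.
  have [|S L leS bL|L [k [comp LP leK]]] :=
    @clique_program_correct t n (clique_bound t (z t)) e adj t0 e_simple no_imm adjP.
  - by rewrite muln_gt0 !expn_gt0.
  - exact: (branching_clique_bound R t0 (z0 t) (tz t) e_simple no_imm leS bL).
  exists L, k; split=> //; apply: le_trans (time_bound R n t0 (z0 t) (tz t) (zt t t0)).
  by rewrite ler_nat.
(* The same error function serves for the lower bound, where [t >= 4] guarantees at least one part
   of size 3. *)
exists (fun t => 120 * 100 * t%:R / (z t)%:R), 4%N; split=> // t n t4 tn.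
have [e [e_simple no_imm [q [tq cliques]]]] := many_maximal_cliques t4 tn.
exists e; split=> //; set g : R := 120 * 100 * _ / _.
have t0 : (0 < t)%N by apply: leq_trans t4.
(* The polynomial loss in the number of cliques is absorbed by the error term, using [6 <= 3 ^ 2]
   and [t <= z ^ 4 <= 3 ^ (4 * z)]. *)
have le_g : (6 * t)%:R <= 3 `^ g.
  apply: (@le_trans _ _ (3 ^ (2 + 4 * z t))%:R).
    rewrite ler_nat expnD mulnC [leqRHS]mulnC; apply: leq_mul => //.
    apply: leq_trans (tz t) _; rewrite [(4 * _)%N]mulnC expnM leq_exp2r //.
    by apply: ltnW; apply: ltn_expl.
  apply: exp_nat_powR; have := cube_le R (z0 t) (zt t t0).
  have : (2 + 4 * z t <= 6 * z t ^ 3)%N.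
    by rewrite !expnS expn0 muln1; have := z0 t; nia.
  rewrite -(ler_nat R) (natrM _ 6) => h1 h2; apply: le_trans h1 _.
  have h0 : 0 <= (z t ^ 3)%:R :> R by rewrite ler0n.
  by rewrite /g; move: h2; rewrite -!mulrA; move: (t%:R / _) => y; lra.
have le_q : 3 `^ (t%:R / 3) <= (3 ^ q)%:R :> R.
  rewrite natrX -powR_mulrn ?ler0n //; apply: ler_powR; first by rewrite ler1n.
  by rewrite ler_pdivrMr ?ltr0n // -(natrM _ _ 3) ler_nat mulnC.
have g_gt0 : 0 < 3 `^ g :> R by rewrite powR_gt0 ?ltr0n.
rewrite powRB; last by rewrite pnatr_eq0 implybT.
rewrite mulrA ler_pdivrMr //.
apply: (@le_trans _ _ (n * 3 ^ q)%:R).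
  by rewrite natrM ler_wpM2l ?ler0n.
apply: (@le_trans _ _ (6 * t * #|maximal_cliques e|)%:R); first by rewrite ler_nat.
by rewrite natrM mulrC ler_wpM2l ?ler0n.
Qed.
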